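(* Let $n\ge2$, let $\Gamma$ be an $(n-1)$-$\operatorname{DTr}$-selfinjective algebra and let $Q$ be an $(n-2)$-self-orthogonal $(n-1)$-$\operatorname{DTr}$-closed generator-cogenerator of $\Gamma$-mod. Let $\Sigma=\operatorname{End}^{op}(Q)$. Then $Q^{\perp_{n-2}}={}^{\perp_{n-2}}Q$, and the functor $\operatorname{Hom}_\Gamma(Q,-)$ gives an equivalence between $Q^{\perp_{n-2}}$ and $Gproj(\Sigma)$.
   Context: All algebras are artin $R$-algebras over a fixed commutative artin ring $R$; modules are finitely generated left modules; $D$ is the standard duality. $\operatorname{add}M$ is the class of direct summands of finite direct sums of copies of $M$. $\operatorname{End}^{op}(Q)$ is the opposite endomorphism algebra, so $\operatorname{Hom}_\Gamma(Q,X)$ is a left $\operatorname{End}^{op}(Q)$-module. $Gproj(\Sigma)$ is the category of finitely generated Gorenstein projective $\Sigma$-modules. For a $\Gamma$-module $Q$ and $m\ge0$: $Q^{\perp_m}=\{M\in\Gamma\text{-mod}: \operatorname{Ext}^i(Q,M)=0\ \forall\,1\le i\le m\}$ and ${}^{\perp_m}Q=\{M\in\Gamma\text{-mod}: \operatorname{Ext}^i(M,Q)=0\ \forall\,1\le i\le m\}$ (full subcategories; for $m=0$ both are $\Gamma$-mod). $Q$ is $m$-self-orthogonal if $\operatorname{Ext}^i(Q,Q)=0$ for $1\le i\le m$. Let $\tau,\tau^-$ be the Auslander–Reiten translation and its quasi-inverse, $\Omega,\Omega^{-1}$ the syzygy and cosyzygy functors; for $m\ge1$, $\tau^m=\tau\,\Omega^{m-1}$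 and $\tau^{-m}=\tau^-\,\Omega^{-(m-1)}$. A basic artin algebra $\Gamma$ is $(n-1)$-$\operatorname{DTr}$-selfinjective if there is a basic $\Gamma$-module $Q$ such that (1) $Q$ is a generator-cogenerator (i.e. $\Gamma\oplus D(\Gamma_\Gamma)\in\operatorname{add}Q$); (2) $Q$ is $(n-2)$-self-orthogonal; (3) $\tau^{n-1}Q\oplus\tau^{-(n-1)}Q\in\operatorname{add}Q$. Such a $Q$ is called an $(n-2)$-self-orthogonal $(n-1)$-$\operatorname{DTr}$-closed generator-cogenerator. *)

(* Defs.v *)
From HB Require Import structures.
From mathcomp Require Import all_boot all_order all_algebra.
From mathcomp Require Import boolp classical_sets.

Set Implicit Arguments.
Unset Strict Implicit.
Unset Printing Implicit Defensive.

Import GRing.Theory.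
Local Open Scope ring_scope.
Local Open Scope classical_set_scope.

(** * Homomorphism groups *)

Definition Hom (A : pzRingType) (U V : lmodType A) : Type := {linear U -> V}.

HB.instance Definition _ (A : pzRingType) (U V : lmodType A) :=
  gen_eqMixin (Hom U V).
HB.instance Definition _ (A : pzRingType) (U V : lmodType A) :=
  gen_choiceMixin (Hom U V).

Section HomGroup.
Context (A : pzRingType) (U V : lmodType A).

Lemma linear_ext (f g : {linear U -> V}) : f =1 g -> f = g.
Proof.
case: f => f [[[f0 fD]] [fZ]]; case: g => g [[[g0 gD]] [gZ]] /= fg.
have e : f = g by apply/funext.
subst g.
rewrite (Prop_irrelevance f0 g0) (Prop_irrelevance fD gD).
by rewrite (Prop_irrelevance fZ gZ).
Qed.

Definition hom_zero : Hom U V := \0 : {linear U -> V}.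
Definition hom_add (f g : Hom U V) : Hom U V :=
  (f : {linear U -> V}) \+ (g : {linear U -> V}) : {linear U -> V}.
Definition hom_opp (f : Hom U V) : Hom U V :=
  \- (f : {linear U -> V}) : {linear U -> V}.

Fact hom_addA : associative hom_add.
Proof. by move=> f g h; apply: linear_ext => x /=; rewrite addrA. Qed.
Fact hom_addC : commutative hom_add.
Proof. by move=> f g; apply: linear_ext => x /=; rewrite addrC. Qed.
Fact hom_add0 : left_id hom_zero hom_add.
Proof. by move=> f; apply: linear_ext => x /=; rewrite add0r. Qed.
Fact hom_addN : left_inverse hom_zero hom_opp hom_add.
Proof. by move=> f; apply: linear_ext => x /=; rewrite addNr. Qed.

HB.instance Definition _ :=
  GRing.isZmodule.Build (Hom U V) hom_addA hom_addC hom_add0 hom_addN.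

End HomGroup.

(** * The ring [End^op(Q)] and the left [End^op(Q)]-module [Hom(Q, X)]

    The product [s * t] is "first [s], then [t]". *)

Definition EndOp (A : pzRingType) (Q : lmodType A) : Type := Hom Q Q.

Section EndOpRing.
Context (A : pzRingType) (Q : lmodType A).

HB.instance Definition _ := GRing.Zmodule.on (EndOp Q).

Definition endop_one : EndOp Q := idfun : {linear Q -> Q}.
Definition endop_mul (s t : EndOp Q) : EndOp Q :=
  (t : {linear Q -> Q}) \o (s : {linear Q -> Q}) : {linear Q -> Q}.

Fact endop_mulA : associative endop_mul.
Proof. by move=> f g h; apply: linear_ext. Qed.
Fact endop_mul1r : left_id endop_one endop_mul.
Proof. by move=> f; apply: linear_ext. Qed.
Fact endop_mulr1 : right_id endop_one endop_mul.
Proof. by move=> f; apply: linear_ext. Qed.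
Fact endop_mulDl : left_distributive endop_mul +%R.
Proof. by move=> f g h; apply: linear_ext => x /=; rewrite linearD. Qed.
Fact endop_mulDr : right_distributive endop_mul +%R.
Proof. by move=> f g h; apply: linear_ext. Qed.

HB.instance Definition _ := GRing.Zmodule_isPzRing.Build (EndOp Q)
  endop_mulA endop_mul1r endop_mulr1 endop_mulDl endop_mulDr.

End EndOpRing.

(* The group [Hom Q X]; the separate name carries the module structure. *)
Definition HomQ (A : pzRingType) (Q X : lmodType A) : Type := Hom Q X.

Section HomQModule.
Context (A : pzRingType) (Q X : lmodType A).

HB.instance Definition _ := GRing.Zmodule.on (HomQ Q X).

Definition homQ_scale (s : EndOp Q) (f : HomQ Q X) : HomQ Q X :=
  (f : {linear Q -> X}) \o (s : {linear Q -> Q}) : {linear Q -> X}.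

Fact homQ_scaleA (s t : EndOp Q) (f : HomQ Q X) :
  homQ_scale s (homQ_scale t f) = homQ_scale (s * t) f.
Proof. by apply: linear_ext. Qed.
Fact homQ_scale1 : left_id 1 homQ_scale.
Proof. by move=> f; apply: linear_ext. Qed.
Fact homQ_scaleDr : right_distributive homQ_scale +%R.
Proof. by move=> s f g; apply: linear_ext. Qed.
Fact homQ_scaleDl (f : HomQ Q X) :
  {morph homQ_scale^~ f : s t / s + t}.
Proof. by move=> s t; apply: linear_ext => x /=; rewrite linearD. Qed.

HB.instance Definition _ := GRing.Zmodule_isLmodule.Build (EndOp Q) (HomQ Q X)
  homQ_scaleA homQ_scale1 homQ_scaleDr homQ_scaleDl.

End HomQModule.

Section HomQMap.
Context (A : pzRingType) (Q X Y : lmodType A) (f : {linear X -> Y}).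

Definition homQ_map_fun (g : HomQ Q X) : HomQ Q Y :=
  f \o (g : {linear Q -> X}) : {linear Q -> Y}.

Fact homQ_map_linear : linear homQ_map_fun.
Proof. by move=> s g h; apply: linear_ext => x /=; rewrite linearD. Qed.

HB.instance Definition _ :=
  GRing.isLinear.Build (EndOp Q) (HomQ Q X) (HomQ Q Y) _ homQ_map_fun
    homQ_map_linear.

Definition homQ_map : {linear HomQ Q X -> HomQ Q Y} := homQ_map_fun.

End HomQMap.

(** * Right modules and change of scalars

    A right [A]-module is a left module over the converse ring [A^c]. *)

HB.instance Definition _ (R : pzRingType) (V : lmodType R) :=
  GRing.Zmodule_isLmodule.Build R V^c
    (@scalerA R V) (@scale1r R V) (@scalerDr R V) (@scalerDl R V).

Fact converse_scalerAr (R : pzRingType) (A : algType R) (k : R) (x y : A^c) :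
  k *: (x * y) = x * (k *: y).
Proof. exact: (@scalerAl R A). Qed.
Fact converse_scalerAl (R : pzRingType) (A : algType R) (k : R) (x y : A^c) :
  k *: (x * y) = (k *: x) * y.
Proof. exact: (@scalerAr R A). Qed.

HB.instance Definition _ (R : pzRingType) (A : algType R) :=
  GRing.Lmodule_isLalgebra.Build R A^c (@converse_scalerAl R A).
HB.instance Definition _ (R : pzRingType) (A : algType R) :=
  GRing.Lalgebra_isAlgebra.Build R A^c (@converse_scalerAr R A).

(* [A^c^c] and [A] are the same ring, but the unifier does not identify them;
   [unconv] turns a left [A^c^c]-module into the same left [A]-module. *)
Definition unconv (A : pzRingType) (M : lmodType A^c^c) : Type := M.

Section Unconv.
Context (A : pzRingType) (M : lmodType A^c^c).

HB.instance Definition _ := GRing.Zmodule.on (unconv M).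

Definition unconv_scale (a : A) (x : unconv M) : unconv M :=
  (a : A^c^c) *: (x : M).

Fact unconv_scaleA a b x :
  unconv_scale a (unconv_scale b x) = unconv_scale (a * b) x.
Proof. exact: (@scalerA A^c^c M). Qed.
Fact unconv_scale1 : left_id 1 unconv_scale.
Proof. exact: (@scale1r A^c^c M). Qed.
Fact unconv_scaleDr : right_distributive unconv_scale +%R.
Proof. exact: (@scalerDr A^c^c M). Qed.
Fact unconv_scaleDl x : {morph unconv_scale^~ x : a b / a + b}.
Proof. exact: (@scalerDl A^c^c M). Qed.

HB.instance Definition _ := GRing.Zmodule_isLmodule.Build A (unconv M)
  unconv_scaleA unconv_scale1 unconv_scaleDr unconv_scaleDl.

End Unconv.

(* An [A]-module as a module over the base ring [R] of the algebra [A]. *)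
Definition restrict_scalars (R : pzRingType) (A : algType R)
  (M : lmodType A) : Type := M.

Section Restrict.
Context (R : pzRingType) (A : algType R) (M : lmodType A).

HB.instance Definition _ := GRing.Zmodule.on (restrict_scalars M).

Definition restrict_scale (r : R) (x : restrict_scalars M) :
    restrict_scalars M :=
  (r%:A : A) *: (x : M).

Fact restrict_scaleA r s x :
  restrict_scale r (restrict_scale s x) = restrict_scale (r * s) x.
Proof. by rewrite /restrict_scale scalerA -scalerAl mul1r scalerA. Qed.
Fact restrict_scale1 : left_id 1 restrict_scale.
Proof. by move=> x; rewrite /restrict_scale !scale1r. Qed.
Fact restrict_scaleDr : right_distributive restrict_scale +%R.
Proof. by move=> r x y; rewrite /restrict_scale scalerDr. Qed.
Fact restrict_scaleDl x : {morph restrict_scale^~ x : r s / r + s}.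
Proof. by move=> r s; rewrite /restrict_scale !scalerDl. Qed.

HB.instance Definition _ := GRing.Zmodule_isLmodule.Build R (restrict_scalars M)
  restrict_scaleA restrict_scale1 restrict_scaleDr restrict_scaleDl.

End Restrict.

(** * The duality [D = Hom_R(-, J)] and the functor [Hom_A(-, A)]

    Both send left [A]-modules to right [A]-modules. *)

Definition dualmod (R : comNzRingType) (J : lmodType R) (A : algType R)
  (M : lmodType A) : Type := Hom (restrict_scalars M) J.

Section Dual.
Context (R : comNzRingType) (J : lmodType R) (A : algType R) (M : lmodType A).

HB.instance Definition _ := GRing.Zmodule.on (dualmod J M).

Definition dual_scale_fun (a : A^c) (h : dualmod J M)
    (x : restrict_scalars M) : J :=
  (h : {linear restrict_scalars M -> J}) ((a : A) *: (x : M)).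

Fact dual_scale_linear a h : linear (dual_scale_fun a h).
Proof.
move=> r x y; rewrite /dual_scale_fun -linearP; congr (h _).
rewrite [LHS]scalerDr; congr (_ + _).
rewrite [LHS](scalerA (a : A)) [RHS](scalerA (r%:A : A)) -scalerAl mul1r.
by rewrite -scalerAr mulr1.
Qed.

HB.instance Definition _ a h :=
  GRing.isLinear.Build R (restrict_scalars M) J _ (dual_scale_fun a h)
    (dual_scale_linear a h).

Definition dual_scale (a : A^c) (h : dualmod J M) : dualmod J M :=
  dual_scale_fun a h : {linear restrict_scalars M -> J}.

Fact dual_scaleA a b h : dual_scale a (dual_scale b h) = dual_scale (a * b) h.
Proof.
apply: linear_ext => x /=.
by rewrite /dual_scale_fun /= /dual_scale_fun scalerA.
Qed.
Fact dual_scale1 : left_id 1 dual_scale.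
Proof.
by move=> h; apply: linear_ext => x /=; rewrite /dual_scale_fun scale1r.
Qed.
Fact dual_scaleDr : right_distributive dual_scale +%R.
Proof. by move=> a g h; apply: linear_ext. Qed.
Fact dual_scaleDl h : {morph dual_scale^~ h : a b / a + b}.
Proof.
move=> a b; apply: linear_ext => x /=.
rewrite /dual_scale_fun scalerDl.
exact: (@linearD _ (restrict_scalars M) J _ h).
Qed.

HB.instance Definition _ := GRing.Zmodule_isLmodule.Build A^c (dualmod J M)
  dual_scaleA dual_scale1 dual_scaleDr dual_scaleDl.

End Dual.

Definition star (A : pzRingType) (M : lmodType A) : Type := Hom M A^o.

Section Star.
Context (A : pzRingType) (M : lmodType A).

HB.instance Definition _ := GRing.Zmodule.on (star M).

Definition star_scale_fun (a : A^c) (h : star M) (x : M) : A^o :=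
  ((h : {linear M -> A^o}) x : A) * (a : A).

Fact star_scale_linear a h : linear (star_scale_fun a h).
Proof.
move=> b x y.
by rewrite /star_scale_fun linearP mulrDl -[RHS]/(_ * _ + _) mulrA.
Qed.

HB.instance Definition _ a h :=
  GRing.isLinear.Build A M A^o _ (star_scale_fun a h) (star_scale_linear a h).

Definition star_scale (a : A^c) (h : star M) : star M :=
  star_scale_fun a h : {linear M -> A^o}.

Fact star_scaleA a b h : star_scale a (star_scale b h) = star_scale (a * b) h.
Proof. by apply: linear_ext => x /=; rewrite /star_scale_fun /= -mulrA. Qed.
Fact star_scale1 : left_id 1 star_scale.
Proof.
by move=> h; apply: linear_ext => x /=; rewrite /star_scale_fun mulr1.
Qed.
Fact star_scaleDr : right_distributive star_scale +%R.
Proof.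
by move=> a g h; apply: linear_ext => x /=; rewrite /star_scale_fun mulrDl.
Qed.
Fact star_scaleDl h : {morph star_scale^~ h : a b / a + b}.
Proof.
by move=> a b; apply: linear_ext => x /=; rewrite /star_scale_fun mulrDr.
Qed.

HB.instance Definition _ := GRing.Zmodule_isLmodule.Build A^c (star M)
  star_scaleA star_scale1 star_scaleDr star_scaleDl.

End Star.

Section StarMap.
Context (A : pzRingType) (M N : lmodType A) (f : {linear M -> N}).

Definition star_map_fun (h : star N) : star M :=
  (h : {linear N -> A^o}) \o f : {linear M -> A^o}.

Fact star_map_linear : linear star_map_fun.
Proof. by move=> a g h; apply: linear_ext. Qed.

HB.instance Definition _ :=
  GRing.isLinear.Build A^c (star N) (star M) _ star_map_fun star_map_linear.

Definition star_map : {linear star N -> star M} := star_map_fun.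

End StarMap.

(** * Modules *)

Section Modules.
Context (A : pzRingType).
Implicit Types M N P I X Y Z K C : lmodType A.

Definition kernel M N (f : {linear M -> N}) : set M := [set x | f x = 0].

Definition submodule M (S : set M) : Prop :=
  [/\ S 0, forall x y, S x -> S y -> S (x + y)
    & forall (a : A) x, S x -> S (a *: x)].

Definition artinian M : Prop :=
  forall S : nat -> set M,
    (forall k, submodule (S k)) -> (forall k, S k.+1 `<=` S k) ->
    exists k, forall l, (k <= l)%N -> S l = S k.

Definition finitely_generated M : Prop :=
  exists (k : nat) (g : 'I_k -> M),
    forall x, exists a : 'I_k -> A, x = \sum_i a i *: g i.

Definition isomorphic M N : Prop := exists f : {linear M -> N}, bijective f.

Definition zero_module M : Prop := forall x : M, x = 0.

Definition projective P : Prop :=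
  forall X Y (p : {linear X -> Y}) (f : {linear P -> Y}),
    range p = setT -> exists g : {linear P -> X}, forall x, f x = p (g x).

Definition injective_module I : Prop :=
  forall X Y (i : {linear X -> Y}) (f : {linear X -> I}),
    injective i -> exists g : {linear Y -> I}, forall x, f x = g (i x).

(* The kernel of [p] is superfluous in [P]. *)
Definition projective_cover P M (p : {linear P -> M}) : Prop :=
  [/\ projective P, range p = setT
    & forall S : set P, submodule S ->
        (forall x, exists s k, [/\ S s, kernel p k & x = s + k]) -> S = setT].

(* The image of [j] is essential in [I]. *)
Definition injective_envelope M I (j : {linear M -> I}) : Prop :=
  [/\ injective_module I, injective j
    & forall S : set I, submodule S -> S `&` range j = [set 0] -> S = [set 0]].

(** [M] is the direct sum of the [X i]. *)
Definition direct_sum (k : nat) (X : 'I_k -> lmodType A) M : Prop :=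
  exists (inj : forall i, {linear X i -> M}) (pr : forall i, {linear M -> X i}),
    [/\ forall i x, pr i (inj i x) = x,
        forall i j x, i != j -> pr j (inj i x) = 0
      & forall y, y = \sum_i inj i (pr i y)].

Definition indecomposable X : Prop :=
  ~ zero_module X /\
  forall Y Z, isomorphic X (Y * Z)%type -> zero_module Y \/ zero_module Z.

Definition basic_module M : Prop :=
  exists (k : nat) (X : 'I_k -> lmodType A),
    [/\ direct_sum X M, forall i, indecomposable (X i)
      & forall i j, i != j -> ~ isomorphic (X i) (X j)].

(** [X] belongs to [add M]: it is a direct summand of some [M^k]. *)
Definition in_add M X : Prop :=
  exists (k : nat) (Y : lmodType A),
    isomorphic (X * Y)%type {ffun 'I_k -> M}.

(** * Syzygies, cosyzygies and vanishing of [Ext] *)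

Definition syzygy M K : Prop :=
  exists (P : lmodType A) (p : {linear P -> M}) (i : {linear K -> P}),
    [/\ projective_cover p, injective i & range i = kernel p].

Definition cosyzygy M C : Prop :=
  exists (I : lmodType A) (j : {linear M -> I}) (q : {linear I -> C}),
    [/\ injective_envelope j, range q = setT & range j = kernel q].

Fixpoint iter_syzygy (k : nat) M K : Prop :=
  if k is k'.+1 then exists L : lmodType A, syzygy M L /\ iter_syzygy k' L K
  else isomorphic M K.

Fixpoint iter_cosyzygy (k : nat) M C : Prop :=
  if k is k'.+1 then exists L : lmodType A, cosyzygy M L /\ iter_cosyzygy k' L C
  else isomorphic M C.

Definition projective_resolution M (P : nat -> lmodType A)
    (d : forall k, {linear P k.+1 -> P k}) (e : {linear P 0%N -> M}) : Prop :=
  [/\ forall k, finitely_generated (P k) /\ projective (P k),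
      range e = setT, range (d 0%N) = kernel e
    & forall k, range (d k.+1) = kernel (d k)].

(** [Ext^i(M, N) = 0], i.e. [H^i(Hom(P, N)) = 0] for a projective resolution
    [P] of [M]. *)
Definition Ext_vanishes (i : nat) M N : Prop :=
  exists (P : nat -> lmodType A) (d : forall k, {linear P k.+1 -> P k})
         (e : {linear P 0%N -> M}),
    projective_resolution d e /\
    match i with
    | 0 => forall f : {linear P 0%N -> N},
        (forall x, f (d 0%N x) = 0) -> forall x, f x = 0
    | j.+1 => forall f : {linear P j.+1 -> N},
        (forall x, f (d j.+1 x) = 0) ->
        exists g : {linear P j -> N}, forall x, f x = g (d j x)
    end.

(** [Q^{perp_m}] and [^{perp_m}Q] *)
Definition right_perp (m : nat) (Q M : lmodType A) : Prop :=
  finitely_generated M /\ forall i, (1 <= i <= m)%N -> Ext_vanishes i Q M.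

Definition left_perp (m : nat) (Q M : lmodType A) : Prop :=
  finitely_generated M /\ forall i, (1 <= i <= m)%N -> Ext_vanishes i M Q.

Definition self_orthogonal (m : nat) (Q : lmodType A) : Prop :=
  forall i, (1 <= i <= m)%N -> Ext_vanishes i Q Q.

(** * Gorenstein projective modules *)

Definition totally_acyclic (P : int -> lmodType A)
    (d : forall i, {linear P i -> P (i + 1)}) : Prop :=
  [/\ forall i, finitely_generated (P i) /\ projective (P i),
      forall i, range (d i) = kernel (d (i + 1))
    & forall i (f : {linear P (i + 1) -> A^o}),
        (forall x, f (d i x) = 0) ->
        exists g : {linear P (i + 1 + 1) -> A^o},
          forall x, f x = g (d (i + 1) x)].

(** Finitely generated Gorenstein projective modules. *)
Definition Gproj M : Prop :=
  finitely_generated M /\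
  exists (P : int -> lmodType A) (d : forall i, {linear P i -> P (i + 1)})
         (j : {linear M -> P 0}),
    [/\ totally_acyclic d, injective j & range j = kernel (d 0)].

End Modules.

(** * The transpose *)

(* [T] is the cokernel of [Hom(P0, A) -> Hom(P1, A)] for a minimal projective
   presentation [P1 -> P0 -> M -> 0]; [c] is the corestriction of [d] to the
   kernel of [p]. *)
Definition transpose (A : pzRingType) (M : lmodType A)
    (T : lmodType A^c) : Prop :=
  exists (P1 P0 K : lmodType A) (p : {linear P0 -> M}) (c : {linear P1 -> K})
         (i : {linear K -> P0}) (d : {linear P1 -> P0})
         (q : {linear star P1 -> T}),
    [/\ projective_cover p /\ projective_cover c,
        injective i /\ range i = kernel p, d =1 i \o c
      & range q = setT /\ range (star_map d) = kernel q].

(** * Artin algebras and the Auslander-Reiten translations *)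

Definition maximal_ideal (R : comNzRingType) (I : set R^o) : Prop :=
  [/\ submodule I, I <> setT
    & forall K : set R^o, submodule K -> I `<=` K -> K = I \/ K = setT].

Definition jacobson_radical (R : comNzRingType) : set R^o :=
  [set x | forall I : set R^o, maximal_ideal I -> I x].

(* [J] is an injective envelope of [R / rad R], so that [Hom_R(-, J)] is the
   standard duality of artin [R]-algebras. *)
Definition dualizing (R : comNzRingType) (J : lmodType R) : Prop :=
  exists (S : lmodType R) (q : {linear R^o -> S}) (j : {linear S -> J}),
    [/\ range q = setT, kernel q = @jacobson_radical R
      & injective_envelope j].

Definition artin_algebra (R : comNzRingType) (A : algType R) : Prop :=
  artinian R^o /\ finitely_generated (A : lmodType R).

Section DTr.
Context (R : comNzRingType) (J : lmodType R) (A : algType R).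
Implicit Types M N Q X Y K C : lmodType A.

Definition dual_of_right (M : lmodType A^c) : lmodType A :=
  unconv (@dualmod R J A^c M).

(** [N] is [tau M = D Tr M]. *)
Definition tau M N : Prop :=
  exists T : lmodType A^c, transpose M T /\ isomorphic N (dual_of_right T).

(** [N] is [tau^- M = Tr D M]. *)
Definition tau_inv M N : Prop :=
  exists T : lmodType A^c^c,
    transpose (dualmod J M) T /\ isomorphic N (unconv T).

(** [N] is [tau^m M = tau Omega^(m-1) M], for [1 <= m]. *)
Definition tau_pow (m : nat) M N : Prop :=
  exists K : lmodType A, iter_syzygy m.-1 M K /\ tau K N.

(** [N] is [tau^(-m) M = tau^- Omega^(-(m-1)) M], for [1 <= m]. *)
Definition tau_inv_pow (m : nat) M N : Prop :=
  exists C : lmodType A, iter_cosyzygy m.-1 M C /\ tau_inv C N.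

Definition generator_cogenerator Q : Prop :=
  in_add Q (A^o * dual_of_right (A^c)^o)%type.

(** [tau^m Q + tau^(-m) Q] belongs to [add Q]. *)
Definition DTr_closed (m : nat) Q : Prop :=
  exists X Y, [/\ tau_pow m Q X, tau_inv_pow m Q Y & in_add Q (X * Y)%type].

(** [Q] is a basic, (n-2)-self-orthogonal, (n-1)-DTr-closed
    generator-cogenerator. *)
Definition self_orthogonal_DTr_closed_gen_cogen (n : nat) Q : Prop :=
  [/\ finitely_generated Q /\ basic_module Q, generator_cogenerator Q,
      self_orthogonal (n - 2) Q & DTr_closed (n - 1) Q].

(** [A] is (n-1)-DTr-selfinjective. *)
Definition DTr_selfinjective (n : nat) : Prop :=
  basic_module A^o /\
  exists Q : lmodType A, self_orthogonal_DTr_closed_gen_cogen n Q.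

End DTr.

(** * Categories and equivalences *)

Record category := Category {
  obj :> Type;
  hom : obj -> obj -> Type;
  idm : forall X, hom X X;
  compose : forall X Y Z, hom Y Z -> hom X Y -> hom X Z;
  compose1m : forall X Y (f : hom X Y), compose (idm Y) f = f;
  composem1 : forall X Y (f : hom X Y), compose f (idm X) = f;
  composeA : forall X Y Z W (h : hom Z W) (g : hom Y Z) (f : hom X Y),
    compose h (compose g f) = compose (compose h g) f
}.

Record functor (C D : category) := Functor {
  fobj :> C -> D;
  fmap : forall X Y, hom X Y -> hom (fobj X) (fobj Y);
  fmap1 : forall X, fmap (idm X) = idm (fobj X);
  fmapM : forall X Y Z (g : hom Y Z) (f : hom X Y),
    fmap (compose g f) = compose (fmap g) (fmap f)
}.

Definition functor_id (C : category) : functor C C :=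
  @Functor C C id (fun _ _ f => f) (fun _ => erefl) (fun _ _ _ _ _ => erefl).

Section FunctorComp.
Context (C D E : category) (G : functor D E) (F : functor C D).

Fact functor_comp1 X : fmap G (fmap F (idm X)) = idm (G (F X)).
Proof. by rewrite !fmap1. Qed.
Fact functor_compM X Y Z (g : hom Y Z) (f : hom X Y) :
  fmap G (fmap F (compose g f)) =
  compose (fmap G (fmap F g)) (fmap G (fmap F f)).
Proof. by rewrite !fmapM. Qed.

Definition functor_comp : functor C E :=
  @Functor C E (fun X => G (F X)) (fun X Y f => fmap G (fmap F f))
    functor_comp1 functor_compM.

End FunctorComp.

Definition is_iso (C : category) (X Y : C) (f : hom X Y) : Prop :=
  exists g : hom Y X, compose g f = idm X /\ compose f g = idm Y.

Definition naturally_isomorphic (C D : category) (F G : functor C D) : Prop :=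
  exists eta : forall X : C, hom (F X) (G X),
    (forall X Y (f : hom X Y),
       compose (fmap G f) (eta X) = compose (eta Y) (fmap F f))
    /\ (forall X, is_iso (eta X)).

Definition is_equivalence (C D : category) (F : functor C D) : Prop :=
  exists G : functor D C,
    naturally_isomorphic (functor_comp G F) (functor_id C) /\
    naturally_isomorphic (functor_comp F G) (functor_id D).

Definition full_subcategory (C : category) (P : C -> Prop) : category :=
  @Category {X : C | P X} (fun X Y => hom (sval X) (sval Y))
    (fun X => idm (sval X)) (fun X Y Z => @compose C (sval X) (sval Y) (sval Z))
    (fun X Y => @compose1m C (sval X) (sval Y))
    (fun X Y => @composem1 C (sval X) (sval Y))
    (fun X Y Z W => @composeA C (sval X) (sval Y) (sval Z) (sval W)).

Definition restrict_functor (C D : category) (F : functor C D)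
    (P : C -> Prop) (P' : D -> Prop) (PP' : forall X, P X -> P' (F X)) :
    functor (full_subcategory P) (full_subcategory P') :=
  @Functor (full_subcategory P) (full_subcategory P')
    (fun X => exist P' (F (sval X)) (PP' _ (svalP X)))
    (fun X Y f => fmap F f)
    (fun X => fmap1 F (sval X))
    (fun X Y Z g f => fmapM F g f).

(** [F] restricts to an equivalence between the full subcategories on [P]
    and [P']. *)
Definition gives_equivalence (C D : category) (F : functor C D)
    (P : C -> Prop) (P' : D -> Prop) : Prop :=
  exists PP' : forall X, P X -> P' (F X), is_equivalence (restrict_functor PP').

Section ModuleCategory.
Context (A : pzRingType).
Implicit Types X Y Z W : lmodType A.

Definition linear_id X : {linear X -> X} := idfun.
Definition linear_comp X Y Z
  (g : {linear Y -> Z}) (f : {linear X -> Y}) : {linear X -> Z} := g \o f.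

Fact linear_comp1m X Y (f : {linear X -> Y}) : linear_comp (linear_id Y) f = f.
Proof. exact: linear_ext. Qed.
Fact linear_compm1 X Y (f : {linear X -> Y}) : linear_comp f (linear_id X) = f.
Proof. exact: linear_ext. Qed.
Fact linear_compA X Y Z W
  (h : {linear Z -> W}) (g : {linear Y -> Z}) (f : {linear X -> Y}) :
  linear_comp h (linear_comp g f) = linear_comp (linear_comp h g) f.
Proof. exact: linear_ext. Qed.

Definition Mod : category :=
  @Category (lmodType A) (fun X Y => {linear X -> Y}) linear_id linear_comp
    linear_comp1m linear_compm1 linear_compA.

End ModuleCategory.

Section HomFunctor.
Context (A : pzRingType) (Q : lmodType A).

Fact hom_functor1 (X : Mod A) :
  homQ_map Q (idm X) = idm (HomQ Q X : Mod (EndOp Q)).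
Proof. by apply: linear_ext => f; apply: linear_ext. Qed.
Fact hom_functorM (X Y Z : Mod A) (g : hom Y Z) (f : hom X Y) :
  homQ_map Q (compose g f) = compose (homQ_map Q g : @hom (Mod (EndOp Q)) _ _)
                               (homQ_map Q f).
Proof. by apply: linear_ext => h; apply: linear_ext. Qed.

(** [Hom(Q, -)], as a functor from [A]-modules to [End^op(Q)]-modules. *)
Definition hom_functor : functor (Mod A) (Mod (EndOp Q)) :=
  @Functor (Mod A) (Mod (EndOp Q)) (fun X : lmodType A => HomQ Q X)
    (fun X Y f => homQ_map Q f) hom_functor1 hom_functorM.

End HomFunctor.

(* Main.v *)
Require Import Defs.
From HB Require Import structures.
From mathcomp Require Import all_boot all_order all_algebra.
From mathcomp Require Import boolp classical_sets.

Set Implicit Arguments.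
Unset Strict Implicit.
Unset Printing Implicit Defensive.

Import GRing.Theory.
Local Open Scope ring_scope.
Local Open Scope classical_set_scope.

(** The proof rests on one formula. Let [K] be a finitely generated module and
    [0 -> X -> Y -> Z -> 0] a short exact sequence. Then [Hom(K, -)] is exact on
    it exactly when [Hom(-, tau K)] is ([tau_formula]), and dually for [tau^-]
    ([tau_inv_formula]). Indeed, for a projective presentation [L1 -> L0 -> K],
    [Hom(X, tau K)] is the [R]-dual of the cokernel of
    [Hom(L0, X) -> Hom(L1, X)]; as the dualizing module is an injective
    cogenerator, exactness of [Hom(-, tau K)] means that this cokernel embeds
    into the one for [Y], and this is the lifting of maps [K -> Z] to [Y]
    ([transpose_formula]).

    Put [m = n - 2] and [d = m + 1]. Applied to the [m]-th syzygy of [Q], the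
    formula shows that [Ext^1(Y, tau^d Q) = 0] implies [Ext^m(Q, Y) = 0] when
    [m > 0], and dimension shifting in [Y] gives the same implication from
    [Ext^i(Y, tau^d Q)] to [Ext^(d-i)(Q, Y)] for [1 <= i <= m]; the shifts are
    possible because [Q] is self-orthogonal and [add Q] contains the projective
    and the injective modules. The dual statement concerns [tau^(-d) Q]. Since
    both translates of [Q] belong to [add Q], an orthogonality relation with [Q]
    on one side passes to the other side ([perp_eq]), which is the equality of
    the two perpendicular categories.

    [Hom(Q, -)] is fully faithful on all modules, because [Q] is a generator
    ([homQ_full], [homQ_faithful]). For [X] in the perpendicular category, a left
    [Q]-approximation [X -> Q^k] is injective since [Q] is a cogenerator, its
    cokernel is again in the perpendicular category, and the short exact sequence
    stays exact under [Hom(Q, -)] and [Hom(-, Q)]; the same holds for right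
    approximations. For [m > 0] this is the vanishing of [Ext^1], for [m = 0] it
    is the formula once more. Splicing these sequences gives a total resolution
    of [Hom(Q, X)] ([homQ_Gproj]). Conversely, the terms of a total resolution
    over [End^op(Q)] are images of modules in [add Q], the differentials come
    from maps between these, and the kernels of these maps are orthogonal to [Q]
    by dimension shifting ([Gproj_homQ]).

    The finiteness statements come from an induction principle which says that
    finitely generated modules over a commutative artin ring have finite length
    ([artin_fg_ind]): it yields Noetherianity, the reflexivity of finitely
    generated modules with respect to the duality, and the finite generation of
    their duals. Vanishing of Ext is treated without Ext groups: [ext1_zero] says
    that maps extend along short exact sequences, [ext_zero] iterates it along
    projective presentations, and [Ext_vanishesE] compares it with the
    definition by projective resolutions. *)

(** * Linear maps, submodules and short exact sequences *)

Section LinearMaps.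
Context (A : pzRingType).
Implicit Types X Y Z M N W : lmodType A.

Definition linear_pack X Y (f : X -> Y) (hf : linear f) : {linear X -> Y} :=
  HB.pack f (GRing.isLinear.Build A X Y *:%R f hf).

Definition onto (X Y : Type) (f : X -> Y) : Prop := forall y, exists x, f x = y.

Lemma range_setT_onto (X Y : Type) (f : X -> Y) : range f = setT <-> onto f.
Proof.
split=> [fT y|fo]; last first.
  by apply/predeqP => y; split=> // _; have [x <-] := fo y; exists x.
have : range f y by rewrite fT.
by case=> x _ <-; exists x.
Qed.

Lemma range_kernel_exact X Y Z (f : {linear X -> Y}) (g : {linear Y -> Z}) :
  range f = kernel g <->
  (forall x, g (f x) = 0) /\ (forall y, g y = 0 -> exists x, f x = y).
Proof.
split=> [fg|[gf0 gf]].
  split=> [x|y gy]; first by have : range f (f x) by []; rewrite fg.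
  by have : kernel g y by []; rewrite -fg => -[x _ <-]; exists x.
by apply/predeqP => y; split=> [[x _ <-]|/gf[x <-]]; [exact: gf0|exists x].
Qed.

Lemma onto_section (X Y : Type) (f : X -> Y) :
  onto f -> exists s : Y -> X, forall y, f (s y) = y.
Proof. by move=> /choice[s sP]; exists s. Qed.

Lemma inj_of_kernel0 X Y (f : {linear X -> Y}) :
  (forall x, f x = 0 -> x = 0) -> injective f.
Proof.
by move=> f0 x y xy; apply/subr0_eq/f0; rewrite linearB xy subrr.
Qed.

Lemma inj_kernel0 X Y (f : {linear X -> Y}) :
  injective f -> forall x, f x = 0 -> x = 0.
Proof. by move=> fi x fx; apply: fi; rewrite fx linear0. Qed.

Lemma factor_inj X Y M (i : {linear X -> Y}) (f : {linear M -> Y}) :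
  injective i -> (forall m, exists x, i x = f m) ->
  exists g : {linear M -> X}, forall m, i (g m) = f m.
Proof.
move=> ii /choice[g gP].
have gl : linear g.
  by move=> a x y; apply: ii; rewrite gP linearP -!gP linearP.
by exists (linear_pack gl).
Qed.

Lemma factor_onto X Y M (p : {linear X -> Y}) (f : {linear X -> M}) :
  onto p -> (forall x, p x = 0 -> f x = 0) ->
  exists g : {linear Y -> M}, forall x, g (p x) = f x.
Proof.
move=> /onto_section[s sP] pf.
have eqf x y : p x = p y -> f x = f y.
  move=> xy; apply/subr0_eq; rewrite -linearB; apply: pf.
  by rewrite linearB xy subrr.
have gl : linear (f \o s).
  by move=> a x y /=; rewrite -linearP; apply: eqf; rewrite sP linearP !sP.
by exists (linear_pack gl) => x /=; apply: eqf; rewrite sP.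
Qed.

Lemma bijective_linear_inv X Y (f : {linear X -> Y}) :
  injective f -> onto f ->
  exists g : {linear Y -> X}, cancel f g /\ cancel g f.
Proof.
move=> fi fo.
have [g gP] := @factor_inj X Y Y f (linear_id Y) fi fo.
by exists g; split=> [x|y]; [apply: fi; rewrite gP|rewrite gP].
Qed.

Lemma isomorphic_maps X Y : isomorphic X Y ->
  exists (f : {linear X -> Y}) (g : {linear Y -> X}),
    cancel f g /\ cancel g f.
Proof.
move=> [f [h fh hf]]; have fi := can_inj fh.
have [g gP] := bijective_linear_inv fi (fun y => ex_intro _ (h y) (hf y)).
by exists f, g.
Qed.

End LinearMaps.

(** ** Submodules and quotients as modules *)

Section SubmoduleModule.
Context (A : pzRingType) (M : lmodType A) (S : set M) (hS : submodule S).

Definition submod_type of submodule S := {x : M | S x}.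
Local Notation K := (submod_type hS).

HB.instance Definition _ := gen_eqMixin K.
HB.instance Definition _ := gen_choiceMixin K.

Let S0 : S 0. Proof. by case: hS. Qed.
Let SD x y : S x -> S y -> S (x + y). Proof. by case: hS => _ + _; apply. Qed.
Let SZ a x : S x -> S (a *: x). Proof. by case: hS => _ _; apply. Qed.
Let SN x : S x -> S (- x). Proof. by move=> /(SZ (-1)); rewrite scaleN1r. Qed.

Definition submod_zero : K := exist _ 0 S0.
Definition submod_add (x y : K) : K :=
  exist _ (sval x + sval y) (SD (svalP x) (svalP y)).
Definition submod_opp (x : K) : K := exist _ (- sval x) (SN (svalP x)).
Definition submod_scale (a : A) (x : K) : K :=
  exist _ (a *: sval x) (SZ a (svalP x)).

Fact submod_val_inj : injective (fun x : K => sval x).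
Proof. by move=> [x Sx] [y Sy] /= xy; apply: eq_exist. Qed.
Fact submod_addA : associative submod_add.
Proof. by move=> x y z; apply: submod_val_inj; rewrite /= addrA. Qed.
Fact submod_addC : commutative submod_add.
Proof. by move=> x y; apply: submod_val_inj; rewrite /= addrC. Qed.
Fact submod_add0 : left_id submod_zero submod_add.
Proof. by move=> x; apply: submod_val_inj; rewrite /= add0r. Qed.
Fact submod_addN : left_inverse submod_zero submod_opp submod_add.
Proof. by move=> x; apply: submod_val_inj; rewrite /= addNr. Qed.

HB.instance Definition _ :=
  GRing.isZmodule.Build K submod_addA submod_addC submod_add0 submod_addN.

Fact submod_scaleA a b x :
  submod_scale a (submod_scale b x) = submod_scale (a * b) x.
Proof. by apply: submod_val_inj; rewrite /= scalerA. Qed.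
Fact submod_scale1 : left_id 1 submod_scale.
Proof. by move=> x; apply: submod_val_inj; rewrite /= scale1r. Qed.
Fact submod_scaleDr : right_distributive submod_scale +%R.
Proof. by move=> a x y; apply: submod_val_inj; rewrite /= scalerDr. Qed.
Fact submod_scaleDl x : {morph submod_scale^~ x : a b / a + b}.
Proof. by move=> a b; apply: submod_val_inj; rewrite /= scalerDl. Qed.

HB.instance Definition _ := GRing.Zmodule_isLmodule.Build A K
  submod_scaleA submod_scale1 submod_scaleDr submod_scaleDl.

Fact submod_val_linear : linear (fun x : K => sval x : M).
Proof. by []. Qed.

Lemma submodule_module : exists (K : lmodType A) (i : {linear K -> M}),
  injective i /\ forall y, S y <-> exists x, i x = y.
Proof.
exists K, (linear_pack submod_val_linear); split; first exact: submod_val_inj.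
by move=> y; split=> [Sy|[x <-]]; [exists (exist _ y Sy)|exact: svalP].
Qed.

(* The quotient is realised on a set of representatives of the cosets. *)
Definition coset_repr (x : M) : M := xget 0 [set y | S (x - y)].

Fact coset_reprP x : S (x - coset_repr x).
Proof.
apply: (xgetPex (0 : M) (P := [set y | S (x - y)])).
by exists x; rewrite /= subrr.
Qed.

Fact coset_repr_eq x y : S (x - y) -> coset_repr x = coset_repr y.
Proof.
move=> Sxy; congr (xget _ _); apply/predeqP => z /=; split=> Sz.
  by rewrite -[y](subrK x) -addrA; apply: SD => //; rewrite -opprB; apply: SN.
by rewrite -[x](subrK y) -addrA; apply: SD.
Qed.

Definition quomod_type of submodule S := {x : M | coset_repr x = x}.
Local Notation C := (quomod_type hS).

HB.instance Definition _ := gen_eqMixin C.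
HB.instance Definition _ := gen_choiceMixin C.

Fact coset_reprK x : coset_repr (coset_repr x) = coset_repr x.
Proof. by apply: coset_repr_eq; rewrite -opprB; apply/SN/coset_reprP. Qed.

Definition quomod_pi (x : M) : C := exist _ (coset_repr x) (coset_reprK x).

Fact quomod_pi_eq x y : quomod_pi x = quomod_pi y <-> S (x - y).
Proof.
split=> [/(congr1 sval)/= xy|Sxy]; last exact/eq_exist/coset_repr_eq.
rewrite -[x](subrK (coset_repr x)) -addrA; apply: SD; first exact: coset_reprP.
by rewrite xy -opprB; apply/SN/coset_reprP.
Qed.

Fact quomod_piK (c : C) : quomod_pi (sval c) = c.
Proof. by case: c => c cP /=; apply: eq_exist. Qed.

Definition quomod_add (x y : C) : C := quomod_pi (sval x + sval y).
Definition quomod_opp (x : C) : C := quomod_pi (- sval x).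
Definition quomod_scale (a : A) (x : C) : C := quomod_pi (a *: sval x).

Fact quomod_piD x y : quomod_pi (x + y) = quomod_add (quomod_pi x) (quomod_pi y).
Proof.
by apply/quomod_pi_eq; rewrite opprD addrACA; apply: SD; apply: coset_reprP.
Qed.
Fact quomod_piN x : quomod_pi (- x) = quomod_opp (quomod_pi x).
Proof.
by apply/quomod_pi_eq; rewrite -opprD; apply: SN; apply: coset_reprP.
Qed.
Fact quomod_piZ a x : quomod_pi (a *: x) = quomod_scale a (quomod_pi x).
Proof.
by apply/quomod_pi_eq; rewrite -scalerBr; apply: SZ; apply: coset_reprP.
Qed.

Fact quomod_addA : associative quomod_add.
Proof.
move=> x y z; rewrite -[x]quomod_piK -[y]quomod_piK -[z]quomod_piK.
by rewrite -!quomod_piD addrA.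
Qed.
Fact quomod_addC : commutative quomod_add.
Proof. by move=> x y; rewrite /quomod_add addrC. Qed.
Fact quomod_add0 : left_id (quomod_pi 0) quomod_add.
Proof. by move=> x; rewrite -[x]quomod_piK -quomod_piD add0r. Qed.
Fact quomod_addN : left_inverse (quomod_pi 0) quomod_opp quomod_add.
Proof.
by move=> x; rewrite -[x]quomod_piK -quomod_piN -quomod_piD addNr.
Qed.

HB.instance Definition _ :=
  GRing.isZmodule.Build C quomod_addA quomod_addC quomod_add0 quomod_addN.

Fact quomod_scaleA a b x :
  quomod_scale a (quomod_scale b x) = quomod_scale (a * b) x.
Proof. by rewrite -[x]quomod_piK -!quomod_piZ scalerA. Qed.
Fact quomod_scale1 : left_id 1 quomod_scale.
Proof. by move=> x; rewrite -[x]quomod_piK -!quomod_piZ scale1r. Qed.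
Fact quomod_scaleDr : right_distributive quomod_scale +%R.
Proof.
move=> a x y; rewrite -[x]quomod_piK -[y]quomod_piK -[_ + _]quomod_piD.
by rewrite -!quomod_piZ scalerDr; exact: quomod_piD.
Qed.
Fact quomod_scaleDl x : {morph quomod_scale^~ x : a b / a + b}.
Proof.
move=> a b; rewrite -[x]quomod_piK -!quomod_piZ scalerDl.
exact: quomod_piD.
Qed.

HB.instance Definition _ := GRing.Zmodule_isLmodule.Build A C
  quomod_scaleA quomod_scale1 quomod_scaleDr quomod_scaleDl.

Fact quomod_pi_linear : linear quomod_pi.
Proof. by move=> a x y; rewrite quomod_piD quomod_piZ. Qed.

Lemma quotient_module : exists (C : lmodType A) (p : {linear M -> C}),
  onto p /\ forall y, p y = 0 <-> S y.
Proof.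
exists C, (linear_pack quomod_pi_linear); split.
  by move=> c; exists (sval c); exact: quomod_piK.
by move=> y; rewrite -[y in S y]subr0; apply: quomod_pi_eq.
Qed.

End SubmoduleModule.

Section ShortExact.
Context (A : pzRingType).
Implicit Types X Y Z M N V W K L P I C B : lmodType A.

Lemma submoduleB M (S : set M) : submodule S ->
  forall x y, S x -> S y -> S (x - y).
Proof.
move=> [_ SD SZ] x y Sx Sy; apply: SD => //.
by rewrite -scaleN1r; apply: SZ.
Qed.

Lemma submodule_kernel M N (f : {linear M -> N}) : submodule (kernel f).
Proof.
rewrite /kernel; split=> /=; first exact: linear0.
- by move=> x y fx fy; rewrite linearD fx fy addr0.
- by move=> a x fx; rewrite linearZ fx /= scaler0.
Qed.

Lemma submodule_preimage M N (f : {linear M -> N}) (S : set N) :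
  submodule S -> submodule [set x | S (f x)].
Proof.
move=> [S0 SD SZ]; split=> /= [|x y Sx Sy|a x Sx]; first by rewrite linear0.
- by rewrite linearD; apply: SD.
- by rewrite linearZ; apply: SZ.
Qed.

Lemma submodule_image M N (f : {linear M -> N}) (S : set M) :
  submodule S -> submodule [set y | exists2 x, S x & f x = y].
Proof.
move=> [S0 SD SZ]; split=> /= [|_ _ [x Sx <-] [y Sy <-]|a _ [x Sx <-]].
- by exists 0 => //; rewrite linear0.
- by exists (x + y); [exact: SD|rewrite linearD].
- by exists (a *: x); [exact: SZ|rewrite linearZ].
Qed.

Record ses X Y Z (i : {linear X -> Y}) (p : {linear Y -> Z}) : Prop := Ses {
  ses_inj : injective i;
  ses_zero : forall x, p (i x) = 0;
  ses_exact : forall y, p y = 0 -> exists x, i x = y;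
  ses_onto : onto p }.

Lemma kernel_ses Y Z (p : {linear Y -> Z}) : onto p ->
  exists (X : lmodType A) (i : {linear X -> Y}), ses i p.
Proof.
move=> po; have [X [i [ii iP]]] := submodule_module (submodule_kernel p).
exists X, i; split=> // [x|y py]; last exact/iP.
by have : kernel p (i x) by apply/iP; exists x.
Qed.

Lemma cokernel_ses X Y (i : {linear X -> Y}) : injective i ->
  exists (Z : lmodType A) (p : {linear Y -> Z}), ses i p.
Proof.
move=> ii.
have hT : submodule [set: X] by [].
have [Z [p [po pP]]] := quotient_module (submodule_image i hT).
exists Z, p; split=> // [x|y /pP[x _ <-]]; last by exists x.
by apply/pP; exists x.
Qed.

(** Both descriptions of the pullback are recorded, since it is used with its
    elements and with maps into it. *)
Definition is_pullback Y Z W B (f : {linear Y -> Z}) (g : {linear W -> Z})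
    (a : {linear B -> Y}) (b : {linear B -> W}) : Prop :=
  [/\ forall x, f (a x) = g (b x),
      forall y w, f y = g w -> exists x, a x = y /\ b x = w,
      forall x, a x = 0 -> b x = 0 -> x = 0
    & forall (V : lmodType A) (u : {linear V -> Y}) (v : {linear V -> W}),
        (forall x, f (u x) = g (v x)) ->
        exists h : {linear V -> B}, forall x, a (h x) = u x /\ b (h x) = v x].

Lemma pullback Y Z W (f : {linear Y -> Z}) (g : {linear W -> Z}) :
  exists (B : lmodType A) (a : {linear B -> Y}) (b : {linear B -> W}),
  is_pullback f g a b.
Proof.
have hS : submodule [set u : Y * W | f u.1 = g u.2].
  split=> /= [|u v uP vP|a u uP]; first by rewrite !linear0.
  - by rewrite !linearD uP vP.
  - by rewrite !linearZ uP.
have [B [i [ii iP]]] := submodule_module hS.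
have al : linear (fun x => (i x).1) by move=> r x y; rewrite linearP.
have bl : linear (fun x => (i x).2) by move=> r x y; rewrite linearP.
have ex y w : f y = g w -> exists x, i x = (y, w).
  by move=> yw; exact/(iP (y, w)).
exists B, (linear_pack al), (linear_pack bl); split=> [x|y w yw|x /= ax bx|].
- by have /iP : exists u, i u = i x by exists x.
- by have [x xP] := ex _ _ yw; exists x; rewrite /= xP.
- by apply: (inj_kernel0 ii); case: (i x) ax bx => ? ? /= -> ->.
move=> V u v uv.
have wl : linear (fun x => (u x, v x)).
  by move=> r x y; rewrite !linearP.
have [h hP] := factor_inj (f := linear_pack wl) ii (fun x => ex _ _ (uv x)).
by exists h => x; rewrite /= hP.
Qed.

Lemma is_pullback_sym Y Z W B (f : {linear Y -> Z}) (g : {linear W -> Z})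
    (a : {linear B -> Y}) (b : {linear B -> W}) :
  is_pullback f g a b -> is_pullback g f b a.
Proof.
move=> [ab ex ab0 univ]; split=> [x|y w yw|x bx ax|V u v uv].
- by rewrite ab.
- by have [x [<- <-]] := ex _ _ (esym yw); exists x.
- exact: ab0.
- have [h hP] := univ V v u (fun x => esym (uv x)).
  by exists h => x; have [] := hP x.
Qed.

(** Pulling back a short exact sequence along [q] keeps its first term. *)
Lemma pullback_ses X Y M L (i : {linear X -> Y}) (p : {linear Y -> M})
    (B : lmodType A) (q : {linear L -> M})
    (a : {linear B -> L}) (b : {linear B -> Y}) :
  ses i p -> is_pullback q p a b ->
  exists j : {linear X -> B}, ses j a /\ forall x, b (j x) = i x.
Proof.
move=> [ii i0 ie po] [ab ex ab0 univ].
have [|j jP] := univ X (\0 : {linear X -> L}) i.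
  by move=> x /=; rewrite i0 linear0.
exists j; split; last by move=> x; have [] := jP x.
split.
- apply: inj_of_kernel0 => x jx; apply: (inj_kernel0 ii).
  by have [_ <-] := jP x; rewrite jx linear0.
- by move=> x; have [] := jP x.
- move=> x ax; have [|y yP] := ie (b x); first by rewrite -ab ax linear0.
  exists y; apply/subr0_eq/ab0; rewrite linearB; have [aj bj] := jP y.
    by rewrite aj ax subrr.
  by rewrite bj yP subrr.
- move=> l; have [y yP] := po (q l); have [x [<- _]] := ex l y (esym yP).
  by exists x.
Qed.

(** ** Finite powers *)

Definition power_pr M k (i : 'I_k) : {linear {ffun 'I_k -> M} -> M}.
Proof.
refine (@linear_pack _ _ _ (fun x : {ffun 'I_k -> M} => x i) _).
by move=> a x y; rewrite !ffunE.
Defined.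

Definition power_in M k (i : 'I_k) : {linear M -> {ffun 'I_k -> M}}.
Proof.
refine (@linear_pack _ _ _
  (fun x : M => [ffun j => if i == j then x else 0]) _).
move=> a x y; apply/ffunP => j; rewrite !ffunE.
by case: eqP => _ //; rewrite scaler0 addr0.
Defined.

Lemma power_in_pr M k (x : {ffun 'I_k -> M}) :
  x = \sum_i power_in M i (power_pr M i x).
Proof.
apply/ffunP => j; rewrite sum_ffunE (bigD1 j) //= !ffunE eqxx big1 ?addr0 //.
by move=> i /negPf ij; rewrite !ffunE ij.
Qed.

Lemma power_tuple X M k (f : 'I_k -> {linear X -> M}) :
  exists g : {linear X -> {ffun 'I_k -> M}}, forall x i, g x i = f i x.
Proof.
have gl : linear (fun x => [ffun i => f i x]).
  by move=> a x y; apply/ffunP => i; rewrite !ffunE linearP.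
by exists (linear_pack gl) => x i; rewrite ffunE.
Qed.

Lemma power_cotuple X M k (f : 'I_k -> {linear M -> X}) :
  exists g : {linear {ffun 'I_k -> M} -> X}, forall x, g x = \sum_i f i (x i).
Proof.
have gl : linear (fun x : {ffun 'I_k -> M} => \sum_i f i (x i)).
  move=> a x y; rewrite scaler_sumr -big_split; apply: eq_bigr => i _.
  by rewrite !ffunE linearP.
by exists (linear_pack gl).
Qed.

Definition power_map X Y k (f : {linear X -> Y}) :
  {linear {ffun 'I_k -> X} -> {ffun 'I_k -> Y}}.
Proof.
refine (@linear_pack _ _ _ (fun x : {ffun 'I_k -> X} => [ffun i => f (x i)]) _).
by move=> a x y; apply/ffunP => i; rewrite !ffunE linearP.
Defined.

Lemma ses_power X Y Z k (i : {linear X -> Y}) (p : {linear Y -> Z}) :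
  ses i p -> ses (power_map k i) (power_map k p).
Proof.
move=> [ii i0 ie po]; split.
- move=> x y /ffunP xy; apply/ffunP => j; apply: ii.
  by have := xy j; rewrite !ffunE.
- by move=> x; apply/ffunP => j; rewrite !ffunE i0.
- move=> y /ffunP y0.
  have /choice[x xP] : forall j, exists x, i x = y j.
    by move=> j; apply: ie; have := y0 j; rewrite !ffunE.
  by exists [ffun j => x j]; apply/ffunP => j; rewrite !ffunE.
- move=> z; have [s sP] := onto_section po.
  by exists [ffun j => s (z j)]; apply/ffunP => j; rewrite !ffunE sP.
Qed.

(** Membership in [add M] is used in the form of a retract of a finite power
    of [M]: retractions compose, and no complement has to be chosen. *)
Definition retract M N : Prop :=
  exists (s : {linear N -> M}) (r : {linear M -> N}), cancel s r.

Lemma in_add_retract M X :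
  in_add M X -> exists k, retract {ffun 'I_k -> M} X.
Proof.
move=> [k [Y /isomorphic_maps[f [g [fg _]]]]]; exists k.
have sl : linear (fun x => f (x, 0)).
  by move=> a x y; rewrite -linearP; congr (f _); congr pair; rewrite /= scaler0 addr0.
have rl : linear (fun y => (g y).1) by move=> a x y; rewrite linearP.
by exists (linear_pack sl), (linear_pack rl) => x /=; rewrite fg.
Qed.

Lemma in_add_prod M X Y : in_add M (X * Y)%type -> in_add M X /\ in_add M Y.
Proof.
move=> [k [Z [f [g fg gf]]]]; split.
  have fl : linear (fun u : X * (Y * Z) => f ((u.1, u.2.1), u.2.2)).
    by move=> a u v; rewrite -linearP.
  exists k, (Y * Z)%type, (linear_pack fl).
  exists (fun x => ((g x).1.1, ((g x).1.2, (g x).2))) => [[x [y z]]|x] /=.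
    by rewrite fg.
  by rewrite -[RHS]gf; case: (g x) => -[].
have fl : linear (fun u : Y * (X * Z) => f ((u.2.1, u.1), u.2.2)).
  by move=> a u v; rewrite -linearP.
exists k, (X * Z)%type, (linear_pack fl).
exists (fun x => ((g x).1.2, ((g x).1.1, (g x).2))) => [[x [y z]]|x] /=.
  by rewrite fg.
by rewrite -[RHS]gf; case: (g x) => -[].
Qed.

End ShortExact.

(** * Vanishing of Ext groups *)

Section ExtVanishing.
Context (A : pzRingType).
Implicit Types X Y Z M N V W K L P I C B : lmodType A.

Definition lifts M Y Z (p : {linear Y -> Z}) : Prop :=
  forall f : {linear M -> Z}, exists g : {linear M -> Y}, forall x, f x = p (g x).

Definition extends X Y (i : {linear X -> Y}) N : Prop :=
  forall f : {linear X -> N}, exists g : {linear Y -> N}, forall x, f x = g (i x).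

Lemma projective_lifts P Y Z (p : {linear Y -> Z}) :
  projective P -> onto p -> lifts P p.
Proof. by move=> hP /range_setT_onto po f; apply: hP. Qed.

(** Vanishing of [Ext^1(M, N)], in a form that refers neither to projective
    nor to injective modules. *)
Definition ext1_zero M N : Prop :=
  forall X Y (i : {linear X -> Y}) (p : {linear Y -> M}),
    ses i p -> extends i N.

Lemma projective_ext1 P N : projective P -> ext1_zero P N.
Proof.
move=> hP X Y i p [ii i0 ie po] f.
have [s sP] := projective_lifts hP po (linear_id P).
have [r rP] : exists r : {linear Y -> X}, forall y, i (r y) = y - s (p y).
  apply: (factor_inj (f := linear_id Y \- linear_comp s p)) => // y.
  by apply: ie; rewrite /= linearB /= -sP subrr.
exists (linear_comp f r) => x /=; congr (f _).
by apply: ii; rewrite rP /= i0 linear0 subr0.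
Qed.

Lemma injective_ext1 M I : injective_module I -> ext1_zero M I.
Proof. by move=> hI X Y i p /ses_inj ii f; apply: hI. Qed.

Lemma ext1_lifts M X Y Z (i : {linear X -> Y}) (p : {linear Y -> Z}) :
  ses i p -> ext1_zero M X -> lifts M p.
Proof.
move=> [ii i0 ie po] hM f.
have [B [a [b [ab ex _ _]]]] := pullback p f.
have bo : onto b.
  by move=> m; have [y yP] := po (f m); have [x [_ <-]] := ex _ _ yP; exists x.
have [K [k hk]] := kernel_ses bo.
have [h hP] : exists h : {linear K -> X}, forall x, i (h x) = a (k x).
  apply: (factor_inj (f := linear_comp a k)) => // x /=.
  by apply: ie; rewrite ab (ses_zero hk) linear0.
have [g gP] := hM _ _ _ _ hk h.
have [u uP] : exists u : {linear M -> Y}, forall x, u (b x) = a x - i (g x).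
  apply: (factor_onto (f := a \- linear_comp i g)) => // x.
  by move=> /(ses_exact hk)[y <-] /=; rewrite -gP hP subrr.
exists u => m; have [x <-] := bo m.
by rewrite uP linearB /= i0 subr0 ab.
Qed.

(** Exactness of [Hom(M, Y) -> Hom(M, Z) -> Ext^1(M, X) -> Ext^1(M, Y)] at
    [Ext^1(M, X)]; with [Y] injective this computes [Ext^1] from an injective
    copresentation of [X]. *)
Lemma ext1_of_lifts M X Y Z (i : {linear X -> Y}) (p : {linear Y -> Z}) :
  ses i p -> ext1_zero M Y -> lifts M p -> ext1_zero M X.
Proof.
move=> [ii i0 ie po] hY hp V W j q hjq f.
have [g gP] := hY _ _ _ _ hjq (linear_comp i f).
have [u uP] : exists u : {linear M -> Z}, forall x, u (q x) = p (g x).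
  apply: (factor_onto (f := linear_comp p g)) (ses_onto hjq) _ => w.
  by move=> /(ses_exact hjq)[v <-] /=; rewrite -gP i0.
have [v vP] := hp u.
have [h hP] : exists h : {linear W -> X}, forall x, i (h x) = g x - v (q x).
  apply: (factor_inj (f := g \- linear_comp v q)) => // x.
  by apply: ie; rewrite /= linearB /= -vP uP subrr.
exists h => x; apply: ii.
by rewrite hP -gP (ses_zero hjq) linear0 subr0.
Qed.

(** Exactness of [Hom(L, N) -> Hom(K, N) -> Ext^1(M, N) -> Ext^1(L, N)] at
    [Ext^1(M, N)]; with [L] projective this computes [Ext^1] from a projective
    presentation of [M]. *)
Lemma ext1_of_extends K L M N (k : {linear K -> L}) (q : {linear L -> M}) :
  ses k q -> ext1_zero L N -> extends k N -> ext1_zero M N.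
Proof.
move=> hkq hL hk X Y i p hip f.
have [B [a [b pb]]] := pullback q p.
have [j [hj bj]] := pullback_ses hip pb.
have [l [hl al]] := pullback_ses hkq (is_pullback_sym pb).
have [g gP] := hL _ _ _ _ hj f.
have [h hP] := hk (linear_comp g l).
have [u uP] : exists u : {linear Y -> N}, forall x, u (b x) = g x - h (a x).
  apply: (factor_onto (f := g \- linear_comp h a)) (ses_onto hl) _ => x.
  by move=> /(ses_exact hl)[y <-] /=; rewrite al -hP subrr.
by exists u => x; rewrite -bj uP (ses_zero hj) linear0 subr0 -gP.
Qed.

Lemma ext1_retract_l M M0 N : retract M0 M -> ext1_zero M0 N -> ext1_zero M N.
Proof.
move=> [s [r sr]] h0 X Y i p hip f.
have [B [a [b pb]]] := pullback r p; have [ab ex ab0 univ] := pb.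
have [j [hj bj]] := pullback_ses hip pb.
have [g gP] := h0 _ _ _ _ hj f.
have [w wP] := univ Y (linear_comp s p) (linear_id Y) (fun x => sr (p x)).
exists (linear_comp g w) => x; rewrite gP /=; congr (g _).
have [aw bw] := wP (i x); apply/subr0_eq/ab0; rewrite linearB.
  by rewrite aw /= (ses_zero hip) linear0 (ses_zero hj) subrr.
by rewrite bw bj subrr.
Qed.

(** The preimage [W'] of the submodule [X] of [Y] under [q : W -> Y]. *)
Lemma preimage_ses X Y Z V W (i : {linear X -> Y}) (p : {linear Y -> Z})
    (j : {linear V -> W}) (q : {linear W -> Y}) :
  ses i p -> ses j q ->
  exists (W' : lmodType A) (w : {linear W' -> W}) (j' : {linear V -> W'})
         (q' : {linear W' -> X}),
  [/\ ses w (linear_comp p q), ses j' q', forall x, w (j' x) = j x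
    & forall x, i (q' x) = q (w x)].
Proof.
move=> hip hjq.
have pqo : onto (linear_comp p q).
  move=> z; have [y <-] := ses_onto hip z; have [w <-] := ses_onto hjq y.
  by exists w.
have [W' [w hw]] := kernel_ses pqo.
have [q' q'P] : exists q' : {linear W' -> X}, forall x, i (q' x) = q (w x).
  apply: (factor_inj (f := linear_comp q w) (ses_inj hip)) => x /=.
  exact/(ses_exact hip)/(ses_zero hw).
have [j' j'P] : exists j' : {linear V -> W'}, forall x, w (j' x) = j x.
  apply: (factor_inj (ses_inj hw)) => x; apply: (ses_exact hw).
  by rewrite /= (ses_zero hjq) linear0.
exists W', w, j', q'; split=> //; split.
- by move=> x y xy; apply: (ses_inj hjq); rewrite -!j'P xy.
- by move=> x; apply: (ses_inj hip); rewrite q'P j'P (ses_zero hjq) linear0.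
- move=> y y0; have [|x xP] := ses_exact hjq (y := w y).
    by rewrite -q'P y0 linear0.
  by exists x; apply: (ses_inj hw); rewrite j'P.
- move=> x; have [y yP] := ses_onto hjq (i x).
  have [|y' y'P] := ses_exact hw (y := y); first by rewrite /= yP (ses_zero hip).
  by exists y'; apply: (ses_inj hip); rewrite q'P y'P.
Qed.

Lemma ext1_middle X Y Z N (i : {linear X -> Y}) (p : {linear Y -> Z}) :
  ses i p -> ext1_zero X N -> ext1_zero Z N -> ext1_zero Y N.
Proof.
move=> hip hX hZ V W j q hjq f.
have [W' [w [j' [q' [hw hj' j'P _]]]]] := preimage_ses hip hjq.
have [g gP] := hX _ _ _ _ hj' f.
have [h hP] := hZ _ _ _ _ hw g.
by exists h => x; rewrite gP hP j'P.
Qed.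

(** [Ext^(k+1)(M, N) = 0], by dimension shifting along projective presentations
    which are not fixed in advance; [ext_zero_syzygy] shows that their choice is
    immaterial. *)
Fixpoint ext_zero (k : nat) M N : Prop :=
  if k is k'.+1 then
    exists K P (i : {linear K -> P}) (p : {linear P -> M}),
      [/\ ses i p, projective P & ext_zero k' K N]
  else ext1_zero M N.

Lemma ses_projective_split K Z P (i : {linear K -> Z}) (p : {linear Z -> P}) :
  ses i p -> projective P ->
  exists (r : {linear Z -> K}) (s : {linear P -> Z}),
  [/\ cancel i r, cancel s p, forall x, r (s x) = 0
    & forall z, z = i (r z) + s (p z)].
Proof.
move=> [ii i0 ie po] hP.
have [s sP] := projective_lifts hP po (linear_id P).
have [r rP] : exists r : {linear Z -> K}, forall x, i (r x) = x - s (p x).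
  apply: (factor_inj (f := linear_id Z \- linear_comp s p)) => // x /=.
  by apply: ie; rewrite linearB /= -sP subrr.
exists r, s; split=> [x|x|x|x].
- by apply: ii; rewrite rP i0 linear0 subr0.
- by rewrite -sP.
- by apply: ii; rewrite rP -sP /= subrr linear0.
- by rewrite rP subrK.
Qed.

(** Adding a projective summand to a syzygy does not change the vanishing of
    Ext; it is the part of the comparison of projective resolutions that
    makes [ext_zero] independent of the chosen presentations. *)
Lemma ext_zero_projective_ext k K Z P N (i : {linear K -> Z})
    (p : {linear Z -> P}) :
  ses i p -> projective P -> ext_zero k Z N <-> ext_zero k K N.
Proof.
move=> hip hP; have [r [s [ir sp rs zE]]] := ses_projective_split hip hP.
case: k => [|k] /=.
  split=> h; first by apply: ext1_retract_l h; exists i, r.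
  by apply: (ext1_middle hip) => //; apply: projective_ext1.
split=> [[L [P0 [l [q [hlq hP0 hL]]]]]|[L [P0 [l [q [hlq hP0 hL]]]]]].
  have [P1 [w [l' [q' [hw hl' _ _]]]]] := preimage_ses hip hlq.
  have [rw [sw [irw spw rsw zEw]]] := ses_projective_split hw hP.
  exists L, P1, l', q'; split=> // U V u f uo.
  have [g gP] := hP0 _ _ u (linear_comp f rw) uo.
  by exists (linear_comp g w) => x; rewrite /= -gP /= irw.
have hPP : projective (P0 * P)%type.
  move=> U V u f uo.
  have l1 : linear (fun x : P0 => f (x, 0)).
    by move=> a x y; rewrite -linearP; congr (f _); congr pair; rewrite /= scaler0 addr0.
  have l2 : linear (fun x : P => f (0, x)).
    by move=> a x y; rewrite -linearP; congr (f _); congr pair; rewrite /= scaler0 addr0.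
  have [g1 g1P] := hP0 _ _ u (linear_pack l1) uo.
  have [g2 g2P] := hP _ _ u (linear_pack l2) uo.
  have gl : linear (fun x : P0 * P => g1 x.1 + g2 x.2).
    by move=> a x y; rewrite !linearP scalerDr addrACA.
  exists (linear_pack gl) => -[x y] /=.
  rewrite linearD -g1P -g2P /= -linearD.
  by congr (f _); congr pair; rewrite /= ?addr0 ?add0r.
have ll : linear (fun x => (l x, 0) : P0 * P).
  by move=> a x y; rewrite linearP; congr pair; rewrite /= scaler0 addr0.
have ql : linear (fun x : P0 * P => i (q x.1) + s x.2).
  by move=> a x y; rewrite !linearP scalerDr addrACA.
exists L, (P0 * P)%type, (linear_pack ll), (linear_pack ql); split=> //; split.
- by move=> x y [] /(ses_inj hlq).
- by move=> x; rewrite /= (ses_zero hlq) !linear0 addr0.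
- move=> [x y] /= xy.
  have y0 : y = 0.
    by have := congr1 p xy; rewrite linearD linear0 (ses_zero hip) add0r sp.
  move: xy; rewrite y0 linear0 addr0 => /(inj_kernel0 (ses_inj hip)).
  by move=> /(ses_exact hlq)[u <-]; exists u.
- move=> z; have [u uP] := ses_onto hlq (r z); exists (u, p z) => /=.
  by rewrite uP -zE.
Qed.

Lemma ext_zero_syzygy k K P M N (i : {linear K -> P}) (p : {linear P -> M}) :
  ses i p -> projective P -> ext_zero k.+1 M N <-> ext_zero k K N.
Proof.
move=> hip hP; split=> [/= [K' [P' [i' [p' [hip' hP' hK']]]]]|hK]; last first.
  by exists K, P, i, p.
have [B [a [b pb]]] := pullback p' p.
have [j [hj _]] := pullback_ses hip pb.
have [l [hl _]] := pullback_ses hip' (is_pullback_sym pb).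
by apply/(ext_zero_projective_ext k N hj hP')/(ext_zero_projective_ext k N hl hP).
Qed.

(** ** The long exact sequences *)

(** [Ext^j(M, Z) -> Ext^(j+1)(M, X) -> Ext^(j+1)(M, Y)] *)
Lemma ext_zero_r_first k M X Y Z (i : {linear X -> Y}) (p : {linear Y -> Z}) :
  ses i p -> ext_zero k M Z -> ext_zero k.+1 M Y -> ext_zero k.+1 M X.
Proof.
move=> hip; elim: k M => [|k IH] M hZ [K [P [l [q [hlq hP hY]]]]].
  exists K, P, l, q; split=> //=; apply: (ext1_of_lifts hip hY) => f.
  have [g gP] := hZ _ _ _ _ hlq f.
  have [h hPh] := projective_lifts hP (ses_onto hip) g.
  by exists (linear_comp h l) => x; rewrite gP hPh.
exists K, P, l, q; split=> //; apply: IH hY.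
by apply/(ext_zero_syzygy k Z hlq hP).
Qed.

(** [Ext^j(M, Y) -> Ext^j(M, Z) -> Ext^(j+1)(M, X)] *)
Lemma ext_zero_r_last k M X Y Z (i : {linear X -> Y}) (p : {linear Y -> Z}) :
  ses i p -> ext_zero k M Y -> ext_zero k.+1 M X -> ext_zero k M Z.
Proof.
move=> hip; elim: k M => [|k IH] M hY [K [P [l [q [hlq hP hX]]]]].
  rewrite /=; apply: (ext1_of_extends hlq (projective_ext1 hP)) => f.
  have [g gP] := ext1_lifts hip hX f.
  have [h hPh] := hY _ _ _ _ hlq g.
  by exists (linear_comp p h) => x; rewrite gP hPh.
exists K, P, l, q; split=> //; apply: IH hX.
by apply/(ext_zero_syzygy k Y hlq hP).
Qed.

Lemma ext1_retract_r M N N0 : retract N0 N -> ext1_zero M N0 -> ext1_zero M N.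
Proof.
move=> [s [r sr]] h X Y i p hip f.
have [g gP] := h _ _ _ _ hip (linear_comp s f).
by exists (linear_comp r g) => x; rewrite /= -gP /= sr.
Qed.

Lemma ext_zero_retract_r k M N N0 :
  retract N0 N -> ext_zero k M N0 -> ext_zero k M N.
Proof.
move=> hN; elim: k M => [|k IH] M /=; first exact: ext1_retract_r.
by move=> [K [P [l [q [hlq hP /IH hX]]]]]; exists K, P, l, q.
Qed.

Lemma ext_zero_power_r k m M N :
  ext_zero k M N -> ext_zero k M {ffun 'I_m -> N}.
Proof.
elim: k M => [|k IH] M /= h; last first.
  by have [K [P [l [q [hlq hP /IH hX]]]]] := h; exists K, P, l, q.
move=> X Y i p hip f.
have /choice[g gP] : forall j, exists g : {linear Y -> N}, forall x, f x j = g (i x).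
  by move=> j; exact: (h _ _ _ _ hip (linear_comp (power_pr N j) f)).
have [g' g'P] := power_tuple g; exists g' => x; apply/ffunP => j.
by rewrite g'P gP.
Qed.

Lemma ext_zero_add_r k M N N0 :
  in_add N0 N -> ext_zero k M N0 -> ext_zero k M N.
Proof.
move=> /in_add_retract[m hN] h.
exact/(ext_zero_retract_r hN)/ext_zero_power_r.
Qed.

Lemma projective_power m P : projective P -> projective {ffun 'I_m -> P}.
Proof.
move=> hP X Y p f po.
have /choice[g gP] : forall j : 'I_m, exists g : {linear P -> X},
    forall x, f (power_in P j x) = p (g x).
  by move=> j; exact: (hP _ _ p (linear_comp f (power_in P j)) po).
have [g' g'P] := power_cotuple g; exists g' => x.
rewrite g'P linear_sum [in LHS](power_in_pr x) linear_sum.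
by apply: eq_bigr => j _; rewrite gP.
Qed.

Lemma injective_power m I : injective_module I -> injective_module {ffun 'I_m -> I}.
Proof.
move=> hI X Y i f ii.
have /choice[g gP] : forall j : 'I_m, exists g : {linear Y -> I},
    forall x, f x j = g (i x).
  by move=> j; exact: (hI _ _ i (linear_comp (power_pr I j) f) ii).
have [g' g'P] := power_tuple g; exists g' => x; apply/ffunP => j.
by rewrite g'P gP.
Qed.

Definition enough_projectives : Prop :=
  forall M, finitely_generated M ->
  exists K P (i : {linear K -> P}) (p : {linear P -> M}),
  [/\ ses i p, projective P, finitely_generated P & finitely_generated K].

Definition enough_injectives : Prop :=
  forall N, finitely_generated N ->
  exists I C (i : {linear N -> I}) (p : {linear I -> C}),
  [/\ ses i p, injective_module I & finitely_generated C].

(** Shifting along an injective copresentation of the second argument turns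
    the sequences in the first argument, which would otherwise require
    comparing projective presentations of three modules, into the case of
    [Ext^1] and [Ext^2]. *)
Section Enough.
Hypothesis hproj : enough_projectives.

Lemma injective_ext_zero k M I :
  finitely_generated M -> injective_module I -> ext_zero k M I.
Proof.
move=> + hI; elim: k M => [|k IH] M hM /=; first exact: injective_ext1.
have [K [P [i [p [hip hP _ hK]]]]] := hproj hM.
by exists K, P, i, p; split=> //; apply: IH.
Qed.

Lemma ext_zero_cosyzygy k M N I C (i : {linear N -> I}) (p : {linear I -> C}) :
  finitely_generated M -> ses i p -> injective_module I ->
  ext_zero k.+1 M N <-> ext_zero k M C.
Proof.
move=> hM hip hI; split=> h.
  exact: (ext_zero_r_last hip (injective_ext_zero _ hM hI)).
exact: (ext_zero_r_first hip h (injective_ext_zero _ hM hI)).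
Qed.

Hypothesis hinj : enough_injectives.

(** [Ext^j(X, N) -> Ext^(j+1)(Z, N) -> Ext^(j+1)(Y, N)] *)
Lemma ext_zero_l_last k X Y Z N (i : {linear X -> Y}) (p : {linear Y -> Z}) :
  finitely_generated X -> finitely_generated Y -> finitely_generated Z ->
  finitely_generated N ->
  ses i p -> ext_zero k X N -> ext_zero k.+1 Y N -> ext_zero k.+1 Z N.
Proof.
move=> fX fY fZ fN hip; elim: k N fN => [|k IH] N fN hX hY.
  have [I [C [l [q [hlq hI _]]]]] := hinj fN.
  apply/(ext_zero_cosyzygy 0 fZ hlq hI).
  have hYC : ext1_zero Y C by apply/(ext_zero_cosyzygy 0 fY hlq hI).
  apply: (ext1_of_extends hip hYC) => f.
  have [g gP] := ext1_lifts hlq hX f.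
  have [h hP] := hI _ _ i g (ses_inj hip).
  by exists (linear_comp q h) => x; rewrite gP hP.
have [I [C [l [q [hlq hI hC]]]]] := hinj fN.
apply/(ext_zero_cosyzygy _ fZ hlq hI); apply: IH => //.
  exact/(ext_zero_cosyzygy _ fX hlq hI).
exact/(ext_zero_cosyzygy _ fY hlq hI).
Qed.

(** [Ext^j(Y, N) -> Ext^j(X, N) -> Ext^(j+1)(Z, N)] *)
Lemma ext_zero_l_first k X Y Z N (i : {linear X -> Y}) (p : {linear Y -> Z}) :
  finitely_generated X -> finitely_generated Y -> finitely_generated Z ->
  finitely_generated N ->
  ses i p -> ext_zero k Y N -> ext_zero k.+1 Z N -> ext_zero k X N.
Proof.
move=> fX fY fZ fN hip; elim: k N fN => [|k IH] N fN hY hZ.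
  have [I [C [l [q [hlq hI _]]]]] := hinj fN.
  rewrite /=; apply: (ext1_of_lifts hlq (injective_ext1 hI)) => f.
  have hZC : ext1_zero Z C by apply/(ext_zero_cosyzygy 0 fZ hlq hI).
  have [g gP] := hZC _ _ _ _ hip f.
  have [h hP] := ext1_lifts hlq hY g.
  by exists (linear_comp h i) => x; rewrite gP hP.
have [I [C [l [q [hlq hI hC]]]]] := hinj fN.
apply/(ext_zero_cosyzygy _ fX hlq hI); apply: IH => //.
  exact/(ext_zero_cosyzygy _ fY hlq hI).
exact/(ext_zero_cosyzygy _ fZ hlq hI).
Qed.

Lemma ext_zero_power_l k m M N :
  ext_zero k M N -> finitely_generated M -> ext_zero k {ffun 'I_m -> M} N.
Proof.
elim: k M => [|k IH] M hM fM /=; have [K [P [l [q [hlq hP _ fK]]]]] := hproj fM.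
  apply: (ext1_of_extends (ses_power m hlq)) => [|f].
    exact/projective_ext1/projective_power.
  have /choice[g gP] : forall j : 'I_m, exists g : {linear P -> N},
      forall x, f (power_in K j x) = g (l x).
    by move=> j; exact: (hM _ _ _ _ hlq (linear_comp f (power_in K j))).
  have [g' g'P] := power_cotuple g; exists g' => x.
  rewrite g'P [in LHS](power_in_pr x) linear_sum.
  by apply: eq_bigr => j _; rewrite gP /= ffunE.
exists {ffun 'I_m -> K}, {ffun 'I_m -> P}, (power_map m l), (power_map m q).
split; [exact: ses_power|exact: projective_power|apply: IH => //].
exact/(ext_zero_syzygy k N hlq hP).
Qed.

Lemma ext_zero_retract_l k M M0 N :
  finitely_generated M -> finitely_generated M0 -> finitely_generated N ->
  retract M0 M -> ext_zero k M0 N -> ext_zero k M N.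
Proof.
move=> fM fM0 + hM; elim: k N => [|k IH] N fN h; first exact: ext1_retract_l h.
have [I [C [l [q [hlq hI hC]]]]] := hinj fN.
apply/(ext_zero_cosyzygy _ fM hlq hI); apply: IH => //.
exact/(ext_zero_cosyzygy _ fM0 hlq hI).
Qed.

End Enough.

(** ** Comparison with projective resolutions *)

(** A cocycle [P_(j+1) -> N] is a map from the syzygy [Omega^(j+1) M] to [N],
    and it is a coboundary when this map extends to [P_j]. *)
Lemma resolution_ext_zero j M N (P : nat -> lmodType A)
    (d : forall k, {linear P k.+1 -> P k}) (e : {linear P 0%N -> M}) :
  projective_resolution d e ->
  (forall f : {linear P j.+1 -> N}, (forall x, f (d j.+1 x) = 0) ->
     exists g : {linear P j -> N}, forall x, f x = g (d j x)) <->
  ext_zero j M N.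
Proof.
elim: j M P d e => [|j IH] M P d e [hP /range_setT_onto eo
    /range_kernel_exact[ed de] hd];
  have [K [i hi]] := kernel_ses eo;
  have [e' e'P] : exists e' : {linear P 1%N -> K}, forall x, i (e' x) = d 0%N x
    by [apply: (factor_inj (ses_inj hi)) => x; apply: (ses_exact hi)];
  have e'o : onto e' by
    [move=> x; have [y yP] := de _ (ses_zero hi x);
     exists y; apply: (ses_inj hi); rewrite e'P].
  have e'E x : (e' x = 0) <-> (exists y, d 1%N y = x).
    have /range_kernel_exact[dd d1] := hd 0%N.
    split=> [x0|[y <-]]; first by apply: d1; rewrite -e'P x0 linear0.
    by apply: (ses_inj hi); rewrite e'P dd linear0.
  split=> [h|h f f0].
    apply: (ext1_of_extends hi (projective_ext1 (hP 0%N).2)) => f.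
    have [|g gP] := h (linear_comp f e').
      by move=> x /=; rewrite (_ : e' _ = 0) ?linear0//; apply/e'E; exists x.
    by exists g => x; have [y <-] := e'o x; rewrite e'P -gP.
  have [g gP] : exists g : {linear K -> N}, forall x, g (e' x) = f x.
    by apply: factor_onto => // x /e'E[y <-].
  have [u uP] := h _ _ _ _ hi g.
  by exists u => x; rewrite -gP uP e'P.
have hK : projective_resolution (fun k => d k.+1) e'.
  split=> //; first exact/range_setT_onto.
  have /range_kernel_exact[dd d1] := hd 0%N.
  apply/range_kernel_exact; split=> [x|y y0].
    by apply: (ses_inj hi); rewrite e'P dd linear0.
  by apply: d1; rewrite -e'P y0 linear0.
apply: iff_trans (IH _ _ _ _ hK) _.
exact: iff_sym (ext_zero_syzygy j N hi (hP 0%N).2).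
Qed.

Lemma resolution_exists M : enough_projectives -> finitely_generated M ->
  exists (P : nat -> lmodType A) (d : forall k, {linear P k.+1 -> P k})
         (e : {linear P 0%N -> M}), projective_resolution d e.
Proof.
move=> hproj fM.
pose obj := {M : lmodType A | finitely_generated M}.
pose data (X : obj) := {K : obj & {P : lmodType A &
  ({linear sval K -> P} * {linear P -> sval X})%type}}.
pose good (X : obj) (t : data X) :=
  let: existT K (existT P (i, p)) := t in
  [/\ ses i p, projective P & finitely_generated P].
have st (X : obj) : {t : data X | good X t}.
  apply: cid; have [K [P [i [p [h1 h2 h3 h4]]]]] := hproj _ (svalP X).
  by exists (existT _ (exist _ K h4) (existT _ P (i, p))).
pose X k := iter k (fun T : obj => projT1 (sval (st T))) (exist _ M fM : obj).
pose P k := projT1 (projT2 (sval (st (X k)))).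
pose i k : {linear sval (X k.+1) -> P k} := (projT2 (projT2 (sval (st (X k))))).1.
pose p k : {linear P k -> sval (X k)} := (projT2 (projT2 (sval (st (X k))))).2.
have hip k : [/\ ses (i k) (p k), projective (P k) & finitely_generated (P k)].
  suff goodE T (t : data T) : good T t ->
      [/\ ses (projT2 (projT2 t)).1 (projT2 (projT2 t)).2,
          projective (projT1 (projT2 t)) & finitely_generated (projT1 (projT2 t))].
    exact: (goodE _ _ (svalP (st (X k)))).
  by case: t => K [P' [i' p']].
exists P, (fun k => linear_comp (i k) (p k.+1)), (p 0%N); split.
- by move=> k; have [] := hip k.
- by apply/range_setT_onto; have [[]] := hip 0%N.
- have [h0 _ _] := hip 0%N; have [h1 _ _] := hip 1%N.
  apply/range_kernel_exact; split=> [x|y /(ses_exact h0)[x <-]].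
    by rewrite /= (ses_zero h0).
  by have [z <-] := ses_onto h1 x; exists z.
move=> k; have [h0 _ _] := hip k; have [h1 _ _] := hip k.+1.
have [h2 _ _] := hip k.+2.
apply/range_kernel_exact; split=> [x|y /= /(inj_kernel0 (ses_inj h0))].
  by rewrite /= (ses_zero h1) linear0.
by move=> /(ses_exact h1)[x <-]; have [z <-] := ses_onto h2 x; exists z.
Qed.

Lemma Ext_vanishesE j M N : enough_projectives -> finitely_generated M ->
  Ext_vanishes j.+1 M N <-> ext_zero j M N.
Proof.
move=> hproj fM; split=> [[P [d [e [hP /(resolution_ext_zero _ _ hP)]]]]//|h].
have [P [d [e hP]]] := resolution_exists hproj fM.
by exists P, d, e; split=> //; apply/(resolution_ext_zero _ _ hP).
Qed.

End ExtVanishing.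

(** * Finitely generated modules *)

Section FinitelyGenerated.
Context (A : pzRingType).
Implicit Types X Y Z M N V W K L P I C B : lmodType A.

Lemma fg_of_family (T : finType) M (g : T -> M) :
  (forall x, exists a : T -> A, x = \sum_t a t *: g t) -> finitely_generated M.
Proof.
move=> gP; exists #|T|, (fun i => g (enum_val i)) => x.
have [a ->] := gP x; exists (fun i => a (enum_val i)).
by rewrite (reindex (@enum_val T T)) //; apply/onW_bij/enum_val_bij.
Qed.

Lemma fg_onto M N (p : {linear M -> N}) :
  onto p -> finitely_generated M -> finitely_generated N.
Proof.
move=> po [k [g gP]]; exists k, (fun i => p (g i)) => y.
have [x <-] := po y; have [a ->] := gP x; exists a.
by rewrite linear_sum; apply: eq_bigr => i _; rewrite linearZ.
Qed.

Lemma fg_retract M N : retract M N -> finitely_generated M -> finitely_generated N.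
Proof. by move=> [s [r sr]]; apply: (@fg_onto _ _ r) => x; exists (s x). Qed.

Lemma fg_ses X Y Z (i : {linear X -> Y}) (p : {linear Y -> Z}) :
  ses i p -> finitely_generated X -> finitely_generated Z -> finitely_generated Y.
Proof.
move=> hip [k [g gP]] [l [h hP]].
have [h' h'P] := onto_section (ses_onto hip).
pose G (t : 'I_k + 'I_l) := match t with inl u => i (g u) | inr v => h' (h v) end.
apply: (@fg_of_family _ _ G) => y; have [b bP] := hP (p y).
have [|x xP] := ses_exact hip (y := y - \sum_v b v *: h' (h v)).
  rewrite linearB linear_sum bP; apply/eqP; rewrite subr_eq0; apply/eqP.
  by apply: eq_bigr => v _; rewrite linearZ /= h'P.
have [a aP] := gP x.
exists (fun t => match t with inl u => a u | inr v => b v end).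
rewrite big_sumType /=; apply: (canRL (subrK _)); rewrite -xP aP linear_sum.
by apply: eq_bigr => u _; rewrite linearZ.
Qed.

Lemma fg_power k M : finitely_generated M -> finitely_generated {ffun 'I_k -> M}.
Proof.
move=> [l [g gP]].
apply: (@fg_of_family _ _ (fun t : 'I_k * 'I_l => power_in M t.1 (g t.2))) => x.
have /choice[a aP] : forall i, exists a : 'I_l -> A, x i = \sum_j a j *: g j.
  by move=> i; exact: gP.
exists (fun t => a t.1 t.2).
rewrite [LHS]power_in_pr -(pair_bigA _ (fun i j => a i j *: power_in M i (g j))).
apply: eq_bigr => i _; rewrite (aP i : power_pr M i x = _) linear_sum.
by apply: eq_bigr => j _; rewrite linearZ.
Qed.

Lemma fg_regular : finitely_generated A^o.
Proof.
exists 1%N, (fun _ => 1) => x; exists (fun _ => x).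
by rewrite big_ord1 -[RHS]/(x * 1) mulr1.
Qed.

Lemma regular_map_linear M (x : M) : linear (fun a : A^o => (a : A) *: x).
Proof. by move=> a b c; rewrite scalerDl -[a *: b]/(a * b) scalerA. Qed.

Definition regular_map M (x : M) : {linear A^o -> M} :=
  linear_pack (regular_map_linear x).

Lemma fg_free_cover M : finitely_generated M ->
  exists k (p : {linear {ffun 'I_k -> A^o} -> M}), onto p.
Proof.
move=> [k [g gP]]; exists k.
have [p pP] := power_cotuple (fun i => regular_map (g i)).
exists p => x; have [a ->] := gP x; exists [ffun i => a i].
by rewrite pP; apply: eq_bigr => i _; rewrite ffunE.
Qed.

Lemma regular_projective : projective A^o.
Proof.
move=> X Y p f /range_setT_onto po; have [x xP] := po (f 1).
exists (regular_map x) => a /=.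
by rewrite linearZ /= xP -linearZ; congr (f _); rewrite -[RHS]/(a * 1) mulr1.
Qed.

Lemma image_factor M N (f : {linear M -> N}) :
  exists I (e : {linear M -> I}) (m : {linear I -> N}),
  [/\ onto e, injective m & forall x, f x = m (e x)].
Proof.
have hT : submodule [set: M] by [].
have [I [m [mi mP]]] := submodule_module (submodule_image f hT).
have [e eP] : exists e : {linear M -> I}, forall x, m (e x) = f x.
  by apply: factor_inj => // x; apply/mP; exists x.
exists I, e, m; split=> // y.
have /mP[x _ xy] : exists x, m x = m y by exists y.
by exists x; apply: mi; rewrite eP.
Qed.

Definition noetherian M : Prop :=
  forall N (i : {linear N -> M}), injective i -> finitely_generated N.

Lemma noetherian_ses X Y Z (i : {linear X -> Y}) (p : {linear Y -> Z}) :
  ses i p -> noetherian X -> noetherian Z -> noetherian Y.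
Proof.
move=> hip hX hZ N j ji.
have [I [e [m [eo mi em]]]] := image_factor (linear_comp p j).
have [K [k hk]] := kernel_ses eo.
have [l lP] : exists l : {linear K -> X}, forall x, i (l x) = j (k x).
  apply: (factor_inj (f := linear_comp j k) (ses_inj hip)) => x /=.
  apply: (ses_exact hip).
  by rewrite -[p _]/(linear_comp p j _) em (ses_zero hk) linear0.
apply: (fg_ses hk); last exact: hZ mi.
apply: (hX _ l) => x y xy; apply: (ses_inj hk); apply: ji.
by rewrite -!lP xy.
Qed.

Lemma noetherian_enough_projectives :
  (forall M, finitely_generated M -> noetherian M) -> enough_projectives A.
Proof.
move=> hN M fM; have [k [p po]] := fg_free_cover fM.
have [K [i hi]] := kernel_ses po.
have fF := fg_power k fg_regular.
exists K, {ffun 'I_k -> A^o}, i, p; split=> //.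
  exact/projective_power/regular_projective.
exact: (hN _ fF _ i (ses_inj hi)).
Qed.

End FinitelyGenerated.

(** * Commutative artin rings *)

(** ** Minimal and maximal submodules *)

Section Extremal.
Context (A : pzRingType).
Implicit Types M N : lmodType A.

Lemma artinian_min M (C : set M -> Prop) :
  artinian M -> (exists2 S, submodule S & C S) ->
  exists S, [/\ submodule S, C S
    & forall S', submodule S' -> C S' -> S' `<=` S -> S' = S].
Proof.
move=> hM [S0 hS0 CS0]; apply: contrapT => nmin.
pose T := {S : set M | submodule S /\ C S}.
have /choice[f fP] : forall S : T, exists S' : T,
    sval S' `<=` sval S /\ sval S' <> sval S.
  move=> [S [hS CS]]; apply: contrapT => hn; apply: nmin; exists S; split=> //.
  move=> S' hS' CS' sub; apply: contrapT => neq; apply: hn.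
  by exists (exist _ S' (conj hS' CS')).
pose s k := iter k f (exist _ S0 (conj hS0 CS0) : T).
have [k kP] := hM (fun k => sval (s k)) (fun k => (svalP (s k)).1)
  (fun k => (fP (s k)).1).
by apply: (fP (s k)).2; apply: (kP k.+1).
Qed.

Lemma artinian_onto M N (p : {linear M -> N}) : onto p -> artinian M -> artinian N.
Proof.
move=> po hM S hS dS.
have [k kP] := hM (fun k => [set x | S k (p x)])
  (fun k => submodule_preimage p (hS k)) (fun k x => dS k (p x)).
exists k => l kl; apply/predeqP => y; have [x <-] := po y.
by have /predeqP/(_ x) := kP l kl.
Qed.

Lemma zorn_submodule M (S : set M) x : submodule S -> ~ S x ->
  exists S', [/\ submodule S', S `<=` S', ~ S' x
    & forall T, submodule T -> S' `<=` T -> ~ T x -> T = S'].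
Proof.
move=> hS Sx.
have [S0 SD SZ] := hS.
(* The union with [S] makes room for the union of the empty chain. *)
pose P : set (set M) := [set B | submodule (S `|` B) /\ ~ (S `|` B) x].
have [|B [[hB Bx] Bmax]] := @Zorn_bigcup M P; last first.
  exists (S `|` B); split=> // T hT sT Tx.
  apply/seteqP; split=> //; apply: contrapT => nTB; apply: (Bmax T).
    split=> [z Bz|TB]; first by apply: sT; right.
    by apply: nTB => z Tz; right; apply: TB.
  by split; rewrite (setUidr (fun z Sz => sT z (or_introl Sz))).
move=> F FP Ftot.
have big y z : (S `|` \bigcup_(X in F) X) y -> (S `|` \bigcup_(X in F) X) z ->
    (S y /\ S z) \/ exists2 B, F B & (S `|` B) y /\ (S `|` B) z.
  case=> [Sy|[B FB By]]; case=> [Sz|[B' FB' B'z]].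
  - by left.
  - by right; exists B' => //; split; [left|right].
  - by right; exists B => //; split; [right|left].
  - right; have [BB'|B'B] := Ftot _ _ FB FB'.
      by exists B' => //; split; right=> //; apply: BB'.
    by exists B => //; split; right=> //; apply: B'B.
have sub B : F B -> S `|` B `<=` S `|` \bigcup_(X in F) X.
  by move=> FB z [Sz|Bz]; [left|right; exists B].
split; last first.
  by case=> // -[B FB Bx]; have [_] := FP _ FB; apply; right.
split; first by left.
  move=> y z yP zP; have [[Sy Sz]|[B FB [By Bz]]] := big y z yP zP.
    by left; apply: SD.
  by apply: (sub _ FB); have [[_ BD _] _] := FP _ FB; apply: BD.
move=> a y yP; have [[Sy _]|[B FB [By _]]] := big y y yP yP.
  by left; apply: SZ.
by apply: (sub _ FB); have [[_ _ BZ] _] := FP _ FB; apply: BZ.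
Qed.

End Extremal.

Section MaximalIdeals.
Context (R : comNzRingType).
Implicit Types (I m : set R^o) (M X Y Z : lmodType R).

Lemma ideal_mul I : submodule I -> forall a b : R, I b -> I (a * b).
Proof. by move=> [_ _ IZ] a b; apply: IZ. Qed.

Lemma maximal_ideal_above I : submodule I -> ~ I 1 ->
  exists2 m, maximal_ideal m & I `<=` m.
Proof.
move=> hI I1; have [m [hm Im m1 mmax]] := zorn_submodule hI I1.
exists m => //; split=> // [mT|K hK mK]; first by apply: m1; rewrite mT.
have [K1|K1] := EM (K 1); last by left; apply: mmax.
by right; apply/seteqP; split=> // r _; rewrite -[r]mulr1; apply: ideal_mul.
Qed.

Lemma maximal_ideal1 m : maximal_ideal m -> ~ m 1.
Proof.
move=> [hm mT _] m1; apply: mT; apply/seteqP; split=> // r _.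
by rewrite -[r]mulr1; apply: ideal_mul.
Qed.

Lemma maximal_ideal_inv m (r : R) : maximal_ideal m -> ~ m r ->
  exists c : R, m (1 - c * r).
Proof.
move=> [hm mT mmax] mr; have [m0 mD mZ] := hm.
pose K : set R^o := [set x | exists c : R, m (x - c * r)].
have hK : submodule K.
  split=> [|x y [c cP] [d dP]|a x [c cP]].
  - by exists 0; rewrite mul0r subr0.
  - by exists (c + d); rewrite mulrDl opprD addrACA; apply: mD.
  - by exists (a * c); rewrite -mulrA -[_ *: _]/(a * x) -mulrBr; apply: ideal_mul.
have mK : m `<=` K by move=> x mx; exists 0; rewrite mul0r subr0.
have [KE|KT] := mmax K hK mK; last by have : K 1 by rewrite KT.
by case: mr; rewrite -KE; exists 1; rewrite mul1r subrr.
Qed.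

Lemma maximal_ideal_prime m (a b : R) :
  maximal_ideal m -> m (a * b) -> ~ m a -> m b.
Proof.
move=> mm mab ma; have [c cP] := maximal_ideal_inv mm ma.
have [hm _ _] := mm; have [_ mD _] := hm.
rewrite -[b](subrK (c * (a * b))); apply: mD; last exact: ideal_mul.
by rewrite mulrA -{1}[b]mul1r -mulrBl mulrC; apply: ideal_mul.
Qed.

Lemma maximal_ideal_sub m m' : maximal_ideal m -> maximal_ideal m' ->
  m `<=` m' -> m' = m.
Proof. by move=> [_ _ mmax] [hm' m'T _] /(mmax _ hm')[]. Qed.

(** In an artinian ring the maximal ideals are separated by single elements:
    a minimal ideal not contained in [m] lies in every other maximal ideal. *)
Lemma maximal_ideal_separate m : artinian R^o -> maximal_ideal m ->
  exists2 s : R, ~ m s & forall m', maximal_ideal m' -> m' <> m -> m' s.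
Proof.
move=> hR mm; have hm := mm; case: hm => hm _ _.
have [|I [hI [s Is ms] Imin]] :=
    artinian_min (C := fun I => exists2 s, I s & ~ m s) hR.
  by exists setT => //; exists 1 => //; apply: maximal_ideal1.
exists s => // m' mm' m'm.
suff Im' : I `&` m' = I by move: Is; rewrite -Im' => -[].
have [hm' _ _] := mm'.
apply: Imin => [||x []//].
  have [I0 ID IZ] := hI; have [m'0 m'D m'Z] := hm'.
  split=> // [x y [Ix mx] [Iy my]|a x [Ix mx]].
    by split; [apply: ID|apply: m'D].
  by split; [apply: IZ|apply: m'Z].
have [t m't mt] : exists2 t, m' t & ~ m t.
  apply: contrapT => hn; apply: m'm; apply/esym/(maximal_ideal_sub mm' mm).
  by move=> t m't; apply: contrapT => mt; apply: hn; exists t.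
exists (t * s); last by move=> /(maximal_ideal_prime mm) /(_ mt).
by split; [apply: ideal_mul|rewrite mulrC; apply: ideal_mul].
Qed.

(** ** Finite length *)

(** This replaces the vanishing of some finite product of maximal ideals. A
    minimal ideal [I] with [I N = N] satisfies [m I = I] for every [m], hence lies
    in the radical; if [N] is nonzero, a minimal ideal [K] with [K N] nonzero is
    generated by some [k] and equals [k I], so [k = k b] with [b] in the radical
    and [k = 0]. *)
Lemma artinian_radical_nilpotent M (N : set M) :
  artinian R^o -> submodule N ->
  (forall m, maximal_ideal m -> forall S : set M, submodule S ->
     (forall a n, m a -> N n -> S ((a : R) *: n)) -> N `<=` S) ->
  forall n, N n -> n = 0.
Proof.
move=> hR hN mN.
pose full I := forall S : set M, submodule S ->
   (forall a n, I a -> N n -> S ((a : R) *: n)) -> N `<=` S.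
have [|I [hI fI Imin]] := artinian_min (C := full) hR.
  by exists setT => // S hS SP n Nn; rewrite -[n]scale1r; apply: SP.
have Irad m : maximal_ideal m -> I `<=` m.
  move=> mm; have [hm _ _] := mm.
  pose mI : set R^o := [set r | forall T : set R^o, submodule T ->
    (forall a b : R, m a -> I b -> T (a * b)) -> T r].
  have hmI : submodule mI.
    split=> [T [T0 _ _] //|x y xP yP T hT TP|a x xP T hT TP].
      by have [_ TD _] := hT; apply: TD; [apply: xP|apply: yP].
    by have [_ _ TZ] := hT; apply: TZ; apply: xP.
  suff <- : mI = I.
    by move=> x; apply=> // a b ma Ib; rewrite mulrC; apply: ideal_mul.
  apply: Imin => // [S hS SP|x].
    apply: (mN _ mm) => // a n ma Nn.
    apply: (fI [set n | S (a *: n)]) Nn.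
      have [S0 SD SZ] := hS; split=> /= [|x y Sx Sy|b x Sx].
      - by rewrite scaler0.
      - by rewrite scalerDr; apply: SD.
      - by rewrite scalerA mulrC -scalerA; apply: SZ.
    by move=> b n' Ib Nn' /=; rewrite scalerA; apply: SP => // T _; apply.
  by apply=> // a b _; apply: ideal_mul.
move=> n0 Nn0; apply: contrapT => n00.
have [|K [hK [k [n [Kk Nn kn]]] Kmin]] := artinian_min
    (C := fun K : set R^o => exists (k : R) n, [/\ K k, N n & (k : R) *: n <> 0]) hR.
  by exists setT => //; exists 1, n0; rewrite scale1r.
have [I0 ID IZ] := hI.
have : [set x : R^o | exists2 b : R, I b & x = k * b] = K.
  apply: Kmin.
  - split=> [|x y [b Ib ->] [c Ic ->]|a x [b Ib ->]].
    + by exists 0 => //; rewrite mulr0.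
    + by exists (b + c); [exact: ID|rewrite mulrDr].
    + by exists (a * b); [exact: IZ|rewrite -[_ *: _]/(a * _) mulrCA].
  - apply: contrapT => hn; apply: kn.
    have hS : submodule [set x : M | (k : R) *: x = 0].
      split=> /= [|x y x0 y0|a x x0]; first by rewrite scaler0.
        by rewrite scalerDr x0 y0 addr0.
      by rewrite scalerA mulrC -scalerA x0 scaler0.
    apply: (fI _ hS) Nn => b n' Ib Nn' /=; apply: contrapT => bn'.
    by apply: hn; exists (k * b), n'; split=> //; [exists b|rewrite -scalerA].
  - by move=> _ [b _ ->]; rewrite mulrC; apply: (ideal_mul hK).
move=> /predeqP/(_ k)[_ /(_ Kk)[b Ib kb]].
have [c cb] : exists c : R, c * (1 - b) = 1.
  apply: contrapT => hn.
  have hB : submodule [set x : R^o | exists c : R, x = c * (1 - b)].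
    split=> [|x y [c ->] [d ->]|a x [c ->]]; first by exists 0; rewrite mul0r.
      by exists (c + d); rewrite mulrDl.
    by exists (a * c); rewrite -mulrA.
  have [|m mm mB] := maximal_ideal_above hB.
    by move=> [c /esym c1]; apply: hn; exists c.
  apply: (maximal_ideal1 mm); rewrite -[1](subrK b).
  have [[_ mD _] _ _] := mm; apply: mD; last exact: Irad.
  by apply: mB; exists 1; rewrite mul1r.
by apply: kn; rewrite -[k]mulr1 -cb mulrCA mulrBr mulr1 -kb subrr mulr0 scale0r.
Qed.

(** A simple module, presented as [R / m] with the class [x] of [1]. *)
Definition simple_at m M (x : M) : Prop :=
  [/\ maximal_ideal m, forall y, exists r : R, y = r *: x
    & forall r, m r <-> (r : R) *: x = 0].

(** Finite length of finitely generated modules, as an induction principle. A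
    cyclic module [M] is artinian, so it has a submodule [N] which is minimal
    with [Pr (M / N)]; if some [m N] were smaller than [N], a submodule of [N]
    containing [m N] and maximal without a given element of [N] would give a
    simple quotient of [N] and contradict the minimality. So [m N = N] for all
    [m], and [N = 0]. *)
Lemma artin_fg_ind (Pr : lmodType R -> Prop) :
  artinian R^o ->
  (forall M, zero_module M -> Pr M) ->
  (forall m M (x : M), simple_at m x -> Pr M) ->
  (forall X Y Z (i : {linear X -> Y}) (p : {linear Y -> Z}),
     ses i p -> Pr X -> Pr Z -> Pr Y) ->
  forall M, finitely_generated M -> Pr M.
Proof.
move=> hR Pr0 Prs Pre.
have art M : artinian M -> Pr M.
  move=> hM; have hT : submodule [set: M] by [].
  have [|N [hN [Z [p [po pP PrZ]]] Nmin]] := artinian_min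
      (C := fun N => exists Z (p : {linear M -> Z}),
         [/\ onto p, forall x, p x = 0 <-> N x & Pr Z]) hM.
    have [Z [p [po pP]]] := quotient_module hT.
    exists setT => //; exists Z, p; split=> //; apply: Pr0 => z.
    by have [x <-] := po z; apply/pP.
  suff N0 : forall n, N n -> n = 0.
    have [K [i hi]] := kernel_ses po.
    apply: (Pre _ _ _ _ _ hi) => //; apply: Pr0 => x.
    by apply: (inj_kernel0 (ses_inj hi)); apply/N0/pP/(ses_zero hi).
  have [N0 ND NZ] := hN.
  apply: (artinian_radical_nilpotent hR hN) => m mm S hS SP n Nn.
  apply: contrapT => Sn.
  have [S0 SD SZ] := hS.
  have hSN : submodule (S `&` N).
    split=> // [x y [Sx Nx] [Sy Ny]|a x [Sx Nx]].
      by split; [apply: SD|apply: ND].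
    by split; [apply: SZ|apply: NZ].
  have [|S' [hS' SS' S'n S'max]] := zorn_submodule (x := n) hSN; first by case.
  have [S'0 S'D S'Z] := hS'.
  have hN' : submodule (S' `&` N).
    split=> // [x y [Sx Nx] [Sy Ny]|a x [Sx Nx]].
      by split; [apply: S'D|apply: ND].
    by split; [apply: S'Z|apply: NZ].
  have mN a x : m a -> N x -> (S' `&` N) ((a : R) *: x).
    move=> ma Nx; have Nax : N ((a : R) *: x) by apply: NZ.
    by split=> //; apply: SS'; split=> //; apply: SP.
  have span y : N y -> exists r : R, (S' `&` N) (y - r *: n).
    move=> Ny; have [S'y|S'y] := EM (S' y).
      by exists 0; rewrite scale0r subr0.
    pose T : set M := [set z | exists r : R, S' (z - r *: y)].
    have hT' : submodule T.
      split=> [|u v [r rP] [t tP]|a u [r rP]].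
      - by exists 0; rewrite scale0r subr0.
      - by exists (r + t); rewrite scalerDl opprD addrACA; apply: S'D.
      - by exists (a * r); rewrite -scalerA -scalerBr; apply: S'Z.
    have [r S'r] : T n.
      apply: contrapT => Tn; apply: S'y; rewrite -(S'max T) //.
        by exists 1; rewrite scale1r subrr.
      by move=> z S'z; exists 0; rewrite scale0r subr0.
    have mr : ~ m r.
      move=> /mN /(_ Ny) [S'ry _]; apply: S'n.
      by rewrite -[n](subrK (r *: y)); apply: S'D.
    have [c mc] := maximal_ideal_inv mm mr; exists c.
    have -> : y - c *: n = (1 - c * r) *: y - c *: (n - r *: y).
      by rewrite scalerBr scalerBl scale1r scalerA opprB addrA subrK.
    apply: (submoduleB hN'); first exact: mN.
    have [_ _ N'Z] := hN'; apply: N'Z; split=> //.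
    by apply: (submoduleB hN) => //; apply: NZ.
  have [Z' [p' [p'o p'P]]] := quotient_module hN'.
  have [u uP] : exists u : {linear Z' -> Z}, forall x, u (p' x) = p x.
    by apply: factor_onto => // x /p'P[_ /pP].
  have uo : onto u by move=> z; have [x <-] := po z; exists (p' x).
  have [K [k hk]] := kernel_ses uo.
  have [|x xP] := ses_exact hk (y := p' n); first by rewrite uP; apply/pP.
  suff : S' `&` N = N by move=> /predeqP/(_ n)[_ /(_ Nn)[]].
  apply: Nmin => //.
  exists Z', p'; split=> //; apply: (Pre _ _ _ _ _ hk) => //.
  apply: (Prs m _ x); split=> // [y|r].
    have [z zP] := p'o (k y).
    have [|r /p'P rP] := span z; first by apply/pP; rewrite -uP zP (ses_zero hk).
    exists r; apply: (ses_inj hk); apply/subr0_eq.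
    by rewrite linearZ /= xP -zP -linearZ -linearB.
  split=> [mr|r0].
    apply: (ses_inj hk); rewrite linear0 linearZ /= xP -linearZ; apply/p'P.
    exact: mN.
  apply: contrapT => mr; have [c mc] := maximal_ideal_inv mm mr.
  apply: S'n; rewrite -[n](subrK (c * r *: n)); apply: S'D.
    by rewrite -{1}[n]scale1r -scalerBl; have [] := mN _ _ mc Nn.
  rewrite -scalerA; apply: S'Z.
  suff /p'P[] : p' (r *: n) = 0 by [].
  by rewrite linearZ /= -xP -linearZ /= r0 linear0.
move=> M [k]; elim: k M => [|k IH] M [g gP].
  by apply: Pr0 => x; have [a ->] := gP x; rewrite big_ord0.
have [I [e [i [eo ii ei]]]] := image_factor (regular_map (g ord0)).
have [Z [p hp]] := cokernel_ses ii.
apply: (Pre _ _ _ _ _ hp); first exact/art/(artinian_onto eo).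
apply: IH; exists (fun j => p (g (lift ord0 j))) => z.
have [y <-] := ses_onto hp z; have [a ->] := gP y.
exists (fun j => a (lift ord0 j)); rewrite big_ord_recl linearD linear_sum /=.
rewrite -[a ord0 *: _]/(regular_map (g ord0) (a ord0)) ei (ses_zero hp) add0r.
by apply: eq_bigr => j _; rewrite linearZ.
Qed.

Lemma artin_noetherian M : artinian R^o -> finitely_generated M -> noetherian M.
Proof.
move=> hR; apply: artin_fg_ind hR _ _ _ M => [M M0 N i ii|m M x|];
  last exact: noetherian_ses.
  exists 0%N, (fun _ => 0) => x; exists (fun _ => 0).
  by rewrite big_ord0; apply: (inj_kernel0 ii).
move=> [mm xM mx] N i ii.
have [[y y0]|N0] := EM (exists y : N, y <> 0); last first.
  exists 0%N, (fun _ => 0) => y; exists (fun _ => 0); rewrite big_ord0.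
  by apply: contrapT => y0; apply: N0; exists y.
exists 1%N, (fun _ => y) => z.
have [r rP] := xM (i y); have [s sP] := xM (i z).
have [|c cP] := maximal_ideal_inv (r := r) mm.
  by move=> /mx r0; apply: y0; apply: (inj_kernel0 ii); rewrite rP.
exists (fun _ => s * c); rewrite big_ord1; apply: ii.
rewrite linearZ /= rP sP; apply/subr0_eq; rewrite scalerA -scalerBl -mulrA.
rewrite -{1}[s]mulr1 -mulrBr -scalerA.
by move/mx: cP => ->; rewrite scaler0.
Qed.

End MaximalIdeals.

(** ** The dualizing module *)

Section Dualizing.
Context (R : comNzRingType) (J : lmodType R).
Hypotheses (hR : artinian R^o) (hJ : dualizing J).
Implicit Types (M X Y Z : lmodType R) (m : set R^o).

Lemma dualizing_injective : injective_module J.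
Proof. by case: hJ => S [q [j [_ _ []]]]. Qed.

(** [J] is an essential extension of [R / rad R], so the elements of [J] killed by
    [m] lie in [R / rad R]; there they are the multiples of the class of an
    element of [R] that separates [m] from the other maximal ideals. *)
Lemma dualizing_socle m : maximal_ideal m ->
  exists s : J, [/\ s <> 0, forall a, m a -> (a : R) *: s = 0
    & forall y, (forall a, m a -> (a : R) *: y = 0) -> exists d : R, y = d *: s].
Proof.
case: hJ => S [q [j [/range_setT_onto qo qrad [_ ji jess]]]] mm.
have [hm _ _] := mm.
have radE (r : R^o) : q r = 0 <-> forall m', maximal_ideal m' -> m' r.
  by rewrite -[q r = 0]/(kernel q r) qrad.
have [s ms sP] := maximal_ideal_separate hR mm.
have mcomb (t : R) m' (a : R) : maximal_ideal m' -> m' t -> m' (a * t).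
  by move=> [hm' _ _]; apply: ideal_mul.
exists (j (q s)); split.
- by move=> /(inj_kernel0 ji)/radE/(_ _ mm).
- move=> a ma; rewrite -!linearZ (_ : q _ = 0) ?linear0//; apply/radE => m' mm'.
  rewrite -[_ *: _]/(a * s).
  have [->|m'm] := EM (m' = m); first by rewrite mulrC; apply: mcomb.
  by apply: mcomb => //; apply: sP.
move=> y ym.
have [t tP] : exists t : R^o, y = j (q t).
  have [->|y0] := EM (y = 0); first by exists 0; rewrite !linear0.
  have hY : submodule [set x : J | exists r : R, x = r *: y].
    split=> [|u v [r ->] [r' ->]|a u [r ->]]; first by exists 0; rewrite scale0r.
      by exists (r + r'); rewrite scalerDl.
    by exists (a * r); rewrite scalerA.
  have [[r [ry0 [u _ uP]]]|nry] :=
      EM (exists r : R, r *: y <> 0 /\ range j (r *: y)).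
    have mr : ~ m r by move=> /ym.
    have [c mc] := maximal_ideal_inv mm mr; have [t tP] := qo (c *: u).
    exists t; rewrite tP linearZ /= uP; apply/subr0_eq.
    by rewrite scalerA -{1}[y]scale1r -scalerBl ym.
  case: y0; suff : [set 0] y by [].
  rewrite -(jess _ hY); first by exists 1; rewrite scale1r.
  apply/predeqP => x; split=> [[[r ->] ryj]|->].
    by apply: contrapT => ry0; apply: nry; exists r.
  by split; [exists 0; rewrite scale0r|exists 0 => //; rewrite linear0].
have [c mc] := maximal_ideal_inv mm ms.
exists ((t : R) * c); rewrite tP -!linearZ; apply/subr0_eq.
rewrite -!linearB (_ : q _ = 0) ?linear0//; apply/radE => m' mm'.
rewrite -[_ *: _]/(t * c * s) -mulrA -{1}[t]mulr1 -mulrBr.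
have [->|m'm] := EM (m' = m); first exact: mcomb.
have [hm' _ _] := mm'.
rewrite mulrC; apply: mcomb => //.
have [a ma m'a] : exists2 a, m a & ~ m' a.
  apply: contrapT => hn; apply: m'm; apply: (maximal_ideal_sub mm mm').
  by move=> a ma; apply: contrapT => m'a; apply: hn; exists a.
apply: (maximal_ideal_prime (a := a)) => //.
have : q (a *: t) = 0.
  by apply: (inj_kernel0 ji); rewrite !linearZ /= -tP ym.
by move=> /radE; apply.
Qed.

(** The annihilator of [x] lies in a maximal ideal [m], so that [R x] maps onto
    a copy of [R / m] in [J]. *)
Lemma dualizing_cogenerator M (x : M) : x <> 0 ->
  exists h : {linear M -> J}, h x <> 0.
Proof.
move=> x0.
have [|m mm xm] := maximal_ideal_above (submodule_kernel (regular_map x)).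
  by rewrite /kernel /= scale1r.
have [s [s0 sm _]] := dualizing_socle mm.
have [I [e [i [eo ii ei]]]] := image_factor (regular_map x).
have [g gP] : exists g : {linear I -> J}, forall r, g (e r) = regular_map s r.
  apply: factor_onto => // r er /=; apply: sm; apply: xm.
  by rewrite -[kernel _ _]/(regular_map x r = 0) ei er linear0.
have [h hP] := dualizing_injective g ii.
exists h; rewrite -[x]scale1r -[_ *: x]/(regular_map x 1) ei -hP gP /=.
by rewrite scale1r.
Qed.

Lemma dualizing_separate M (S : set M) (x : M) : submodule S -> ~ S x ->
  exists h : {linear M -> J}, (forall y, S y -> h y = 0) /\ h x <> 0.
Proof.
move=> hS Sx; have [Z [p [po pP]]] := quotient_module hS.
have [|h hx] := @dualizing_cogenerator Z (p x); first by move/pP.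
by exists (linear_comp h p); split=> // y /pP /= ->; rewrite linear0.
Qed.

(** Surjectivity of the evaluation map from [M] to its double [J]-dual; [xi] is
    an element of the double dual, and its [R]-linearity is expressed pointwise
    on the maps in [Hom(M, J)]. *)
Definition reflexive_module M : Prop :=
  forall xi : {linear M -> J} -> J,
  (forall h h' h'' : {linear M -> J},
     (forall x, h'' x = h x + h' x) -> xi h'' = xi h + xi h') ->
  (forall (r : R) (h h' : {linear M -> J}),
     (forall x, h' x = r *: h x) -> xi h' = r *: xi h) ->
  exists x, forall h, xi h = h x.

Lemma fg_reflexive M : finitely_generated M -> reflexive_module M.
Proof.
apply: artin_fg_ind hR _ _ _ M => [M M0 xi xiD xiZ|m M x [mm xM mx] xi xiD xiZ|].
- exists 0 => h; rewrite linear0 (xiZ 0 h h) ?scale0r// => x.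
  by rewrite [x]M0 linear0 scaler0.
- have [s [s0 sm sgen]] := dualizing_socle mm.
  have ro : onto (regular_map x) by move=> y; have [r ->] := xM y; exists r.
  have [h0 h0P] : exists h : {linear M -> J},
      forall r, h (regular_map x r) = regular_map s r.
    by apply: factor_onto => // r /mx/sm.
  have h0x : h0 x = s by have := h0P 1; rewrite /= !scale1r.
  have [|d dP] := sgen (xi h0).
    move=> a ma; rewrite -(xiZ a h0 \0) => [|y].
      by rewrite (xiZ 0 \0 \0) ?scale0r// => y; rewrite /= scaler0.
    have [r ->] := xM y; rewrite /= linearZ /= h0x scalerA mulrC -scalerA.
    by rewrite sm ?scaler0.
  exists (d *: x) => h.
  have [|r rP] := sgen (h x).
    by move=> a /mx ax; rewrite -linearZ ax linear0.
  rewrite (xiZ r h0 h) => [|y]; first by rewrite dP [RHS]linearZ /= rP !scalerA mulrC.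
  have [t ->] := xM y.
  by rewrite !linearZ /= rP h0x !scalerA mulrC.
move=> X Y Z i p hip hX hZ xi xiD xiZ.
have [||z zP] := hZ (fun h => xi (linear_comp h p)).
- by move=> h h' h'' hE; apply: xiD => x /=; rewrite hE.
- by move=> r h h' hE; apply: xiZ => x /=; rewrite hE.
have [y0 y0P] := ses_onto hip z.
pose ext (g : {linear X -> J}) := cid (dualizing_injective g (ses_inj hip)).
have xi0 (h : {linear Y -> J}) : (forall x, h (i x) = 0) -> xi h = h y0.
  move=> h0; have [u uP] : exists u : {linear Z -> J}, forall y, u (p y) = h y.
    by apply: factor_onto (ses_onto hip) _ => y /(ses_exact hip)[x <-].
  rewrite -uP y0P -zP (xiD (linear_comp u p) \0 h) => [|y]; last first.
    by rewrite /= uP addr0.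
  by rewrite (xiZ 0 \0 \0) ?scale0r ?addr0// => y; rewrite /= scaler0.
have xiE (h h' : {linear Y -> J}) : (forall x, h (i x) = h' (i x)) ->
    xi h - h y0 = xi h' - h' y0.
  move=> hh'; have -> : xi h = h y0 - h' y0 + xi h'.
    rewrite (xiD (h \- h') h' h) => [|y]; last by rewrite /= subrK.
    by rewrite xi0 // => x; rewrite /= hh' subrr.
  by rewrite addrAC [X in X + _]addrAC subrr add0r addrC.
have [||x0 x0P] := hX (fun g => xi (sval (ext g)) - sval (ext g) y0).
- move=> g g' g'' gE.
  rewrite (@xiE _ (sval (ext g) \+ sval (ext g'))) => [|x]; last first.
    by rewrite /= -!(svalP (ext _)).
  by rewrite (xiD (sval (ext g)) (sval (ext g'))) //= opprD addrACA.
- move=> r g g' gE.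
  have rl : linear (fun y => r *: sval (ext g) y).
    by move=> a u v; rewrite linearP scalerDr !scalerA mulrC.
  rewrite (@xiE _ (linear_pack rl)) => [|x]; last first.
    by rewrite /= -!(svalP (ext _)).
  by rewrite (xiZ r (sval (ext g))) //= scalerBr.
exists (y0 + i x0) => h; rewrite linearD /=.
rewrite -[h (i x0)]/(linear_comp h i x0) -x0P.
rewrite -(@xiE h) => [|x]; first by rewrite addrC subrK.
by rewrite -(svalP (ext _)).
Qed.

End Dualizing.

(** * Modules over an artin algebra *)

Section RestrictScalars.
Context (R : comNzRingType) (A : algType R).
Implicit Types (M N X Y : lmodType A).

Lemma algebra_central (r : R) (a : A) : r%:A * a = a * r%:A.
Proof. by rewrite mulr_algl mulr_algr. Qed.

Lemma restrict_scalars_map_linear X Y (f : {linear X -> Y}) :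
  linear (f : restrict_scalars X -> restrict_scalars Y).
Proof. by move=> r x y; exact: linearP. Qed.

Definition restrict_scalars_map X Y (f : {linear X -> Y}) :
    {linear restrict_scalars X -> restrict_scalars Y} :=
  linear_pack (restrict_scalars_map_linear f).

Hypothesis hA : finitely_generated (A : lmodType R).

Lemma fg_restrict_scalars M :
  finitely_generated M -> finitely_generated (restrict_scalars M).
Proof.
case: hA => l [h hP] [k [g gP]].
apply: (@fg_of_family R _ (restrict_scalars M)
  (fun t : 'I_k * 'I_l => h t.2 *: g t.1)) => x.
have [a ->] := gP x.
have /choice[c cP] : forall i, exists c : 'I_l -> R, a i = \sum_j c j *: h j.
  by move=> i; exact: hP.
exists (fun t => c t.1 t.2).
rewrite -(pair_bigA _ (fun i j =>
  (c i j *: (h j *: g i : restrict_scalars M) : restrict_scalars M))).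
apply: eq_bigr => i _; rewrite (cP i) scaler_suml; apply: eq_bigr => j _.
by rewrite -[RHS]/((c i j)%:A *: (h j *: g i)) scalerA mulr_algl.
Qed.

Lemma fg_of_restrict_scalars M :
  finitely_generated (restrict_scalars M) -> finitely_generated M.
Proof.
move=> [k [g gP]]; exists k, g => x; have [a ->] := gP x.
by exists (fun i => (a i)%:A).
Qed.

Lemma artin_algebra_noetherian M :
  artinian R^o -> finitely_generated M -> noetherian M.
Proof.
move=> hR /fg_restrict_scalars fM N i ii.
apply: fg_of_restrict_scalars.
exact: (artin_noetherian hR fM (i := restrict_scalars_map i)).
Qed.

End RestrictScalars.

(** ** Homomorphism groups as [R]-modules *)

Definition HomR (R : comNzRingType) (A : algType R) (X Y : lmodType A) : Type :=
  Defs.Hom X Y.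

Section HomRModule.
Context (R : comNzRingType) (A : algType R) (X Y : lmodType A).

HB.instance Definition _ := GRing.Zmodule.on (HomR X Y).

Fact homR_scale_linear (r : R) (f : HomR X Y) :
  linear (fun x => r%:A *: (f : {linear X -> Y}) x).
Proof.
by move=> a x y; rewrite linearP scalerDr !scalerA algebra_central.
Qed.

Definition homR_scale (r : R) (f : HomR X Y) : HomR X Y :=
  linear_pack (homR_scale_linear r f).

Fact homR_scaleA r s f : homR_scale r (homR_scale s f) = homR_scale (r * s) f.
Proof. by apply: linear_ext => x /=; rewrite scalerA mulr_algl scalerA. Qed.
Fact homR_scale1 : left_id 1 homR_scale.
Proof. by move=> f; apply: linear_ext => x /=; rewrite !scale1r. Qed.
Fact homR_scaleDr : right_distributive homR_scale +%R.
Proof. by move=> r f g; apply: linear_ext => x /=; rewrite scalerDr. Qed.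
Fact homR_scaleDl f : {morph homR_scale^~ f : r s / r + s}.
Proof. by move=> r s; apply: linear_ext => x /=; rewrite !scalerDl. Qed.

HB.instance Definition _ := GRing.Zmodule_isLmodule.Build R (HomR X Y)
  homR_scaleA homR_scale1 homR_scaleDr homR_scaleDl.

Definition homR_fun (f : HomR X Y) : {linear X -> Y} := f.

Lemma homR_funD f g x : homR_fun (f + g) x = homR_fun f x + homR_fun g x.
Proof. by []. Qed.

Lemma homR_funZ (r : R) f x : homR_fun (r *: f) x = r%:A *: homR_fun f x.
Proof. by []. Qed.

End HomRModule.

Section HomRMaps.
Context (R : comNzRingType) (A : algType R).
Implicit Types (X Y Z : lmodType A).

Lemma homR_post_linear X Y Z (g : {linear Y -> Z}) :
  linear (fun f : HomR X Y => (linear_comp g f : HomR X Z)).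
Proof.
by move=> r f h; apply: linear_ext => x; rewrite /= linearD linearZ.
Qed.

Lemma homR_pre_linear X Y Z (g : {linear X -> Y}) :
  linear (fun f : HomR Y Z => (linear_comp f g : HomR X Z)).
Proof. by move=> r f h; apply: linear_ext. Qed.

Definition homR_post X Y Z (g : {linear Y -> Z}) :
    {linear HomR X Y -> HomR X Z} := linear_pack (@homR_post_linear X Y Z g).

Definition homR_pre X Y Z (g : {linear X -> Y}) :
    {linear HomR Y Z -> HomR X Z} := linear_pack (@homR_pre_linear X Y Z g).

(** [Hom(X, Y)] embeds in a power of [Y] by evaluation at generators of [X]. *)
Lemma fg_homR X Y : artinian R^o -> finitely_generated (A : lmodType R) ->
  finitely_generated X -> finitely_generated Y ->
  finitely_generated (HomR X Y).
Proof.
move=> hR hA [k [g gP]] /(fg_restrict_scalars hA) fY.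
have el : linear (fun f : HomR X Y =>
    [ffun i => homR_fun f (g i)] : {ffun 'I_k -> restrict_scalars Y}).
  by move=> r f h; apply/ffunP => i; rewrite !ffunE.
apply: (artin_noetherian hR (fg_power k fY) (i := linear_pack el)).
move=> f h /= /ffunP fh; apply: linear_ext => x; have [a ->] := gP x.
rewrite !linear_sum; apply: eq_bigr => i _; rewrite !linearZ /=.
by have := fh i; rewrite !ffunE /homR_fun => ->.
Qed.

End HomRMaps.

(** ** Dual pairs of projective modules *)

(** A perfect pairing of finitely generated projective modules. It covers the
    evaluations [P * P^* -> A] and [P'^* * P' -> A] at once, so that a single
    formula serves for [Tr] of a left module and for [Tr] of a dual module. *)
Definition dual_pair (R : comNzRingType) (A : algType R) (L : lmodType A)
    (L' : lmodType A^c) (b : L -> L' -> A) : Prop :=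
  [/\ forall y, linear (fun x => b x y : A^o),
      forall x, linear (fun y => b x y : (A^c)^o)
    & exists k (e : 'I_k -> L) (e' : 'I_k -> L'),
      (forall x, x = \sum_i b x (e' i) *: e i) /\
      (forall y, y = \sum_i (b (e i) y : A^c) *: e' i)].

Lemma dual_pair_linear_l (R : comNzRingType) (A : algType R) (L : lmodType A)
    (L' : lmodType A^c) (b : L -> L' -> A) : dual_pair b ->
  forall a x z y, b (a *: x + z) y = a * b x y + b z y.
Proof. by case=> bl _ _ a x z y; apply: bl. Qed.

Lemma dual_pair_linear_r (R : comNzRingType) (A : algType R) (L : lmodType A)
    (L' : lmodType A^c) (b : L -> L' -> A) : dual_pair b ->
  forall x (a : A) y z, b x ((a : A^c) *: y + z) = b x y * a + b x z.
Proof. by case=> _ br _ x a y z; apply: br. Qed.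

Lemma projective_dual_basis (A : pzRingType) (P : lmodType A) :
  finitely_generated P -> projective P ->
  exists k (e : 'I_k -> P) (e' : 'I_k -> star P),
    (forall x, x = \sum_i ((e' i : {linear P -> A^o}) x : A) *: e i) /\
    (forall h : star P, h = \sum_i ((h : {linear P -> A^o}) (e i) : A^c) *: e' i).
Proof.
move=> fP hP; have [k [p po]] := fg_free_cover fP.
have [s sP] := projective_lifts hP po (linear_id P).
exists k, (fun i => p (power_in A^o i 1)).
exists (fun i => linear_comp (power_pr A^o i) s).
have basis x : x = \sum_i ((s x) i : A) *: p (power_in A^o i 1).
  rewrite [LHS]sP [s x in LHS]power_in_pr linear_sum; apply: eq_bigr => i _.
  rewrite -[power_pr _ _ _]mulr1 -[_ * 1]/(_ *: (1 : A^o)).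
  by rewrite !linearZ.
split=> // h; apply: linear_ext => x; rewrite [in LHS](basis x) linear_sum.
elim/big_rec2: _ => [//|i y z _ ->]; rewrite linearZ.
by [].
Qed.

Lemma dual_pair_star (R : comNzRingType) (A : algType R) (P : lmodType A) :
  finitely_generated P -> projective P ->
  dual_pair (fun (x : P) (h : star P) => (h : {linear P -> A^o}) x : A).
Proof.
move=> fP hP; split=> [h|x|]; first exact: linearP.
- by [].
- exact: projective_dual_basis.
Qed.

Lemma dual_pair_star_op (R : comNzRingType) (A : algType R) (P : lmodType A^c) :
  finitely_generated P -> projective P ->
  dual_pair (fun (h : unconv (star P)) (x : P) =>
    (((h : star P) : {linear P -> (A^c)^o}) x : A)).
Proof.
move=> fP hP; split=> [x|h|].
- by [].
- exact: linearP.
- have [k [e [e' [eP e'P]]]] := projective_dual_basis fP hP.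
  by exists k, e', e; split.
Qed.

Section DualPair.
Context (R : comNzRingType) (A : algType R).
Context (L : lmodType A) (L' : lmodType A^c) (b : L -> L' -> A).
Hypothesis hb : dual_pair b.

Lemma dual_pair_projective : projective L.
Proof.
have [_ _ [k [e [e' [eP _]]]]] := hb; move=> X Y f g /range_setT_onto fo.
have [s sP] := onto_section fo.
have hl : linear (fun x => \sum_i b x (e' i) *: s (g (e i))).
  move=> a x y; rewrite scaler_sumr -big_split; apply: eq_bigr => i _.
  by rewrite (dual_pair_linear_l hb) scalerDl scalerA.
exists (linear_pack hl) => x; rewrite [in LHS](eP x) !linear_sum.
by apply: eq_bigr => i _; rewrite !linearZ /= sP.
Qed.

Definition pair_map (Y : lmodType A) (l : L') (y : Y) : HomR L Y.
Proof.
refine (@linear_pack _ _ _ (fun x => b x l *: y) _).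
by move=> a x z; rewrite (dual_pair_linear_l hb) scalerDl scalerA.
Defined.

Lemma pair_map_basis (Y : lmodType A) k (e : 'I_k -> L) (e' : 'I_k -> L')
    (h : HomR L Y) :
  (forall x, x = \sum_i b x (e' i) *: e i) ->
  h = \sum_i pair_map (e' i) (homR_fun h (e i)).
Proof.
move=> eP; apply: linear_ext => x.
rewrite [in LHS](eP x) linear_sum.
elim/big_rec2: _ => [//|i y z _ ->]; rewrite linearZ.
by [].
Qed.

Lemma pair_mapD (Y : lmodType A) (l : L') (y y' : Y) :
  pair_map l (y + y') = pair_map l y + pair_map l y'.
Proof. by apply: linear_ext => x /=; rewrite scalerDr. Qed.

Lemma pair_mapZ (Y : lmodType A) (l : L') (a : A) (y : Y) :
  pair_map l (a *: y) = pair_map ((a : A^c) *: l) y.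
Proof.
apply: linear_ext => x /=; rewrite scalerA; congr (_ *: _).
have b0 : b x 0 = 0.
  have := dual_pair_linear_r hb x (-1) l l.
  by rewrite scaleN1r addNr mulrN1 addNr.
by have := dual_pair_linear_r hb x a l 0; rewrite b0 !addr0.
Qed.

Lemma pair_mapDl (Y : lmodType A) (l l' : L') (y : Y) :
  pair_map (l + l') y = pair_map l y + pair_map l' y.
Proof.
apply: linear_ext => x /=; rewrite -scalerDl; congr (_ *: _).
by have := dual_pair_linear_r hb x 1 l l'; rewrite scale1r mulr1.
Qed.

Lemma pair_mapZl (Y : lmodType A) (l : L') (r : R) (y : Y) :
  pair_map ((r%:A : A^c) *: l) y = r *: pair_map l y.
Proof.
rewrite -pair_mapZ; apply: linear_ext => x /=.
by rewrite !scalerA algebra_central.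
Qed.

End DualPair.

(** ** Maps into a dual module *)

Section DualModule.
Context (R : comNzRingType) (J : lmodType R) (A : algType R) (T : lmodType A^c).

Definition dual_eval (f : dual_of_right J T) (t : T) : J :=
  ((f : dualmod J T) : {linear restrict_scalars T -> J}) t.

Lemma dual_evalDr f t t' : dual_eval f (t + t') = dual_eval f t + dual_eval f t'.
Proof. exact: (linearD ((f : dualmod J T) : {linear restrict_scalars T -> J})). Qed.

Lemma dual_eval_sum f (I : finType) (t : I -> T) :
  dual_eval f (\sum_i t i) = \sum_i dual_eval f (t i).
Proof. exact: (linear_sum ((f : dualmod J T) : {linear restrict_scalars T -> J})). Qed.

Lemma dual_evalZr f (r : R) t : dual_eval f ((r%:A : A^c) *: t) = r *: dual_eval f t.
Proof.
exact: (linearZZ ((f : dualmod J T) : {linear restrict_scalars T -> J}) r t).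
Qed.

Lemma dual_eval0 f : dual_eval f 0 = 0.
Proof. exact: (linear0 ((f : dualmod J T) : {linear restrict_scalars T -> J})). Qed.

Lemma dual_evalDl f g t : dual_eval (f + g) t = dual_eval f t + dual_eval g t.
Proof. by []. Qed.

Lemma dual_evalZl (a : A) f t : dual_eval (a *: f) t = dual_eval f ((a : A^c) *: t).
Proof. by []. Qed.

Lemma dual_eval_ext (f g : dual_of_right J T) :
  (forall t, dual_eval f t = dual_eval g t) -> f = g.
Proof. by move=> fg; apply: linear_ext. Qed.

Lemma dual_map_exists (Y : lmodType A) (B : Y -> T -> J) :
  (forall y y' t, B (y + y') t = B y t + B y' t) ->
  (forall (a : A) y t, B (a *: y) t = B y ((a : A^c) *: t)) ->
  (forall y t t', B y (t + t') = B y t + B y t') ->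
  (forall y (r : R) t, B y ((r%:A : A^c) *: t) = r *: B y t) ->
  exists u : {linear Y -> dual_of_right J T}, forall y t, dual_eval (u y) t = B y t.
Proof.
move=> BDl BZl BDr BZr.
have Bl y : linear (B y : restrict_scalars T -> J).
  by move=> r t t'; rewrite BDr; congr (_ + _); apply: BZr.
pose u y : dual_of_right J T := (linear_pack (Bl y) : {linear restrict_scalars T -> J}).
have ul : linear u.
  move=> a y y'; apply: dual_eval_ext => t.
  by rewrite dual_evalDl dual_evalZl /dual_eval /= BDl BZl.
by exists (linear_pack ul).
Qed.

End DualModule.

(** * The Auslander-Reiten formula *)

Section AuslanderReiten.
Context (R : comNzRingType) (J : lmodType R) (A : algType R).
Hypotheses (hR : artinian R^o) (hJ : dualizing J).

Section Formula.
Context (L1 L0 K : lmodType A) (d : {linear L1 -> L0}) (p : {linear L0 -> K}).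
Context (L1' L0' T : lmodType A^c) (d' : {linear L0' -> L1'}) (q : {linear L1' -> T}).
Context (b1 : L1 -> L1' -> A) (b0 : L0 -> L0' -> A).
Hypotheses (hb1 : dual_pair b1) (hb0 : dual_pair b0).
Hypotheses (po : onto p) (pd : forall x, p (d x) = 0)
  (dp : forall x, p x = 0 -> exists y, d y = x).
Hypotheses (qo : onto q) (qd : forall x, q (d' x) = 0)
  (dq : forall x, q x = 0 -> exists y, d' y = x).
Hypothesis adj : forall x y, b0 (d x) y = b1 x (d' y).

(** [Hom(X, D T)] consists of the forms on [Hom(L1, X)] that vanish on the maps
    which factor through [d]: both sides are the dual of the tensor product of
    [T] and [X]. This lemma and the next one give the two directions. *)
Lemma dual_form_exists (X : lmodType A) (u : {linear X -> dual_of_right J T}) :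
  exists phi : {linear HomR L1 X -> J},
    (forall l x, phi (pair_map hb1 l x) = dual_eval (u x) (q l)) /\
    (forall h : {linear L0 -> X}, phi (linear_comp h d) = 0).
Proof.
have [b1l b1r [k [e [e' [eP e'P]]]]] := hb1.
have pl : linear (fun g : HomR L1 X =>
    \sum_i dual_eval (u (homR_fun g (e i))) (q (e' i))).
  move=> r g h; rewrite scaler_sumr -big_split; apply: eq_bigr => i _.
  by rewrite homR_funD homR_funZ linearD dual_evalDl linearZZ dual_evalZl dual_evalZr.
have phiE l x : (linear_pack pl) (pair_map hb1 l x) = dual_eval (u x) (q l).
  rewrite [in RHS](e'P l) linear_sum dual_eval_sum; apply: eq_bigr => i _.
  rewrite -[homR_fun _ _]/(b1 (e i) l *: x) linearZZ dual_evalZl.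
  by rewrite linearZZ.
exists (linear_pack pl); split=> // h.
have [b0l b0r [k0 [e0 [e0' [e0P e0'P]]]]] := hb0.
have -> : (linear_comp h d : HomR L1 X) =
    \sum_i pair_map hb1 (d' (e0' i)) (h (e0 i)).
  apply: etrans (congr1 (homR_pre X d) (pair_map_basis hb0 (h : HomR L0 X) e0P)) _.
  rewrite linear_sum; apply: eq_bigr => i _; apply: linear_ext => x /=.
  by rewrite adj.
rewrite linear_sum big1 // => i _.
by rewrite phiE qd dual_eval0.
Qed.

Lemma map_of_dual_form (Y : lmodType A) (psi : {linear HomR L1 Y -> J}) :
  (forall h : {linear L0 -> Y}, psi (linear_comp h d) = 0) ->
  exists u : {linear Y -> dual_of_right J T},
    forall l y, dual_eval (u y) (q l) = psi (pair_map hb1 l y).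
Proof.
move=> psi0; have [s sP] := onto_section qo.
have eqpsi l l' y : q l = q l' -> psi (pair_map hb1 l y) = psi (pair_map hb1 l' y).
  move=> ll'; have [|z zP] := dq (x := l - l'); first by rewrite linearB ll' subrr.
  have -> : l = d' z + l' by rewrite zP subrK.
  rewrite pair_mapDl linearD /=.
  have -> : pair_map hb1 (d' z) y = linear_comp (pair_map hb0 z y) d.
    by apply: linear_ext => x /=; rewrite adj.
  by rewrite psi0 add0r.
have [||||u uP] := @dual_map_exists _ J _ T Y (fun y t => psi (pair_map hb1 (s t) y)).
- by move=> y y' t; rewrite pair_mapD linearD.
- by move=> a y t; rewrite pair_mapZ; apply: eqpsi; rewrite linearZ /= !sP.
- move=> y t t'; rewrite -linearD -pair_mapDl; apply: eqpsi.
  by rewrite linearD /= !sP.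
- move=> y r t; rewrite -linearZ -pair_mapZl; apply: eqpsi.
  by rewrite linearZ /= !sP.
by exists u => l y; rewrite uP; apply: eqpsi; rewrite sP.
Qed.

(** With [T] the transpose of [K] presented by [L1 -> L0], the functor
    [Hom(-, D T)] is the kernel of the map [D Hom(L1, -) -> D Hom(L0, -)].
    Hence it is exact on a short exact sequence [0 -> X -> Y -> Z -> 0] exactly
    when every map [L1 -> X] whose composite with [X -> Y] extends along
    [L1 -> L0] already extends with values in [X], and this is the lifting of
    maps [K -> Z] to [Y]. *)
Lemma transpose_formula (X Y Z : lmodType A) (i : {linear X -> Y})
    (pi : {linear Y -> Z}) :
  ses i pi -> lifts K pi <-> extends i (dual_of_right J T).
Proof.
move=> hi; split=> [hK u|hT g].
  (* The form of [u] is extended from [Hom(L1, X)] to [Hom(L1, Y)], with value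
     zero on the maps through [d]. *)
  have [phi [phiE phi0]] := dual_form_exists u.
  pose alpha (v : HomR L1 X * HomR L0 Y) : HomR L1 Y :=
    homR_post L1 i v.1 + homR_pre Y d v.2.
  have al : linear alpha.
    by move=> r v w; rewrite /alpha !linearP scalerDr addrACA.
  have bl : linear (fun v : HomR L1 X * HomR L0 Y => phi v.1).
    by move=> r v w; rewrite linearP.
  have [I [e [m [eo mi em]]]] := image_factor (linear_pack al).
  have [psi0 psi0P] : exists psi0 : {linear I -> J},
      forall v, psi0 (e v) = phi v.1.
    apply: (factor_onto (f := linear_pack bl) eo) => -[g h] gh0 /=.
    have gh x : i (homR_fun g x) + homR_fun h (d x) = 0.
      have : linear_pack al (g, h) = 0 by rewrite em gh0 linear0.
      by move=> /(congr1 (fun f : HomR L1 Y => homR_fun f x)).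
    have [k kP] : exists k : {linear K -> Z}, forall x, k (p x) = pi (homR_fun h x).
      apply: (factor_onto (f := linear_comp pi (homR_fun h)) po) => x.
      move=> /dp[y <-] /=; have := gh y => /(congr1 pi).
      by rewrite linearD (ses_zero hi) add0r linear0.
    have [k' k'P] := hK k.
    have [h1 h1P] : exists h1 : {linear L0 -> X},
        forall x, i (h1 x) = homR_fun h x - k' (p x).
      apply: (factor_inj (f := homR_fun h \- linear_comp k' p) (ses_inj hi)) => x.
      by apply: (ses_exact hi); rewrite /= linearB /= -k'P kP subrr.
    have -> : g = - (linear_comp h1 d : HomR L1 X).
      apply: linear_ext => x; apply: (ses_inj hi); apply/subr0_eq.
      rewrite -[(- _ : HomR L1 X) x]/(- h1 (d x)) linearN opprK h1P pd linear0 subr0.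
      exact: gh.
    by rewrite linearN phi0 oppr0.
  have [psi psiP] := dualizing_injective hJ psi0 mi.
  have psiE g h : psi (homR_post L1 i g + homR_pre Y d h) = phi g.
    by rewrite -[_ + _]/(linear_pack al (g, h)) em -psiP psi0P.
  have [|u' u'P] := @map_of_dual_form Y psi.
    by move=> h; have := psiE 0 h; rewrite !linear0 add0r.
  exists u' => x; apply: dual_eval_ext => t; have [l <-] := qo t.
  rewrite u'P -phiE -(psiE _ 0) linear0 addr0; congr (psi _).
  by apply: linear_ext => y /=; rewrite linearZ.
have [h hP] :=
  projective_lifts (dual_pair_projective hb0) (ses_onto hi) (linear_comp g p).
have [g1 g1P] : exists g1 : {linear L1 -> X}, forall x, i (g1 x) = h (d x).
  apply: (factor_inj (f := linear_comp h d) (ses_inj hi)) => x.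
  by apply: (ses_exact hi); rewrite /= -hP /= pd linear0.
have hT0 : submodule [set: HomR L0 X] by [].
have [[h1 h1P]|nh1] := EM (exists h1 : {linear L0 -> X}, forall x, h1 (d x) = g1 x).
  have [g' g'P] : exists g' : {linear K -> Y}, forall x, g' (p x) = h x - i (h1 x).
    apply: (factor_onto (f := h \- linear_comp i h1) po) => x /dp[y <-] /=.
    by rewrite h1P g1P subrr.
  exists g' => x; have [y <-] := po x.
  by rewrite g'P linearB (ses_zero hi) subr0 -hP.
(* Otherwise a form separates [g1] from the maps through [d]; extended to [Y],
   it would also have to vanish at [h d]. *)
have [|psi [psi0 psi1]] := dualizing_separate hR hJ (x := g1 : HomR L1 X)
    (submodule_image (homR_pre X d) hT0).
  move=> [h1 _ h1E]; apply: nh1; exists (homR_fun h1) => x.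
  by rewrite -h1E.
have [|u uP] := @map_of_dual_form X psi.
  by move=> h1; apply: psi0; exists h1.
have [u' u'P] := hT u.
have [phi' [phi'E phi'0]] := dual_form_exists u'.
case: psi1; rewrite -(phi'0 h).
have -> : linear_comp h d = linear_comp i g1 by apply: linear_ext => x /=.
have [b1l b1r [k [e [e' [eP e'P]]]]] := hb1.
rewrite [in LHS](pair_map_basis hb1 (g1 : HomR L1 X) eP) linear_sum.
rewrite (pair_map_basis hb1 (linear_comp i g1 : HomR L1 Y) eP) linear_sum.
by apply: eq_bigr => j _; rewrite phi'E -uP u'P.
Qed.

End Formula.

End AuslanderReiten.

(** * Syzygies and the translations *)

Section Additive.
Context (A : pzRingType).
Implicit Types X Y Z M N V W K L P I C B : lmodType A.

Lemma isomorphic_retract M N : isomorphic M N -> retract M N /\ retract N M.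
Proof. by move=> /isomorphic_maps[f [g [fg gf]]]; split; [exists g, f|exists f, g]. Qed.

Lemma lifts_retract M N Y Z (p : {linear Y -> Z}) :
  retract M N -> lifts M p -> lifts N p.
Proof.
move=> [s [r sr]] hM f; have [g gP] := hM (linear_comp f r).
by exists (linear_comp g s) => x; rewrite /= -gP /= sr.
Qed.

Lemma lifts_power k M Y Z (p : {linear Y -> Z}) :
  lifts M p -> lifts {ffun 'I_k -> M} p.
Proof.
move=> hM f.
have /choice[g gP] : forall j : 'I_k, exists g : {linear M -> Y},
    forall x, f (power_in M j x) = p (g x).
  by move=> j; exact: (hM (linear_comp f (power_in M j))).
have [g' g'P] := power_cotuple g; exists g' => x.
rewrite g'P linear_sum [in LHS](power_in_pr x) linear_sum.
by apply: eq_bigr => j _; rewrite gP.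
Qed.

Lemma lifts_add M N Y Z (p : {linear Y -> Z}) : in_add M N -> lifts M p -> lifts N p.
Proof. by move=> /in_add_retract[k hN] h; apply/(lifts_retract hN)/lifts_power. Qed.

Lemma extends_retract X Y (i : {linear X -> Y}) M N :
  retract M N -> extends i M -> extends i N.
Proof.
move=> [s [r sr]] hM f; have [g gP] := hM (linear_comp s f).
by exists (linear_comp r g) => x; rewrite /= -gP /= sr.
Qed.

Lemma extends_power k X Y (i : {linear X -> Y}) M :
  extends i M -> extends i {ffun 'I_k -> M}.
Proof.
move=> hM f.
have /choice[g gP] : forall j, exists g : {linear Y -> M},
    forall x, f x j = g (i x).
  by move=> j; exact: (hM (linear_comp (power_pr M j) f)).
have [g' g'P] := power_tuple g; exists g' => x; apply/ffunP => j.
by rewrite g'P gP.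
Qed.

Lemma extends_add X Y (i : {linear X -> Y}) M N :
  in_add M N -> extends i M -> extends i N.
Proof. by move=> /in_add_retract[k hN] h; apply/(extends_retract hN)/extends_power. Qed.

Lemma fg_add M N : in_add M N -> finitely_generated M -> finitely_generated N.
Proof. by move=> /in_add_retract[k hN] /(fg_power k); apply: fg_retract. Qed.

(** ** Projective covers, injective envelopes and syzygies *)

Lemma fg_projective_cover P M (p : {linear P -> M}) :
  projective_cover p -> finitely_generated M -> finitely_generated P.
Proof.
move=> [hP /range_setT_onto po pmin] /fg_free_cover[k [f fo]].
have [g gP] :=
  projective_lifts (projective_power (m := k) (@regular_projective A)) po f.
have hT : submodule [set: {ffun 'I_k -> A^o}] by [].
apply: (@fg_onto _ _ _ g _ (fg_power k (fg_regular A))) => x.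
suff : [set y | exists2 z, [set: {ffun 'I_k -> A^o}] z & g z = y] x.
  by case=> z _ <-; exists z.
rewrite (pmin _ (submodule_image g hT)) // => y.
have [z zP] := fo (p y); exists (g z), (y - g z); split; first by exists z.
  by rewrite /kernel /= linearB -gP zP subrr.
by rewrite addrC subrK.
Qed.

Lemma syzygy_ses M K : syzygy M K ->
  exists P (i : {linear K -> P}) (p : {linear P -> M}),
  [/\ ses i p, projective P & finitely_generated M -> finitely_generated P].
Proof.
move=> [P [p [i [pc ii /range_kernel_exact[ip pi]]]]]; exists P, i, p.
have [hP /range_setT_onto po _] := pc.
by split=> //; exact: fg_projective_cover pc.
Qed.

Lemma cosyzygy_ses M C : cosyzygy M C ->
  exists I (j : {linear M -> I}) (q : {linear I -> C}),
  ses j q /\ injective_envelope j.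
Proof.
move=> [I [j [q [je /range_setT_onto qo /range_kernel_exact[jq qj]]]]].
by exists I, j, q; split=> //; have [_ ji _] := je; split.
Qed.

Lemma fg_iter_syzygy k M K : (forall M, finitely_generated M -> noetherian M) ->
  finitely_generated M -> iter_syzygy k M K -> finitely_generated K.
Proof.
move=> hN; elim: k M => [|k IH] M fM /=.
  by move=> /isomorphic_retract[hK _]; apply: fg_retract fM.
move=> [L [/syzygy_ses[P [i [p [hip hP fP]]]]]]; apply: IH.
exact: hN (fP fM) _ _ (ses_inj hip).
Qed.

(** The injective envelope of [M] embeds, by essentiality, in any injective
    module that contains [M]. *)
Lemma fg_iter_cosyzygy k M C : (forall M, finitely_generated M -> noetherian M) ->
  (forall M, finitely_generated M -> exists (E : lmodType A) (i : {linear M -> E}),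
     [/\ injective i, injective_module E & finitely_generated E]) ->
  finitely_generated M -> iter_cosyzygy k M C -> finitely_generated C.
Proof.
move=> hN hE; elim: k M => [|k IH] M fM /=.
  by move=> /isomorphic_retract[hK _]; apply: fg_retract fM.
move=> [L [/cosyzygy_ses[I [j [q [hjq [hI ji jess]]]]]]]; apply: IH.
apply: (fg_onto (ses_onto hjq)).
have [E [i [ii hiE fE]]] := hE _ fM.
have [g gP] := hiE _ _ j i ji.
apply: (hN _ fE _ g); apply: inj_of_kernel0 => x gx.
suff : [set 0] x by [].
rewrite -(jess _ (submodule_kernel g)) //.
apply/predeqP => y; split=> [[gy [z _ zy]]|->].
  by move: gy; rewrite /kernel -zy /= -gP => /(inj_kernel0 ii) ->; rewrite linear0.
by split; [rewrite /kernel /= linear0|exists 0; rewrite ?linear0].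
Qed.

(** [Ext^(k+1)(M, W)] is [Hom(K, W)] modulo the maps that extend to the
    projective cover of the [k]-th syzygy of [M]. A map which lifts to [P]
    extends in this way because its lift does, by [Ext^(k+1)(M, P) = 0]. *)
Lemma ext_zero_iter_syzygy k M K P W (pi : {linear P -> W}) :
  iter_syzygy k.+1 M K -> ext_zero k M P -> lifts K pi -> ext_zero k M W.
Proof.
elim: k M => [|k IH] M /= [L [/syzygy_ses[P0 [i [p [hip hP0 _]]]]]].
  move=> /isomorphic_retract[_ hL] hM /(lifts_retract hL) hK.
  apply: (ext1_of_extends hip (projective_ext1 hP0)) => f.
  have [g gP] := hK f; have [h hP] := hM _ _ _ _ hip g.
  by exists (linear_comp pi h) => x; rewrite gP hP.
move=> hL hM hK; apply/(ext_zero_syzygy k W hip hP0).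
by apply: (IH _ hL) => //; apply/(ext_zero_syzygy k P hip hP0).
Qed.

(** The dual statement, for maps [W -> C] modulo those that lift to the
    injective envelope of the [k]-th cosyzygy. *)
Lemma ext_zero_iter_cosyzygy k M C I W (i : {linear W -> I}) :
  enough_projectives A -> finitely_generated W -> finitely_generated I ->
  iter_cosyzygy k.+1 M C -> ext_zero k I M -> extends i C -> ext_zero k W M.
Proof.
move=> hproj fW fI; elim: k M => [|k IH] M
    /= [L [/cosyzygy_ses[I0 [j [q [hjq [hI0 _ _]]]]]]].
  move=> /isomorphic_retract[_ hL] hM /(extends_retract hL) hC.
  apply: (ext1_of_lifts hjq (injective_ext1 hI0)) => f.
  have [g gP] := hC f; have [h hP] := ext1_lifts hjq hM g.
  by exists (linear_comp h i) => x; rewrite gP hP.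
move=> hL hM hC; apply/(ext_zero_cosyzygy hproj k fW hjq hI0).
apply: IH hL _ hC.
exact/(ext_zero_cosyzygy hproj k fI hjq hI0).
Qed.

End Additive.

(** ** The duality on finitely generated modules *)

Section Duality.
Context (R : comNzRingType) (J : lmodType R).
Hypotheses (hR : artinian R^o) (hJ : dualizing J).

Lemma fg_dual (M : lmodType R) : finitely_generated M ->
  exists k (h : 'I_k -> {linear M -> J}),
  forall f : {linear M -> J}, exists r : 'I_k -> R,
  forall x, f x = \sum_i r i *: h i x.
Proof.
move: M; apply: (artin_fg_ind (Pr := fun M => exists k (h : 'I_k -> {linear M -> J}),
    forall f : {linear M -> J}, exists r : 'I_k -> R,
    forall x, f x = \sum_i r i *: h i x) hR) => [M M0|m M x [mm xM mx]|].
- exists 0%N, (fun _ => \0) => f; exists (fun _ => 0) => x.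
  by rewrite big_ord0 [x]M0 linear0.
- have [s [s0 sm sgen]] := dualizing_socle hR hJ mm.
  have ro : onto (regular_map x) by move=> y; have [r ->] := xM y; exists r.
  have [h0 h0P] : exists h : {linear M -> J},
      forall r, h (regular_map x r) = regular_map s r.
    by apply: factor_onto => // r /mx/sm.
  exists 1%N, (fun _ => h0) => f.
  have [|r rP] := sgen (f x); first by move=> a /mx ax; rewrite -linearZ ax linear0.
  exists (fun _ => r) => y; have [a ->] := xM y; rewrite big_ord1.
  have -> : h0 (a *: x) = a *: s := h0P a.
  by rewrite linearZ /= rP !scalerA mulrC.
move=> X Y Z i p hip [k [h hX]] [l [g hZ]].
have /choice[h' h'P] : forall u, exists h' : {linear Y -> J}, forall x, h u x = h' (i x).
  by move=> u; exact: (dualizing_injective hJ (h u) (ses_inj hip)).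
pose G u := match split u with inl v => h' v | inr v => linear_comp (g v) p end.
exists (k + l)%N, G => f; have [r rP] := hX (linear_comp f i).
have scl (a : R) (e : {linear Y -> J}) : linear (fun y => a *: e y).
  by move=> b u v; rewrite linearP scalerDr !scalerA mulrC.
have suml : linear (fun y => f y - \sum_v r v *: h' v y).
  move=> a u v; rewrite linearP scalerBr addrACA -opprD; congr (_ - _).
  rewrite scaler_sumr -big_split; apply: eq_bigr => j _; exact: (scl (r j) (h' j)).
have [f' f'P] : exists f' : {linear Z -> J},
    forall y, f' (p y) = f y - \sum_v r v *: h' v y.
  apply: (factor_onto (f := linear_pack suml) (ses_onto hip)) => y.
  move=> /(ses_exact hip)[x <-] /=; apply/eqP; rewrite subr_eq0; apply/eqP.
  rewrite -[f _]/(linear_comp f i x) rP; apply: eq_bigr => v _.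
  by rewrite h'P.
have [t tP] := hZ f'.
exists (fun u => match split u with inl v => r v | inr v => t v end) => y.
rewrite big_split_ord /= /G.
have splitl v : split (lshift l v) = inl v := unsplitK (inl v).
have splitr v : split (rshift k v) = inr v := unsplitK (inr v).
under eq_bigr => v _ do rewrite splitl.
under [X in _ = _ + X]eq_bigr => v _ do rewrite splitr.
by rewrite /= -tP f'P addrC subrK.
Qed.

Context (A : algType R).
Hypothesis hA : finitely_generated (A : lmodType R).
Implicit Types X Y Z M N K C : lmodType A.

Lemma fg_dualmod M : finitely_generated M -> finitely_generated (dualmod J M).
Proof.
move=> /(fg_restrict_scalars hA) /fg_dual[k [h hP]].
exists k, h => f; have [r rP] := hP f; exists (fun i => (r i)%:A).
apply: linear_ext => x; rewrite rP; elim/big_rec2: _ => [//|i y z _ ->].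
rewrite -linearZZ.
by [].
Qed.

(** [Hom(X, D(A)) = D X] is exact in [X]. *)
Lemma dual_regular_injective : injective_module (dual_of_right J (A^c)^o).
Proof.
move=> X Y i f ii.
have fl : linear (fun x : restrict_scalars X => dual_eval (f x) 1).
  move=> r x y; rewrite -[_ *: x + y]/(r%:A *: (x : X) + y) linearP dual_evalDl.
  rewrite dual_evalZl; congr (_ + _).
  exact: (dual_evalZr (f x) r (1 : (A^c)^o)).
have [psi psiP] :=
  dualizing_injective hJ (i := restrict_scalars_map i) (linear_pack fl) ii.
have [||||g gP] := @dual_map_exists R J A (A^c)^o Y (fun y t => psi ((t : A) *: y)).
- by move=> y y' t; rewrite scalerDr; exact: linearD.
- by move=> a y t; rewrite scalerA.
- by move=> y t t'; rewrite scalerDl; exact: linearD.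
- move=> y r t; rewrite -linearZZ; congr (psi _).
  rewrite -[RHS]/(r%:A *: ((t : A) *: y)) scalerA algebra_central.
  by [].
exists g => x; apply: dual_eval_ext => t; rewrite gP.
have -> : (t : A) *: i x = i ((t : A) *: x) by rewrite linearZZ.
rewrite -psiP /= linearZZ dual_evalZl; congr (dual_eval _ _).
by rewrite -[RHS]/((1 : A) * (t : A)) mul1r.
Qed.

(** Generators of [D M] give the components of the embedding. *)
Lemma fg_embed_dual_regular M : finitely_generated M ->
  exists k (i : {linear M -> {ffun 'I_k -> dual_of_right J (A^c)^o}}), injective i.
Proof.
move=> /(fg_restrict_scalars hA) /fg_dual[k [h hP]].
have /choice[u uP] : forall i, exists u : {linear M -> dual_of_right J (A^c)^o},
    forall x t, dual_eval (u x) t = h i ((t : A) *: x).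
  move=> i; apply: dual_map_exists.
  - by move=> y y' t; rewrite scalerDr; exact: linearD.
  - by move=> a y t; rewrite scalerA.
  - by move=> y t t'; rewrite scalerDl; exact: linearD.
  - move=> y r t; rewrite -linearZZ; congr (h i _).
    rewrite -[RHS]/(r%:A *: ((t : A) *: y)) scalerA algebra_central.
    by [].
have [g gP] := power_tuple u; exists k, g; apply: inj_of_kernel0 => x.
move=> /ffunP gx; apply: contrapT => x0.
have [f] := dualizing_cogenerator hR hJ (M := restrict_scalars M) x0.
have [r ->] := hP f; case; rewrite big1 // => i _.
have := uP i x 1; rewrite -gP gx scale1r => <-.
by rewrite ffunE scaler0.
Qed.

Lemma dual_dual_retract C : finitely_generated C ->
  retract (dual_of_right J (dualmod J C)) C /\
  retract C (dual_of_right J (dualmod J C)).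
Proof.
move=> /(fg_restrict_scalars hA) /(fg_reflexive hR hJ) hC.
have [||||ev evP] := @dual_map_exists R J A (dualmod J C) C
    (fun x h => (h : {linear restrict_scalars C -> J}) x).
- by move=> y y' t; exact: (linearD (t : {linear restrict_scalars C -> J})).
- by [].
- by [].
- move=> y r t; exact: (linearZZ (t : {linear restrict_scalars C -> J}) r y).
have evi : injective ev.
  apply: inj_of_kernel0 => x ex; apply: contrapT => x0.
  have [f] := dualizing_cogenerator hR hJ (M := restrict_scalars C) x0.
  by rewrite -[f x](evP x (f : dualmod J C)) ex.
have evo : onto ev.
  move=> f; have [||x xP] := hC (fun h => dual_eval f (h : dualmod J C)).
  - move=> h h' h'' hE; rewrite -dual_evalDr; congr (dual_eval f _).
    exact: linear_ext.
  - move=> r h h' hE; rewrite -dual_evalZr; congr (dual_eval f _).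
    apply: linear_ext => x; rewrite hE -linearZZ.
    by [].
  exists x; apply: dual_eval_ext => t; rewrite evP.
  exact: esym (xP t).
have [g [evg gev]] := bijective_linear_inv evi evo.
by split; [exists ev, g|exists g, ev].
Qed.

(** ** The translations [tau] and [tau^-] *)

(** The Auslander-Reiten formula for defects: [Hom(K, -)] and [Hom(-, tau K)]
    are exact on the same short exact sequences. *)
Lemma tau_formula K N X Y Z (i : {linear X -> Y}) (p : {linear Y -> Z}) :
  finitely_generated K -> tau J K N -> ses i p -> lifts K p <-> extends i N.
Proof.
move=> fK [T [[P1 [P0 [L [pr [c [k [d [q [[prc cc]
  [ki /range_kernel_exact[kp pk]] dkc [/range_setT_onto qo
  /range_kernel_exact[qd dq]]]]]]]]]]] /isomorphic_retract[hN hN']]] hip.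
have fP0 := fg_projective_cover prc fK.
have fL : finitely_generated L by apply: (artin_algebra_noetherian hA hR fP0 ki).
have fP1 := fg_projective_cover cc fL.
have [hP0 /range_setT_onto po _] := prc; have [hP1 /range_setT_onto co _] := cc.
have pd x : pr (d x) = 0 by rewrite dkc /= kp.
have dp x : pr x = 0 -> exists y, d y = x.
  by move=> /pk[y <-]; have [z <-] := co y; exists z; rewrite dkc.
have := @transpose_formula R J A hR hJ P1 P0 K d pr (star P1) (star P0) T
  (star_map d) q _ _ (dual_pair_star fP1 hP1) (dual_pair_star fP0 hP0)
  po pd dp qo qd dq (fun _ _ => erefl) _ _ _ i p hip.
move=> [h1 h2]; split=> [/h1|/(extends_retract hN)//].
exact: extends_retract.
Qed.

Definition unconv_map (M N : lmodType A^c^c) (f : {linear M -> N}) :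
  {linear unconv M -> unconv N}.
Proof.
refine (@linear_pack A (unconv M) (unconv N) f _).
by move=> a x y; exact: (linearP f).
Defined.

(** A presentation [P1 -> P0 -> D C -> 0] dualizes to a presentation
    [P0^* -> P1^* -> tau^- C -> 0], and the module [D (D C)] that the formula for
    it produces is [C]. *)
Lemma tau_inv_formula C N X Y Z (i : {linear X -> Y}) (p : {linear Y -> Z}) :
  finitely_generated C -> tau_inv J C N -> ses i p -> lifts N p <-> extends i C.
Proof.
move=> fC [T [[P1 [P0 [L [pr [c [k [d [q [[prc cc]
  [ki /range_kernel_exact[kp pk]] dkc [/range_setT_onto qo
  /range_kernel_exact[qd dq]]]]]]]]]]] /isomorphic_retract[hN hN']]] hip.
have fD := fg_dualmod fC.
have fP0 := fg_projective_cover prc fD.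
have fL : finitely_generated L.
  exact: (@artin_algebra_noetherian R A^c hA P0 hR fP0 L k ki).
have fP1 := fg_projective_cover cc fL.
have [hP0 /range_setT_onto po _] := prc; have [hP1 /range_setT_onto co _] := cc.
have [hC hC'] := dual_dual_retract fC.
have pd x : pr (d x) = 0 by rewrite dkc /= kp.
have dp x : pr x = 0 -> exists y, d y = x.
  by move=> /pk[y <-]; have [z <-] := co y; exists z; rewrite dkc.
have := @transpose_formula R J A hR hJ (unconv (star P0)) (unconv (star P1))
  (unconv T) (unconv_map (star_map d)) (unconv_map q) P0 P1 (dualmod J C) d pr
  _ _ (dual_pair_star_op fP0 hP0) (dual_pair_star_op fP1 hP1)
  qo qd dq po pd dp (fun _ _ => erefl) _ _ _ i p hip.
move=> [h1 h2]; split=> [hL|hE].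
  by apply: extends_retract hC _; apply/h1/(lifts_retract hN).
by apply: (lifts_retract hN'); apply/h2/(extends_retract hC').
Qed.

End Duality.

(** * Perpendicular categories *)

Section Perpendicular.
Context (R : comNzRingType) (J : lmodType R) (A : algType R).
Hypotheses (hR : artinian R^o) (hJ : dualizing J).
Hypothesis hA : finitely_generated (A : lmodType R).
Context (Q : lmodType A).
Hypotheses (fQ : finitely_generated Q) (hgen : in_add Q A^o)
  (hcog : in_add Q (dual_of_right J (A^c)^o)).
Implicit Types X Y Z W : lmodType A.

Lemma fg_noetherian (M : lmodType A) : finitely_generated M -> noetherian M.
Proof. exact: (artin_algebra_noetherian hA hR). Qed.

Lemma fg_enough_projectives : enough_projectives A.
Proof. exact: noetherian_enough_projectives fg_noetherian. Qed.

Lemma fg_dual_regular : finitely_generated (dual_of_right J (A^c)^o).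
Proof. exact: fg_add hcog fQ. Qed.

Lemma injective_cover M : finitely_generated M ->
  exists k (C : lmodType A)
    (i : {linear M -> {ffun 'I_k -> dual_of_right J (A^c)^o}})
    (p : {linear {ffun 'I_k -> dual_of_right J (A^c)^o} -> C}),
  ses i p /\ finitely_generated C.
Proof.
move=> fM; have [k [i ii]] := fg_embed_dual_regular hR hJ hA fM.
have [C [p hp]] := cokernel_ses ii; exists k, C, i, p; split=> //.
exact: fg_onto (ses_onto hp) (fg_power k fg_dual_regular).
Qed.

Lemma dual_regular_power_injective k :
  injective_module {ffun 'I_k -> dual_of_right J (A^c)^o}.
Proof. exact/injective_power/dual_regular_injective. Qed.

Lemma fg_enough_injectives : enough_injectives A.
Proof.
move=> N /injective_cover[k [C [i [p [hip fC]]]]].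
exists {ffun 'I_k -> dual_of_right J (A^c)^o}, C, i, p; split=> //.
exact: dual_regular_power_injective.
Qed.

Lemma ext_zero_add_l k M N X :
  finitely_generated M -> finitely_generated X ->
  in_add M N -> ext_zero k M X -> ext_zero k N X.
Proof.
move=> fM fX hN; have fN := fg_add hN fM.
have [l hN'] := in_add_retract hN.
move=> /(ext_zero_power_l fg_enough_projectives l)/(_ fM).
apply: (ext_zero_retract_l fg_enough_projectives fg_enough_injectives) => //.
exact: fg_power.
Qed.

Context (m : nat) (K N C N' : lmodType A).
Hypothesis hself : forall k, (k < m)%N -> ext_zero k Q Q.
Hypotheses (hK : iter_syzygy m Q K) (hN : tau J K N) (hQN : in_add Q N).
Hypotheses (hC : iter_cosyzygy m Q C) (hN' : tau_inv J C N') (hQN' : in_add Q N').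

Let fK : finitely_generated K. Proof. exact: fg_iter_syzygy fg_noetherian fQ hK. Qed.

Let fC : finitely_generated C.
Proof.
apply: fg_iter_cosyzygy fg_noetherian _ fQ hC => M fM.
have [k [D [i [p [hip _]]]]] := injective_cover fM.
exists {ffun 'I_k -> dual_of_right J (A^c)^o}, i; split; first exact: ses_inj hip.
  exact: dual_regular_power_injective.
exact/fg_power/fg_dual_regular.
Qed.

(** With [d = m + 1] and [N] the module [tau^d Q], this is a consequence of the
    higher Auslander-Reiten duality [Ext^i(Y, N) = D Ext^(d-i)(Q, Y)], at
    [i = k + 1]. For [k = 0], [Ext^1(Y, N) = 0] makes [Hom(K, -)] exact on a free
    presentation of [Y], where [K] is the [m]-th syzygy of [Q]; syzygies of [Y]
    shift the degree down, because [Q] has no extensions by projectives. *)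
Lemma ext_tau_shift k Y : (k < m)%N -> finitely_generated Y ->
  ext_zero k Y N -> ext_zero (m.-1 - k) Q Y.
Proof.
elim: k Y => [|k IH] Y km fY hY; have [l [p po]] := fg_free_cover fY;
  have [L [i hip]] := kernel_ses po.
  have hm : m = m.-1.+1 by rewrite prednK.
  rewrite subn0; move: hK; rewrite hm => hK'.
  apply: (ext_zero_iter_syzygy (pi := p) hK').
    apply/ext_zero_power_r/(ext_zero_add_r hgen)/hself.
    by rewrite -hm.
  by apply/(tau_formula hR hJ hA fK hN hip); apply: (hY _ _ _ _ hip).
have hP := projective_power (m := l) (@regular_projective A).
have fL := fg_noetherian (fg_power l (fg_regular A)) (ses_inj hip).
have kE : (m.-1 - k = (m.-1 - k.+1).+1)%N.
  by rewrite subnS prednK // subn_gt0; case: (m) km.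
apply: (ext_zero_r_last hip).
  apply/ext_zero_power_r/(ext_zero_add_r hgen)/hself.
  by case: (m) km => // m' _; rewrite ltnS leq_subr.
rewrite -kE; apply: IH => //; first exact: ltnW.
exact/(ext_zero_syzygy k N hip hP).
Qed.

(** The dual argument, with cosyzygies of [Y] in [add D(A)]. *)
Lemma ext_tau_inv_shift k Y : (k < m)%N -> finitely_generated Y ->
  ext_zero k N' Y -> ext_zero (m.-1 - k) Y Q.
Proof.
have fN' := fg_add hQN' fQ.
have hI l : forall k, (k < m)%N ->
    ext_zero k {ffun 'I_l -> dual_of_right J (A^c)^o} Q.
  move=> j jm; apply: (ext_zero_power_l fg_enough_projectives).
    by apply: ext_zero_add_l hcog _ => //; apply: hself.
  exact: fg_dual_regular.
elim: k Y => [|k IH] Y km fY hY; have [l [Z [i [p [hip fZ]]]]] := injective_cover fY;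
  have fI := fg_power l fg_dual_regular.
  have hm : m = m.-1.+1 by rewrite prednK.
  rewrite subn0; move: hC; rewrite hm => hC'.
  apply: (ext_zero_iter_cosyzygy (i := i) fg_enough_projectives fY fI hC').
    by apply: hI; rewrite -hm.
  by apply/(tau_inv_formula hR hJ hA fC hN' hip)/(ext1_lifts hip).
have kE : (m.-1 - k = (m.-1 - k.+1).+1)%N.
  by rewrite subnS prednK // subn_gt0; case: (m) km.
apply: (ext_zero_l_first fg_enough_projectives fg_enough_injectives fY fI fZ fQ hip).
  by apply: hI; case: (m) km => // m' _; rewrite ltnS leq_subr.
rewrite -kE; apply: IH => //; first exact: ltnW.
apply/(ext_zero_cosyzygy fg_enough_projectives k fN' hip) => //.
exact: dual_regular_power_injective.
Qed.

(** Both translates of [Q] lie in [add Q], so orthogonality to [Q] on one side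
    passes to a translate of [Q], and the duality moves it to the other side. *)
Lemma perp_eq Y : finitely_generated Y ->
  (forall k, (k < m)%N -> ext_zero k Q Y) <->
  (forall k, (k < m)%N -> ext_zero k Y Q).
Proof.
have subm k : (k < m)%N -> (m.-1 - k < m)%N /\ (m.-1 - (m.-1 - k) = k)%N.
  by case: (m) => // m' km; rewrite subKn // ltnS leq_subr.
move=> fY; split=> h k /subm[km <-].
  apply: ext_tau_inv_shift => //.
  exact: ext_zero_add_l hQN' (h _ km).
by apply: ext_tau_shift => //; apply: ext_zero_add_r hQN (h _ km).
Qed.

End Perpendicular.

(** * The functor [Hom(Q, -)] for a generator [Q] *)

Section HomGenerator.
Context (A : pzRingType) (Q : lmodType A).
Implicit Types X Y Z : lmodType A.

Definition homQ_fun X (f : HomQ Q X) : {linear Q -> X} := f.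

Lemma homQ_ext X (f g : HomQ Q X) : (forall x, homQ_fun f x = homQ_fun g x) -> f = g.
Proof. exact: linear_ext. Qed.

Lemma homQ_funD X (f g : HomQ Q X) x :
  homQ_fun (f + g) x = homQ_fun f x + homQ_fun g x.
Proof. by []. Qed.

Lemma homQ_fun_sum X (I : finType) (f : I -> HomQ Q X) x :
  homQ_fun (\sum_i f i) x = \sum_i homQ_fun (f i) x.
Proof. by elim/big_rec2: _ => // i y z _ <-. Qed.

Lemma homQ_funZ X (s : EndOp Q) (f : HomQ Q X) x :
  homQ_fun (s *: f) x = homQ_fun f ((s : {linear Q -> Q}) x).
Proof. by []. Qed.

Lemma homQ_mapE X Y (f : {linear X -> Y}) (g : HomQ Q X) x :
  homQ_fun (homQ_map Q f g) x = f (homQ_fun g x).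
Proof. by []. Qed.

Lemma homQ_map_inj X Y (f : {linear X -> Y}) :
  injective f -> injective (homQ_map Q f).
Proof.
move=> fi g h gh; apply: homQ_ext => x; apply: fi.
by rewrite -!homQ_mapE gh.
Qed.

(** ** Free modules over [End^op(Q)] *)

Lemma homQ_power_decomp k (h : HomQ Q {ffun 'I_k -> Q}) :
  h = \sum_i (linear_comp (power_pr Q i) (homQ_fun h) : EndOp Q) *:
             (power_in Q i : HomQ Q {ffun 'I_k -> Q}).
Proof.
apply: homQ_ext => x; rewrite homQ_fun_sum [LHS]power_in_pr.
by apply: eq_bigr => i _; rewrite homQ_funZ.
Qed.

Lemma homQ_power_fg k : finitely_generated (HomQ Q {ffun 'I_k -> Q}).
Proof.
exists k, (fun i => power_in Q i) => h.
exists (fun i => linear_comp (power_pr Q i) (homQ_fun h)).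
exact: homQ_power_decomp.
Qed.

(** [Hom(Q, Q^k)] is free on the inclusions of the factors. *)
Lemma homQ_power_map k (U : lmodType (EndOp Q)) (u : 'I_k -> U) :
  exists g : {linear HomQ Q {ffun 'I_k -> Q} -> U},
  (forall h, g h = \sum_i (linear_comp (power_pr Q i) (homQ_fun h) : EndOp Q) *: u i).
Proof.
have gl : linear (fun h : HomQ Q {ffun 'I_k -> Q} =>
    \sum_i (linear_comp (power_pr Q i) (homQ_fun h) : EndOp Q) *: u i).
  move=> s h h'; rewrite scaler_sumr -big_split; apply: eq_bigr => i _.
  rewrite /= scalerA -scalerDl; congr (_ *: _).
  by apply: linear_ext => x /=; rewrite ffunE.
by exists (linear_pack gl).
Qed.

Lemma homQ_power_projective k : projective (HomQ Q {ffun 'I_k -> Q}).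
Proof.
move=> U V p f /range_setT_onto po; have [s sP] := onto_section po.
have [g gP] := homQ_power_map (fun i : 'I_k => s (f (power_in Q i))).
exists g => h; rewrite gP linear_sum [in LHS](homQ_power_decomp h) linear_sum.
by apply: eq_bigr => i _; rewrite !linearZZ sP.
Qed.

(** ** Full faithfulness *)

Hypothesis hgen : in_add Q A^o.

Lemma generator_unit : exists k (q : 'I_k -> Q) (alpha : 'I_k -> {linear Q -> A^o}),
  \sum_j alpha j (q j) = 1.
Proof.
have [k [s [r sr]]] := in_add_retract hgen.
exists k, (fun j => s 1 j), (fun j => linear_comp r (power_in Q j)).
by rewrite -[RHS]sr [s 1 in RHS](power_in_pr (s 1)) linear_sum.
Qed.

Lemma generator_span : exists k (q : 'I_k -> Q) (alpha : 'I_k -> {linear Q -> A^o}),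
  forall X (x : X), x = \sum_j linear_comp (regular_map x) (alpha j) (q j).
Proof.
have [k [q [alpha a1]]] := generator_unit; exists k, q, alpha => X x.
by rewrite -[LHS]scale1r -a1 scaler_suml.
Qed.

Lemma generator_lifts_onto Y Z (p : {linear Y -> Z}) : lifts Q p -> onto p.
Proof.
have [k [q [alpha sp]]] := generator_span.
move=> hp z; have /choice[g gP] : forall j, exists g : {linear Q -> Y},
    forall x, linear_comp (regular_map z) (alpha j) x = p (g x).
  by move=> j; exact: hp.
exists (\sum_j g j (q j)); rewrite linear_sum [RHS]sp.
by apply: eq_bigr => j _; rewrite -gP.
Qed.

Lemma homQ_faithful X Y (f f' : {linear X -> Y}) :
  (forall g : {linear Q -> X}, forall x, f (g x) = f' (g x)) -> forall x, f x = f' x.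
Proof.
have [k [q [alpha sp]]] := generator_span.
move=> ff' x; rewrite [x]sp !linear_sum; apply: eq_bigr => j _; exact: ff'.
Qed.

(** [f x] is forced by writing [x] as a sum of values [g_j (q_j)] of maps
    [g_j : Q -> X]. *)
Lemma homQ_full X Y (F : {linear HomQ Q X -> HomQ Q Y}) :
  exists f : {linear X -> Y}, forall g, F g = homQ_map Q f g.
Proof.
have [k [q [alpha sp]]] := generator_span.
pose rho (x : X) j : HomQ Q X := linear_comp (regular_map x) (alpha j).
pose f x := \sum_j homQ_fun (F (rho x j)) (q j).
have fF (g : HomQ Q X) y : f (homQ_fun g y) = homQ_fun (F g) y.
  rewrite [y in RHS](sp Q) linear_sum; apply: eq_bigr => j _.
  have -> : rho (homQ_fun g y) j =
      (linear_comp (regular_map y) (alpha j) : EndOp Q) *: g.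
    by apply: homQ_ext => x; rewrite homQ_funZ /= linearZ.
  by rewrite linearZZ homQ_funZ.
have fD x y : f (x + y) = f x + f y.
  rewrite /f -big_split; apply: eq_bigr => j _.
  have -> : rho (x + y) j = rho x j + rho y j.
    by apply: homQ_ext => z; rewrite homQ_funD /= scalerDr.
  by rewrite linearD homQ_funD.
have f0 : f 0 = 0 by apply: (addrI (f 0)); rewrite -fD !addr0.
have fs (I : finType) (x : I -> X) : f (\sum_i x i) = \sum_i f (x i).
  by elim/big_rec2: _ => // i y z _ <-.
have fl : linear f.
  move=> a x y; rewrite fD; congr (_ + _).
  rewrite [x in LHS]sp scaler_sumr fs [x in RHS]sp fs scaler_sumr.
  apply: eq_bigr => j _.
  rewrite -[linear_comp _ _ _]/(homQ_fun (rho x j) (q j)) -linearZZ !fF.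
  by rewrite linearZZ.
exists (linear_pack fl) => g; apply: homQ_ext => y.
by rewrite homQ_mapE /= fF.
Qed.

(** Finitely generated projective [End^op(Q)]-modules come from [add Q]: the
    idempotent which splits such a module off [Hom(Q, Q^k)] is induced by an
    idempotent of [Q^k]. *)
Lemma projective_homQ (P : lmodType (EndOp Q)) :
  finitely_generated P -> projective P ->
  exists k Q' (phi : {linear P -> HomQ Q Q'}) (psi : {linear HomQ Q Q' -> P}),
  [/\ retract {ffun 'I_k -> Q} Q', cancel phi psi & cancel psi phi].
Proof.
move=> [k [g gP]] hP.
have [p pP] := homQ_power_map g.
have po : onto p.
  move=> x; have [a ->] := gP x.
  exists (\sum_i a i *: (power_in Q i : HomQ Q _)); rewrite linear_sum.
  apply: eq_bigr => i _; rewrite linearZZ pP (bigD1 i) //= big1 => [|j ji].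
    rewrite addr0 scalerA; congr (_ *: _); apply: linear_ext => y /=.
    by rewrite ffunE eqxx.
  rewrite (_ : linear_comp _ _ = 0 :> EndOp Q) ?scale0r//.
  by apply: linear_ext => y /=; rewrite ffunE eq_sym (negPf ji).
have [s sP] := projective_lifts hP po (linear_id P).
have [eps epsP] := homQ_full (linear_comp s p).
have [Q' [e [m [eo mi em]]]] := image_factor eps.
have epsK x : eps (eps x) = eps x.
  apply: (homQ_faithful (f := linear_comp eps eps)) => h y /=.
  rewrite -[eps (h y)]/(homQ_fun (homQ_map Q eps h) y) -epsP.
  rewrite -[eps _]/(homQ_fun (homQ_map Q eps (linear_comp s p h)) y) -epsP /=.
  by rewrite -sP.
have emK y : e (m y) = y.
  have [x <-] := eo y; apply: mi.
  by rewrite -em -em epsK em.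
exists k, Q', (linear_comp (homQ_map Q e) s), (linear_comp p (homQ_map Q m)).
split=> [|x|h]; first by exists m, e.
  rewrite /=.
  have -> : homQ_map Q m (homQ_map Q e (s x)) = homQ_map Q eps (s x).
    by apply: homQ_ext => y; rewrite !homQ_mapE em.
  by rewrite -epsP /= -sP -sP.
rewrite /=.
have -> : s (p (homQ_map Q m h)) = homQ_map Q eps (homQ_map Q m h) by rewrite -epsP.
by apply: homQ_ext => y; rewrite !homQ_mapE em !emK.
Qed.

End HomGenerator.

(** ** Approximations by powers of [Q] *)

Section Approximations.
Context (R : comNzRingType) (A : algType R) (Q : lmodType A).
Hypotheses (hR : artinian R^o) (hA : finitely_generated (A : lmodType R)).
Hypothesis fQ : finitely_generated Q.
Implicit Types X Y Z : lmodType A.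

Definition central_scale X (r : R) : {linear X -> X} :=
  homR_fun (r *: (linear_id X : HomR X X)).

Lemma fg_homQ X : finitely_generated X -> finitely_generated (HomQ Q X).
Proof.
move=> fX; have [k [h hP]] := fg_homR hR hA fQ fX.
exists k, h => f; have [r rP] := hP f.
exists (fun i => central_scale Q (r i)); rewrite [LHS]rP.
elim/big_rec2: _ => [//|i y z _ ->].
by apply: homQ_ext => x; rewrite [RHS]homQ_funD homQ_funZ /homQ_fun /= linearZ.
Qed.

(** The components are generators of [Hom(X, Q)] over [R]; scalars of [R] act on
    [Q] by endomorphisms. *)
Lemma left_approximation X : finitely_generated X ->
  exists k (i : {linear X -> {ffun 'I_k -> Q}}), extends i Q.
Proof.
move=> fX; have [k [h hP]] := fg_homR hR hA fX fQ.
have [i iP] := power_tuple (fun j => homR_fun (h j)); exists k, i => f.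
have [r rP] := hP f.
have [g gP] := power_cotuple (fun j => central_scale Q (r j)).
exists g => x; rewrite gP -[f x]/(homR_fun (f : HomR X Q) x) rP.
rewrite (_ : homR_fun _ x = \sum_j homR_fun (r j *: h j) x); last first.
  by elim/big_rec2: _ => // j y z _ <-.
by apply: eq_bigr => j _; rewrite iP.
Qed.

Lemma right_approximation X : finitely_generated X ->
  exists k (p : {linear {ffun 'I_k -> Q} -> X}), lifts Q p.
Proof.
move=> fX; have [k [h hP]] := fg_homR hR hA fQ fX.
have [p pP] := power_cotuple (fun j => homR_fun (h j)); exists k, p => f.
have [r rP] := hP f.
have [g gP] := power_tuple (fun j => central_scale Q (r j)).
exists g => x; rewrite pP -[f x]/(homR_fun (f : HomR Q X) x) rP.
rewrite (_ : homR_fun _ x = \sum_j homR_fun (r j *: h j) x); last first.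
  by elim/big_rec2: _ => // j y z _ <-.
by apply: eq_bigr => j _; rewrite gP homR_funZ /= linearZ.
Qed.

End Approximations.

(** * Gorenstein projective [End^op(Q)]-modules *)

Section GorensteinProjective.
Context (R : comNzRingType) (J : lmodType R) (A : algType R).
Hypotheses (hR : artinian R^o) (hJ : dualizing J).
Hypothesis hA : finitely_generated (A : lmodType R).
Context (Q : lmodType A).
Hypotheses (fQ : finitely_generated Q) (hgen : in_add Q A^o)
  (hcog : in_add Q (dual_of_right J (A^c)^o)).
Context (m : nat) (K N C N' : lmodType A).
Hypothesis hself : forall k, (k < m)%N -> ext_zero k Q Q.
Hypotheses (hK : iter_syzygy m Q K) (hN : tau J K N) (hQN : in_add Q N).
Hypotheses (hC : iter_cosyzygy m Q C) (hN' : tau_inv J C N') (hQN' : in_add Q N').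
Implicit Types X Y Z : lmodType A.

Definition ext_perp X : Prop :=
  finitely_generated X /\ forall k, (k < m)%N -> ext_zero k Q X.

(** The short exact sequences from which total resolutions are spliced. *)
Definition approx_step X Z : Prop :=
  exists k (i : {linear X -> {ffun 'I_k -> Q}}) (p : {linear {ffun 'I_k -> Q} -> Z}),
  [/\ ses i p, lifts Q p & extends i Q].

Let hproj := fg_enough_projectives hR hA.
Let hinj := fg_enough_injectives hR hJ hA fQ hcog.
Let perpE := perp_eq hR hJ hA fQ hgen hcog hself hK hN hQN hC hN' hQN'.

(** Exactness of [Hom(Q, -)] on the left approximation sequence of [X] comes
    from [Ext^1(Q, X) = 0] when [m > 0]; for [m = 0] there is no such condition
    and the Auslander-Reiten formula replaces it. *)
Lemma approx_step_right X : ext_perp X -> exists Z, ext_perp Z /\ approx_step X Z.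
Proof.
move=> [fX hX]; have [k [i hi]] := left_approximation hR hA fQ fX.
have fQk := fg_power k fQ.
have ii : injective i.
  have [l [u ui]] := fg_embed_dual_regular hR hJ hA fX.
  have [j [s [r sr]]] := in_add_retract hcog.
  apply: inj_of_kernel0 => x ix; apply: (inj_kernel0 ui); apply/ffunP => a.
  rewrite [RHS]ffunE; apply: (can_inj sr); rewrite linear0; apply/ffunP => b.
  have [g gP] :=
    hi (linear_comp (power_pr _ b) (linear_comp s (linear_comp (power_pr _ a) u))).
  by have := gP x; rewrite ix linear0 /= => ->; rewrite ffunE.
have [Z [p hip]] := cokernel_ses ii.
have fZ : finitely_generated Z := fg_onto (ses_onto hip) fQk.
have hp : lifts Q p.
  have [m0|m0] := posnP m; last exact: ext1_lifts hip (hX 0%N m0).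
  move: hK; rewrite m0 => /isomorphic_retract[QK KQ].
  apply: (lifts_retract KQ).
  apply/(tau_formula hR hJ hA (fg_retract QK fQ) hN hip).
  exact: extends_add hQN hi.
exists Z; split; last by exists k, i, p.
split=> //; apply/(perpE fZ) => -[|j] jm.
  by apply: (ext1_of_extends hip _ hi); apply: (ext_zero_power_l hproj k (hself jm) fQ).
apply: (ext_zero_l_last hproj hinj fX fQk fZ fQ hip).
  exact: ((perpE fX).1 hX _ (ltnW jm)).
exact: (ext_zero_power_l hproj k (hself jm) fQ).
Qed.

Lemma approx_step_left Z : ext_perp Z -> exists X, ext_perp X /\ approx_step X Z.
Proof.
move=> [fZ hZ]; have [k [p hp]] := right_approximation hR hA fQ fZ.
have fQk := fg_power k fQ.
have po := generator_lifts_onto hgen hp.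
have [X [i hip]] := kernel_ses po.
have fX : finitely_generated X := fg_noetherian hR hA fQk (ses_inj hip).
have hi : extends i Q.
  have [m0|m0] := posnP m; last exact: ((perpE fZ).1 hZ _ m0 _ _ _ _ hip).
  move: hC; rewrite m0 => /isomorphic_retract[QC CQ].
  apply: (extends_retract CQ).
  apply/(tau_inv_formula hR hJ hA (fg_retract QC fQ) hN' hip).
  exact: lifts_add hQN' hp.
exists X; split; last by exists k, i, p.
split=> // -[|j] jm.
  by apply: (ext1_of_lifts hip _ hp); apply: (ext_zero_power_r (k := 0) k (hself jm)).
apply: (ext_zero_r_first hip (hZ _ (ltnW jm))).
exact: ext_zero_power_r (hself jm).
Qed.

(** Splicing left and right approximation sequences gives an exact complex of
    powers of [Q] which stays exact under [Hom(Q, -)] and [Hom(-, Q)]; its image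
    under [Hom(Q, -)] is a total resolution by free modules. *)
Lemma homQ_Gproj X : ext_perp X -> Gproj (HomQ Q X).
Proof.
move=> hX; split; first by case: hX => fX _; apply: fg_homQ.
(* The kernels of the complex form a family indexed by the integers, with
   approximation sequences stated between [x i] and [x (i + 1)]; the sequences
   are chosen afterwards, so that no map has to be transported along an equality
   of integers. *)
pose T := {X : lmodType A | ext_perp X}.
have /choice[r rP] : forall t : T, exists t' : T, approx_step (sval t) (sval t').
  move=> t; have [Z [hZ tZ]] := approx_step_right (svalP t).
  by exists (exist _ Z hZ).
have /choice[l lP] : forall t : T, exists t' : T, approx_step (sval t') (sval t).
  move=> t; have [Z [hZ tZ]] := approx_step_left (svalP t).
  by exists (exist _ Z hZ).
pose t0 : T := exist _ X hX.
pose x (i : int) : lmodType A :=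
  sval (match i with Posz n => iter n r t0 | Negz n => iter n.+1 l t0 end).
have step (i : int) : approx_step (x i) (x (i + 1)).
  case: i => n.
    have -> : Posz n + 1 = Posz n.+1 by rewrite intS addrC.
    exact: rP.
  case: n => [|n].
    have -> : Negz 0 + 1 = Posz 0 by [].
    exact: lP.
  have -> : Negz n.+1 + 1 = Negz n.
    by rewrite !NegzE [n.+2%:Z]intS opprD addrAC addNr add0r.
  exact: lP.
pose data i := {k : nat & prod {linear x i -> {ffun 'I_k -> Q}}
  {linear {ffun 'I_k -> Q} -> x (i + 1)}}.
have dataP i : {D : data i |
    ses (projT2 D).1 (projT2 D).2 /\
    (lifts Q (projT2 D).2 /\ extends (projT2 D).1 Q)}.
  apply: cid; have [k [u [p [h1 h2 h3]]]] := step i.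
  by exists (existT _ k (u, p)).
pose k i := projT1 (sval (dataP i)).
pose u i : {linear x i -> {ffun 'I_(k i) -> Q}} := (projT2 (sval (dataP i))).1.
pose p i : {linear {ffun 'I_(k i) -> Q} -> x (i + 1)} := (projT2 (sval (dataP i))).2.
have hup i : ses (u i) (p i) := (svalP (dataP i)).1.
have hp i : lifts Q (p i) := (svalP (dataP i)).2.1.
have hu i : extends (u i) Q := (svalP (dataP i)).2.2.
exists (fun i => HomQ Q {ffun 'I_(k i) -> Q}).
exists (fun i => homQ_map Q (linear_comp (u (i + 1)) (p i))).
exists (homQ_map Q (u 0)); split; last 2 first.
- exact: homQ_map_inj (ses_inj (hup 0)).
- apply/range_kernel_exact; split=> [h|h h0].
    by apply: homQ_ext => y; rewrite !homQ_mapE /= (ses_zero (hup 0)) linear0.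
  have [h' h'P] : exists h' : {linear Q -> x 0}, forall y, u 0 (h' y) = homQ_fun h y.
    apply: (factor_inj (ses_inj (hup 0))) => y; apply: (ses_exact (hup 0)).
    apply: (inj_kernel0 (ses_inj (hup (0 + 1)))).
    by have := congr1 (fun g => homQ_fun g y) h0.
  by exists h'; apply: homQ_ext => y; rewrite homQ_mapE -h'P.
split=> i; first by split; [exact: homQ_power_fg|exact: homQ_power_projective].
  apply/range_kernel_exact; split=> [h|h h0].
    apply: homQ_ext => y; rewrite !homQ_mapE /= (ses_zero (hup (i + 1))).
    by rewrite linear0.
  have [h' h'P] : exists h' : {linear Q -> x (i + 1)},
      forall y, u (i + 1) (h' y) = homQ_fun h y.
    apply: (factor_inj (ses_inj (hup _))) => y; apply: (ses_exact (hup _)).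
    apply: (inj_kernel0 (ses_inj (hup (i + 1 + 1)))).
    by have := congr1 (fun g => homQ_fun g y) h0.
  have [g gP] := hp i h'.
  by exists g; apply: homQ_ext => y; rewrite homQ_mapE /= -gP h'P.
move=> f f0.
have fl : linear (f : HomQ Q {ffun 'I_(k (i + 1)) -> Q} -> HomQ Q Q).
  by move=> s a b; exact: (linearP f).
have [phi phiP] := homQ_full hgen (linear_pack fl).
have phi0 y : phi (u (i + 1) y) = 0.
  have [y' <-] := ses_onto (hup i) y.
  apply: (homQ_faithful hgen (f := linear_comp phi (linear_comp (u (i + 1)) (p i)))
    (f' := \0)) => h z /=.
  have := f0 h; rewrite -[f _]/(linear_pack fl _) phiP.
  by move=> /(congr1 (fun g => homQ_fun g z)).
have [phi' phi'P] : exists phi' : {linear x (i + 1 + 1) -> Q},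
    forall y, phi' (p (i + 1) y) = phi y.
  apply: (factor_onto (ses_onto (hup (i + 1)))) => y.
  by move=> /(ses_exact (hup (i + 1)))[z <-].
have [g gP] := hu (i + 1 + 1) phi'.
have gl : linear (homQ_map Q g : _ -> (EndOp Q)^o).
  by move=> s a b; exact: (linearP (homQ_map Q g)).
exists (linear_pack gl) => h; rewrite -[f h]/(linear_pack fl h) phiP.
by apply: homQ_ext => y; rewrite homQ_mapE -phi'P gP.
Qed.

(** A total resolution of [M] consists of modules [Hom(Q, Q_i)] and of maps
    induced by [Q_i -> Q_(i+1)]; the kernel [X] of [Q_0 -> Q_1] is sent to [M],
    and exactness of [Hom(Q, -)] on all the kernel sequences yields the
    vanishing of [Ext^k(Q, X)] by dimension shifting. *)
Lemma Gproj_homQ (M : lmodType (EndOp Q)) : Gproj M ->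
  exists X, ext_perp X /\ isomorphic (HomQ Q X) M.
Proof.
move=> [fM [P [d [j [[hP hd _] ji /range_kernel_exact[dj jd]]]]]].
pose data i := {Q' : lmodType A &
  ({linear P i -> HomQ Q Q'} * {linear HomQ Q Q' -> P i})%type}.
have dataP i : {D : data i |
    (exists k, retract {ffun 'I_k -> Q} (projT1 D)) /\
    (cancel (projT2 D).1 (projT2 D).2 /\ cancel (projT2 D).2 (projT2 D).1)}.
  apply: cid; have [fP hPi] := hP i.
  have [k [Q' [phi [psi [h1 h2 h3]]]]] := projective_homQ hgen fP hPi.
  by exists (existT _ Q' (phi, psi)); split=> //; exists k.
pose q i := projT1 (sval (dataP i)).
pose phi i : {linear P i -> HomQ Q (q i)} := (projT2 (sval (dataP i))).1.
pose psi i : {linear HomQ Q (q i) -> P i} := (projT2 (sval (dataP i))).2.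
have hq i : exists k, retract {ffun 'I_k -> Q} (q i) := (svalP (dataP i)).1.
have phiK i : cancel (phi i) (psi i) := (svalP (dataP i)).2.1.
have psiK i : cancel (psi i) (phi i) := (svalP (dataP i)).2.2.
have del i : {del : {linear q i -> q (i + 1)} |
    forall h, phi (i + 1) (d i (psi i h)) = homQ_map Q del h}.
  apply: cid.
  exact: (homQ_full hgen (linear_comp (phi (i + 1)) (linear_comp (d i) (psi i)))).
pose dl i := sval (del i).
have dlP i h : phi (i + 1) (d i (psi i h)) = homQ_map Q (dl i) h := svalP (del i) h.
have dd i x : dl (i + 1) (dl i x) = 0.
  apply: (homQ_faithful hgen (f := linear_comp (dl (i + 1)) (dl i)) (f' := \0)) => h y.
  have /range_kernel_exact[d0 _] := hd i.
  rewrite -[LHS]/(homQ_fun (homQ_map Q (dl (i + 1)) (homQ_map Q (dl i) h)) y).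
  by rewrite -!dlP phiK d0 linear0.
pose kdata i := {X : lmodType A & {linear X -> q i}}.
have kdataP i : {D : kdata i |
    injective (projT2 D) /\ forall y, dl i y = 0 <-> exists x, projT2 D x = y}.
  apply: cid; have [X [kap hk]] := submodule_module (submodule_kernel (dl i)).
  by exists (existT _ X kap).
pose X i := projT1 (sval (kdataP i)).
pose kap i : {linear X i -> q i} := projT2 (sval (kdataP i)).
have kapi i : injective (kap i) := (svalP (kdataP i)).1.
have kapP i y : dl i y = 0 <-> exists x, kap i x = y := (svalP (kdataP i)).2 y.
have kap0 i x : dl i (kap i x) = 0 by apply/kapP; exists x.
have seq i : exists p : {linear q i -> X (i + 1)},
    ses (kap i) p /\ lifts Q p.
  have [p pP] : exists p : {linear q i -> X (i + 1)},
      forall y, kap (i + 1) (p y) = dl i y.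
    by apply: factor_inj => // y; apply/kapP/dd.
  have hp : lifts Q p.
    move=> f; have /range_kernel_exact[_ dE] := hd i.
    have [|g gP] := dE (psi (i + 1) (linear_comp (kap (i + 1)) f : HomQ Q _)).
      apply: (can_inj (phiK _)); rewrite dlP linear0; apply: homQ_ext => y.
      by rewrite homQ_mapE /homQ_fun /= kap0.
    exists (homQ_fun (phi i g)) => y; apply: kapi; rewrite pP.
    rewrite -homQ_mapE -dlP phiK gP psiK.
    by [].
  exists p; split=> //; split=> //; last exact: (generator_lifts_onto hgen).
    by move=> x; apply: kapi; rewrite pP kap0 linear0.
  by move=> y y0; apply/kapP; rewrite -pP y0 linear0.
have hX k i : (k < m)%N -> ext_zero k Q (X i).
  elim: k i => [|k IH] i km; have [p [hkp hp]] := seq i; have [l hl] := hq i.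
    apply: (ext1_of_lifts hkp _ hp); apply: (ext_zero_retract_r (k := 0) hl).
    exact: ext_zero_power_r (hself km).
  apply: (ext_zero_r_first hkp (IH _ (ltnW km))).
  exact/(ext_zero_retract_r hl)/ext_zero_power_r/hself.
exists (X 0); split.
  split=> [|k km]; last exact: hX.
  have [l hl] := hq 0.
  exact: (fg_noetherian hR hA (fg_retract hl (fg_power l fQ)) (kapi 0)).
have mapi := homQ_map_inj (Q := Q) (kapi 0).
have [f fP] : exists f : {linear M -> HomQ Q (X 0)},
    forall x, homQ_map Q (kap 0) (f x) = phi 0 (j x).
  apply: (factor_inj (f := linear_comp (phi 0) j)) => // x.
  have [h hP'] : exists h : {linear Q -> X 0},
      forall y, kap 0 (h y) = homQ_fun (phi 0 (j x)) y.
    apply: factor_inj => // y; apply/kapP.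
    by rewrite -homQ_mapE -dlP phiK dj linear0.
  by exists h; apply: homQ_ext => y; rewrite homQ_mapE hP'.
have fi : injective f.
  by move=> x y xy; apply: ji; apply: (can_inj (phiK 0)); rewrite -!fP xy.
have fo : onto f.
  move=> h; have [|x xP] := jd (psi 0 (homQ_map Q (kap 0) h)).
    apply: (can_inj (phiK _)); rewrite dlP linear0; apply: homQ_ext => y.
    by rewrite !homQ_mapE kap0.
  by exists x; apply: mapi; rewrite fP xP psiK.
have [g [fg gf]] := bijective_linear_inv fi fo.
by exists g; exists f.
Qed.

End GorensteinProjective.

(** * Equivalences of categories *)

Section Equivalence.
Context (C D : category).

Lemma fully_faithful_equivalence (F : functor C D) :
  (forall X Y (g : Defs.hom (F X) (F Y)), exists f : Defs.hom X Y, fmap F f = g) ->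
  (forall X Y (f f' : Defs.hom X Y), fmap F f = fmap F f' -> f = f') ->
  (forall Y : D, exists (X : C) (u : Defs.hom (F X) Y), is_iso u) ->
  is_equivalence F.
Proof.
move=> full faith ess.
have data (Y : D) : {t : {X : C & (Defs.hom (F X) Y * Defs.hom Y (F X))%type} |
    compose (projT2 t).2 (projT2 t).1 = idm _ /\
    compose (projT2 t).1 (projT2 t).2 = idm _}.
  apply: cid; have [X [u [v uv]]] := ess Y.
  by exists (existT _ X (u, v)).
pose g Y := projT1 (sval (data Y)).
pose u Y : Defs.hom (F (g Y)) Y := (projT2 (sval (data Y))).1.
pose v Y : Defs.hom Y (F (g Y)) := (projT2 (sval (data Y))).2.
have vu Y : compose (v Y) (u Y) = idm _ := (svalP (data Y)).1.
have uv Y : compose (u Y) (v Y) = idm _ := (svalP (data Y)).2.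
have pre X Y (h : Defs.hom (F X) (F Y)) := cid (full X Y h).
pose gm Y Y' (f : Defs.hom Y Y') : Defs.hom (g Y) (g Y') :=
  sval (pre _ _ (compose (v Y') (compose f (u Y)))).
have gmP Y Y' (f : Defs.hom Y Y') :
    fmap F (gm Y Y' f) = compose (v Y') (compose f (u Y)) := svalP (pre _ _ _).
have gm1 Y : gm Y Y (idm Y) = idm (g Y).
  by apply: faith; rewrite gmP fmap1 compose1m vu.
have gmM X Y Z (h : Defs.hom Y Z) (f : Defs.hom X Y) :
    gm X Z (compose h f) = compose (gm Y Z h) (gm X Y f).
  apply: faith; rewrite fmapM !gmP -!composeA; congr (compose _ (compose _ _)).
  by rewrite composeA uv compose1m.
exists (@Functor D C g gm gm1 gmM); split.
  exists (fun X => sval (pre (g (F X)) X (u (F X)))); split=> [X Y f|X] /=.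
    apply: faith; rewrite !fmapM (svalP (pre _ _ (u (F X)))).
    rewrite (svalP (pre _ _ (u (F Y)))) gmP composeA uv compose1m.
    by [].
  exists (sval (pre _ _ (v (F X)))); split; apply: faith;
    by rewrite fmapM fmap1 (svalP (pre _ _ (u (F X)))) (svalP (pre _ _ (v (F X)))).
exists u; split=> [X Y f|Y] /=; first by rewrite gmP composeA uv compose1m.
by exists (v Y).
Qed.

End Equivalence.

(** * The equivalence *)

Theorem theorem2p13 (R : comNzRingType) (J : lmodType R) (Gamma : algType R)
    (Q : lmodType Gamma) (n : nat)
    (hJ : dualizing J)
    (hGamma : artin_algebra Gamma)
    (hn : (2 <= n)%N)
    (hself : DTr_selfinjective J Gamma n)
    (hQ : self_orthogonal_DTr_closed_gen_cogen J n Q) :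
  (forall M : lmodType Gamma,
     right_perp (n - 2) Q M <-> left_perp (n - 2) Q M) /\
  gives_equivalence (hom_functor Q)
    (right_perp (n - 2) Q) (@Gproj (EndOp Q)).
Proof.
case: hGamma => hR hA.
case: hQ => [[fQ _] /in_add_prod[hgen hcog] horth [N [N'
  [[K [hK hN]] [C [hC hN']] /in_add_prod[hQN hQN']]]]].
have m1 : (n - 1).-1 = (n - 2)%N by rewrite -subnS.
rewrite {}m1 in hK hC.
set m := (n - 2)%N in horth hK hC *.
have hproj := fg_enough_projectives hR hA.
have ExtE (X Y : lmodType Gamma) : finitely_generated X ->
    (forall i, (1 <= i <= m)%N -> Ext_vanishes i X Y) <->
    (forall k, (k < m)%N -> ext_zero k X Y).
  move=> fX; split=> [h k km|h [//|k] km].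
    exact: (Ext_vanishesE k Y hproj fX).1 (h k.+1 km).
  exact: (Ext_vanishesE k Y hproj fX).2 (h k km).
have hself' k : (k < m)%N -> ext_zero k Q Q by apply: (ExtE Q Q fQ).1.
have rightE (X : lmodType Gamma) : right_perp m Q X <-> ext_perp Q m X.
  split=> -[fX hX]; split=> //; first exact: (ExtE Q X fQ).1.
  exact: (ExtE Q X fQ).2.
have perpE := perp_eq hR hJ hA fQ hgen hcog hself' hK hN hQN hC hN' hQN'.
split=> [X|].
  split=> -[fX hX]; split=> //.
    by apply/(ExtE X Q fX)/(perpE X fX)/(ExtE Q X fQ).
  by apply/(ExtE Q X fQ)/(perpE X fX)/(ExtE X Q fX).
have PP' (X : lmodType Gamma) : right_perp m Q X -> Gproj (hom_functor Q X).
  move=> /rightE.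
  exact: (homQ_Gproj hR hJ hA fQ hgen hcog hself' hK hN hQN hC hN' hQN').
exists PP'; apply: fully_faithful_equivalence => [X Y g|X Y f f' ff'|Y].
- have [f fP] := homQ_full hgen (g : {linear HomQ Q (sval X) -> HomQ Q (sval Y)}).
  by exists f; apply: linear_ext => h; rewrite fP.
- apply: linear_ext; apply: (homQ_faithful hgen) => h x.
  exact: (congr1 (fun F : {linear HomQ Q (sval X) -> HomQ Q (sval Y)} =>
    homQ_fun (F h) x) ff').
have [X [hX /isomorphic_maps[f [g [fg gf]]]]] :=
  Gproj_homQ hR hA fQ hgen hself' (svalP Y).
exists (exist _ X ((rightE X).2 hX)), f, g.
by split; apply: linear_ext => x /=; rewrite ?fg ?gf.
Qed.
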